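(* Let $p\ge 1$, let $X$ and $X'$ be $C^p$ Banach manifolds with boundary, let $X''\subset X'$ be a neat $C^p$ Banach submanifold, let $f:X\to X'$ be a $C^p$ map, and let $x_0\in f^{-1}(X'')$. If $f$ is transverse to $X''$ at $x_0$, then there are a chart $(V,\psi,(E,\alpha))$ for $X$ with $x_0\in V$ and $\psi(x_0)=0$, such that the subspace $$L:=d\psi(x_0)\left((df(x_0))^{-1}(T_{f(x_0)}X'')\right)\subset E$$ is closed and has a closed complement in $E$ (let $\iota_L:L\to E$ be the continuous inclusion), and the map $$g:=\psi^{-1}\circ\iota_L\restriction(\psi(V)\cap L):\ \psi(V)\cap L\to \psi^{-1}(\psi(V)\cap L)\subset X$$ is a $C^p$ embedding from the relatively open subset $\psi(V)\cap L$ of $L\cap E_\alpha^+$ onto a $C^p$ submanifold $\psi^{-1}(\psi(V)\cap L)$ of $X$. Moreover, the following hold: (1) $\psi^{-1}(\psi(V)\cap L)=V\cap f^{-1}(X'')$; (2) $T_x(f^{-1}(X''))=(df(x))^{-1}(T_{f(x)}X'')=(d\psi(x))^{-1}L$ for all $x\in V\cap f^{-1}(X'')$. Finally, $f^{-1}(X'')\cap V$ is a neat $C^p$ Banach submanifold of $V$.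
   Context: Half spaces and differentiability: for a real Banach space $E$ and $\alpha$ either a nonzero continuous linear functional on $E$ or the constant function $1$ (this second choice accounts for manifolds without boundary), put $E_\alpha^+=\{x\in E:\alpha(x)\ge 0\}$ and $E_\alpha^0=\{x\in E:\alpha(x)=0\}$. A map $h:U\to F$ from an open subset $U$ of $E_\alpha^+$ to a Banach space $F$ is differentiable at $x\in U$ if there is a bounded linear $u:E\to F$ (necessarily unique) with $\|h(y)-h(x)-u(y-x)\|_F/\|y-x\|_E\to 0$ as $y\to x$ in $U$; $C^p$ maps ($p\in\{1,2,\dots\}\cup\{\infty\}$) are defined accordingly. Manifolds: a $C^p$ Banach manifold with boundary is a set $X$ with a (maximal) $C^p$ atlas of charts $(U,\varphi,(E,\alpha))$, where $U\subset X$, and $\varphi:U\to E_\alpha^+$ is injective with image open in $E_\alpha^+$, and the chart changes are $C^p$. The boundary $\partial X$ is the set of points $x$ with $\alpha(\varphi(x))=0$ for some (equivalently any) chart at $x$, and $\operatorname{Int}(X)=X\setminus\partial X$. The boundary $\partial X$ is a $C^p$ Banach manifold without boundary. The tangent space $T_xX$ is isomorphic to $E$ for interior and for boundary points $x$. $C^p$ maps and their derivatives $df(x)$ are defined via charts. Submanifolds: a subset $Y\subset X$ is a $C^p$ submanifold if for every $y\in Y$ there are a chart $(U,\varphi,(E,\alpha))$ of $X$ with $y\in U$, $\varphi(y)=0$, a closed linear subspace $F\subset E$ with a closed complement in $E$, and $\mu$ (a continuous linear functional on $F$ or the constant $1$) such that $\varphi(U\cap Y)=\varphi(U)\cap F_\mu^+$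 and this is an open subset of $F_\mu^+$. A submanifold $Y\subset X$ is neat if $\partial Y=Y\cap\partial X$. A $C^p$ embedding is a $C^p$ map whose image is a $C^p$ submanifold and which is a $C^p$ diffeomorphism onto its image. Transversality: for a $C^p$ map $f:X\to X'$ and a $C^p$ submanifold $X''\subset X'$, write $\partial f:=f\restriction\partial X:\partial X\to X'$. The map $f$ is transverse to $X''$ at $x\in X$ if one of the following holds: (i) $x\notin f^{-1}(X'')$; (ii) $x\in f^{-1}(X'')\cap\operatorname{Int}(X)$, $T_{f(x)}X'=\operatorname{Ran}df(x)+T_{f(x)}X''$, and $(df(x))^{-1}(T_{f(x)}X'')$ has a closed complement in $T_xX$; (iii) $x\in f^{-1}(X'')\cap\partial X$, $T_{f(x)}X'=\operatorname{Ran}d(\partial f)(x)+T_{f(x)}X''$, and $(d(\partial f)(x))^{-1}(T_{f(x)}X'')$ has a closed complement in $T_x(\partial X)$. *)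

(* Defs.v *)
From HB Require Import structures.
From mathcomp Require Import all_boot all_order all_algebra.
From mathcomp Require Import all_classical all_reals topology normedtype.
Set Implicit Arguments.
Unset Strict Implicit.
Unset Printing Implicit Defensive.
Import Order.TTheory GRing.Theory Num.Theory.
Import numFieldNormedType.Exports.
Local Open Scope classical_set_scope.
Local Open Scope ring_scope.

(* The space L(E, F) of bounded linear maps with the operator norm. *)
Section bounded_linear_maps.
Context {R : realType} (E F : normedModType R).

Definition bounded_linear : {pred E -> F} :=
  mem [set f : E -> F | linear f /\ continuous f].

Record blin := Blin { blin_fun :> E -> F; blinP : blin_fun \in bounded_linear }.

HB.instance Definition _ := [isSub for blin_fun].
HB.instance Definition _ := [Choice of blin by <:].

Lemma bounded_linear_submod : submod_closed bounded_linear.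
Proof.
split.
  rewrite inE; split=> [a x y /=|]; first by rewrite scaler0 addr0.
  exact: cst_continuous.
move=> a f g; rewrite !inE => -[lf cf] [lg cg]; split.
  move=> b x y; rewrite !fctE lf lg /= !scalerDr !scalerA [a * b]mulrC.
  by rewrite -!addrA; congr (_ + _); rewrite addrCA.
move=> x; apply: continuousD; last exact: cg.
by apply: continuousZl_tmp; exact: cf.
Qed.

HB.instance Definition _ :=
  GRing.isSubmodClosed.Build _ _ bounded_linear bounded_linear_submod.
HB.instance Definition _ := [SubChoice_isSubLmodule of blin by <:].

Definition opnorm (u : blin) : R :=
  sup [set `|u x| | x in [set x : E | `|x| <= 1]].

Lemma blin_linear (u : blin) : linear u.
Proof. by have := blinP u; rewrite inE => -[]. Qed.

Lemma blin_continuous (u : blin) : continuous u.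
Proof. by have := blinP u; rewrite inE => -[]. Qed.

Lemma blin0 (u : blin) : u 0 = 0.
Proof. by have := blin_linear u (-1) 0 0; rewrite !scaleN1r !addNr. Qed.

Lemma blinZ (u : blin) a x : u (a *: x) = a *: u x.
Proof. by have := blin_linear u a x 0; rewrite !addr0 blin0 addr0. Qed.

Lemma opnorm_has_sup (u : blin) :
  has_sup [set `|u x| | x in [set x : E | `|x| <= 1]].
Proof.
split; first by exists `|u 0|; exists 0; rewrite //= normr0 ler01.
pose u' : {linear E -> F} :=
  HB.pack (blin_fun u) (GRing.isLinear.Build _ _ _ _ _ (blin_linear u)).
have : bounded_near u' (nbhs 0).
  exact/linear_bounded_continuous/blin_continuous.
move/bounded_funP => /(_ 1)[M uM]; exists M => _ [x /= x1 <-]; exact: uM.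
Qed.

Lemma le_opnorm_ball (u : blin) x : `|x| <= 1 -> `|u x| <= opnorm u.
Proof.
by move=> x1; apply: ub_le_sup; [have [] := opnorm_has_sup u|exists x].
Qed.

Lemma opnorm_le (u : blin) M :
  (forall x, `|x| <= 1 -> `|u x| <= M) -> opnorm u <= M.
Proof.
move=> uM; apply: ge_sup; first by have [] := opnorm_has_sup u.
by move=> _ [x /= x1 <-]; exact: uM.
Qed.

Lemma le_opnorm (u : blin) x : `|u x| <= opnorm u * `|x|.
Proof.
have [->|x0] := eqVneq x 0; first by rewrite blin0 !normr0 mulr0.
rewrite -ler_pdivrMr ?normr_gt0// mulrC -[_^-1]gtr0_norm ?invr_gt0 ?normr_gt0//.
by rewrite -normrZ -blinZ le_opnorm_ball// normfZV.
Qed.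

Lemma ler_opnormD (u v : blin) : opnorm (u + v) <= opnorm u + opnorm v.
Proof.
apply: opnorm_le => x x1; rewrite (_ : (u + v) x = u x + v x)//.
by rewrite (le_trans (ler_normD _ _))// lerD// le_opnorm_ball.
Qed.

Lemma opnormZ (a : R) (u : blin) : opnorm (a *: u) = `|a| * opnorm u.
Proof.
have le b (v : blin) : opnorm (b *: v) <= `|b| * opnorm v.
  apply: opnorm_le => x x1; rewrite (_ : (b *: v) x = b *: v x)//.
  by rewrite normrZ ler_wpM2l// le_opnorm_ball.
apply/eqP; rewrite eq_le le /=.
have [->|a0] := eqVneq a 0.
  rewrite normr0 mul0r (le_trans (normr_ge0 ((0 *: u : blin) 0)))//.
  by rewrite le_opnorm_ball ?normr0.
rewrite -ler_pdivlMl ?normr_gt0// -normfV.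
by have := le a^-1 (a *: u); rewrite scalerA mulVf// scale1r.
Qed.

Lemma opnorm_eq0 (u : blin) : opnorm u = 0 -> u = 0.
Proof.
move=> u0; apply/val_inj/funext => x /=; apply/eqP.
by rewrite -normr_le0 (le_trans (le_opnorm u x))// u0 mul0r.
Qed.

HB.instance Definition _ :=
  Lmodule_isNormed.Build R blin ler_opnormD opnormZ opnorm_eq0.

End bounded_linear_maps.

Section closed_subspaces.
Context {R : realType} (E : completeNormedModType R).

Record closed_subspace := ClosedSubspace {
  cs_set :> set E;
  cs_submod : submod_closed [pred x | x \in cs_set];
  cs_closed : closed cs_set }.

Section closed_subspace_type.
Variable L : closed_subspace.

Definition cs_pred : {pred E} := [pred x | x \in (L : set E)].

Record cs_type := CsVec { cs_val : E; cs_valP : cs_val \in cs_pred }.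

HB.instance Definition _ := [isSub for cs_val].
HB.instance Definition _ := [Choice of cs_type by <:].
HB.instance Definition _ :=
  GRing.isSubmodClosed.Build _ _ cs_pred (cs_submod L).
HB.instance Definition _ := [SubChoice_isSubLmodule of cs_type by <:].

Let nm (v : cs_type) : R := `|cs_val v|.

Lemma cs_ler_normD (v w : cs_type) : nm (v + w) <= nm v + nm w.
Proof. exact: ler_normD. Qed.

Lemma cs_normrZ (a : R) (v : cs_type) : nm (a *: v) = `|a| * nm v.
Proof. exact: normrZ. Qed.

Lemma cs_normr0_eq0 (v : cs_type) : nm v = 0 -> v = 0.
Proof. by move=> /eqP; rewrite normr_eq0 => /eqP v0; apply/val_inj. Qed.

HB.instance Definition _ :=
  Lmodule_isNormed.Build R cs_type cs_ler_normD cs_normrZ cs_normr0_eq0.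

Lemma cs_cauchy_cvg (F : set_system cs_type) :
  ProperFilter F -> cauchy F -> cvg F.
Proof.
move=> FF /cauchy_ballP Fc.
have cF : cauchy (cs_val @ F).
  apply/cauchy_ballP => e e0; have [[P Q] /= [FP FQ] PQ] := Fc _ e0.
  exists (cs_val @` P, cs_val @` Q) => /=.
    by split; [apply: filterS FP|apply: filterS FQ] => v Pv; exists v.
  move=> [_ _] /= [[v Pv <-] [w Qw <-]]; have := PQ (v, w) (conj Pv Qw).
  by rewrite -!ball_normE.
have /cauchy_cvg cvF := cF.
have Ll : lim (cs_val @ F) \in cs_pred.
  rewrite !inE; apply: (closed_cvg _ (@cs_closed L) _ _ cvF).
  by apply: nearW => v; have := cs_valP v; rewrite !inE.
apply/cvg_ex; exists (CsVec Ll); apply/cvgrPdist_lt => e e0.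
by move/cvgrPdist_lt : cvF => /(_ _ e0).
Qed.

HB.instance Definition _ := Uniform_isComplete.Build cs_type cs_cauchy_cvg.

End closed_subspace_type.

Definition complemented (L : closed_subspace) := exists G : closed_subspace,
  (L : set E) `&` G = [set 0] /\
  [set x + y | x in (L : set E) & y in (G : set E)] = setT.

End closed_subspaces.

Section half_spaces.
Context {R : realType}.

Definition halfspace_fun (E : normedModType R) (alpha : E -> R) :=
  [/\ scalar alpha, continuous alpha & exists x, alpha x != 0] \/
  alpha = cst 1.

Definition hs_pos (E : normedModType R) (alpha : E -> R) : set E :=
  [set x | 0 <= alpha x].

Definition hs_bd (E : normedModType R) (alpha : E -> R) : set E :=
  [set x | alpha x = 0].

Definition open_in (E : normedModType R) (A U : set E) :=
  exists2 O : set E, open O & U = O `&` A.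

End half_spaces.

(* In the following, the set [A] is meant to be open in a half space. *)
Section differentiability.
Context {R : realType}.

Definition is_deriv (E F : normedModType R) (A : set E) (h : E -> F) (x : E)
    (u : blin E F) :=
  `|h y - h x - u (y - x)| / `|y - x| @[y --> within A (nbhs x)] --> (0 : R).

Definition deriv (E F : normedModType R) (A : set E) (h : E -> F) (x : E) :
    blin E F :=
  xget 0 [set u | is_deriv A h x u].

Fixpoint Ck (k : nat) (E F : normedModType R) (A : set E) (h : E -> F) : Prop :=
  if k is k'.+1 then exists2 dh : E -> blin E F,
    forall x, A x -> is_deriv A h x (dh x) & Ck k' A dh
  else {within A, continuous h}.

End differentiability.

Variant smoothness := Finite of nat | Infinite.

Definition smooth_ge1 (p : smoothness) : bool :=
  if p is Finite k then (0 < k)%N else true.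

Definition Cp {R : realType} (p : smoothness) (E F : normedModType R)
    (A : set E) (h : E -> F) : Prop :=
  match p with
  | Finite k => Ck k A h
  | Infinite => forall k, Ck k A h
  end.

Section manifolds.
Context {R : realType}.

(* Only the values of [cmap] on the domain [cdom] of the chart are relevant. *)
Record chart (T : pointedType) := Chart {
  cmod :> completeNormedModType R;
  chs : cmod -> R;
  cdom : set T;
  cmap : T -> cmod }.

Arguments chs {T} c _.
Arguments cdom {T} c _.
Arguments cmap {T} c _.

Definition cimg (T : pointedType) (c : chart T) : set c := cmap c @` cdom c.
Arguments cimg {T} c _.

Definition cinv (T : pointedType) (c : chart T) : c -> T :=
  pinv (cdom c) (cmap c).
Arguments cinv {T} c _.

(* A subset of an ambient type together with an atlas; the axioms of a         *)
(* manifold are in [is_manifold]. Predicates on charts and on tangent vectors  *)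
(* cannot be of type [set _], for universe reasons.                            *)
Record mfd (T : pointedType) := Mfd {
  mset :> set T;
  atlas : chart T -> Prop }.
Arguments Mfd {T} mset atlas.

Definition is_chart (T : pointedType) (X : set T) (c : chart T) :=
  [/\ halfspace_fun (chs c), cdom c `<=` X,
      {in cdom c &, injective (cmap c)} &
      open_in (hs_pos (chs c)) (cimg c)].

(* The local representation of [f] in the charts [c] and [c']; it is           *)
(* meaningful on [rep_dom f c c'].                                             *)
Definition rep (T T' : pointedType) (f : T -> T') (c : chart T)
    (c' : chart T') : c -> c' :=
  cmap c' \o f \o cinv c.
Arguments rep {T T'} f c c' _.

Definition rep_dom (T T' : pointedType) (f : T -> T') (c : chart T)
    (c' : chart T') : set c :=
  cmap c @` (cdom c `&` f @^-1` cdom c').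
Arguments rep_dom {T T'} f c c' _.

Definition compatible (p : smoothness) (T : pointedType) (c c' : chart T) :=
  [/\ open_in (hs_pos (chs c)) (rep_dom id c c'),
      open_in (hs_pos (chs c')) (rep_dom id c' c),
      Cp p (rep_dom id c c') (rep id c c') &
      Cp p (rep_dom id c' c) (rep id c' c)].

Definition max_atlas (p : smoothness) (T : pointedType) (X : set T)
    (A : chart T -> Prop) : chart T -> Prop :=
  fun c => is_chart X c /\ forall c', A c' -> compatible p c c'.

Definition is_manifold (p : smoothness) (T : pointedType) (X : mfd T) :=
  (forall x, mset X x -> exists2 c, atlas X c & cdom c x) /\
  forall c, atlas X c <-> max_atlas p X (atlas X) c.

Definition boundary (T : pointedType) (X : mfd T) : set T :=
  [set x | mset X x /\ exists c, [/\ atlas X c, cdom c x & chs c (cmap c x) = 0]].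

Definition interior (T : pointedType) (X : mfd T) : set T := X `\` boundary X.

(* The chart of [Y] with values in the half space of [F] given by [mu]; the    *)
(* default value 0 is taken outside of the preimage of [F].                    *)
Definition restr_chart (T : pointedType) (c : chart T)
    (F : closed_subspace c) (mu : cs_type F -> R) (Y : set T) : chart T :=
  @Chart T (cs_type F) mu (cdom c `&` Y) (fun x => insubd 0 (cmap c x)).

Definition boundary_mfd (p : smoothness) (T : pointedType) (X : mfd T) : mfd T :=
  Mfd (boundary X) (max_atlas p (boundary X) (fun c' =>
    exists (c : chart T) (F : closed_subspace c),
      [/\ atlas X c, (F : set c) = hs_bd (chs c) &
          c' = restr_chart (cst 1 : cs_type F -> R) (boundary X)])).

Definition open_mfd (T : pointedType) (X : mfd T) (V : set T) : mfd T :=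
  Mfd V (fun c => atlas X c /\ cdom c `<=` V).

(* A subset [W] of a half space, with the identity as a global chart. *)
Definition halfspace_mfd (p : smoothness) (E : completeNormedModType R)
    (alpha : E -> R) (W : set E) : mfd E :=
  Mfd W (max_atlas p W (fun c => c = @Chart E E alpha W id)).

Definition Cp_map (p : smoothness) (T T' : pointedType) (X : mfd T)
    (X' : mfd T') (f : T -> T') :=
  f @` X `<=` X' /\
  forall x, mset X x -> exists (c : chart T) (c' : chart T'),
    [/\ atlas X c /\ cdom c x, atlas X' c' /\ cdom c' (f x),
        f @` cdom c `<=` cdom c' & Cp p (cimg c) (rep f c c')].

Definition diffeo (p : smoothness) (T T' : pointedType) (X : mfd T)
    (X' : mfd T') (f : T -> T') :=
  Cp_map p X X' f /\ exists g : T' -> T,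
    [/\ Cp_map p X' X g, {in (X : set T), cancel f g} &
        {in (X' : set T'), cancel g f}].

Definition adapted (T : pointedType) (X : mfd T) (Y : set T) (y : T)
    (c : chart T) (F : closed_subspace c) (mu : cs_type F -> R) :=
  let F_mu := @cs_val _ _ F @` hs_pos mu in
  [/\ atlas X c, cdom c y /\ cmap c y = 0, complemented F, halfspace_fun mu &
      cmap c @` (cdom c `&` Y) = cimg c `&` F_mu /\
      open_in F_mu (cmap c @` (cdom c `&` Y))].

Definition submanifold (T : pointedType) (X : mfd T) (Y : set T) :=
  Y `<=` X /\ forall y, Y y ->
    exists (c : chart T) (F : closed_subspace c) (mu : cs_type F -> R),
      adapted X Y y mu.

Definition sub_mfd (p : smoothness) (T : pointedType) (X : mfd T) (Y : set T) :
    mfd T :=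
  Mfd Y (max_atlas p Y (fun c' =>
    exists (y : T) (c : chart T) (F : closed_subspace c) (mu : cs_type F -> R),
      [/\ Y y, adapted X Y y mu & c' = restr_chart mu Y])).

Definition neat_submanifold (p : smoothness) (T : pointedType) (X : mfd T)
    (Y : set T) :=
  submanifold X Y /\ boundary (sub_mfd p X Y) = Y `&` boundary X.

Definition embedding (p : smoothness) (T T' : pointedType) (X : mfd T)
    (X' : mfd T') (f : T -> T') :=
  [/\ Cp_map p X X' f, submanifold X' (f @` X) &
      diffeo p X (sub_mfd p X' (f @` X)) f].

(* A tangent vector at [x] is identified with the family of its components in  *)
(* the charts at [x], related by the derivatives of the chart changes; the     *)
(* other components are 0.                                                     *)
Definition tvec (T : pointedType) := forall c : chart T, c.

Definition chart_at (T : pointedType) (X : mfd T) (x : T) (c : chart T) :=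
  atlas X c /\ cdom c x.

Definition tangent (T : pointedType) (X : mfd T) (x : T) (v : tvec T) : Prop :=
  (forall c, ~ chart_at X x c -> v c = 0) /\
  forall c c', chart_at X x c -> chart_at X x c' ->
    v c' = deriv (rep_dom id c c') (rep id c c') (cmap c x) (v c).

Definition tzero (T : pointedType) : tvec T := fun c => 0.

Definition tadd (T : pointedType) (v w : tvec T) : tvec T :=
  fun c => v c + w c.

Definition tscale (T : pointedType) (a : R) (v : tvec T) : tvec T :=
  fun c => a *: v c.

(* The derivative [df(x)]; its value does not depend on the chart [c] at [x]. *)
Definition dmap (T T' : pointedType) (X : mfd T) (X' : mfd T') (f : T -> T')
    (x : T) (v : tvec T) : tvec T' :=
  fun c' => xget 0 [set w | chart_at X' (f x) c' /\
    exists2 c, chart_at X x c &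
      w = deriv (rep_dom f c c') (rep f c c') (cmap c x) (v c)].

Definition drange (T T' : pointedType) (X : mfd T) (X' : mfd T') (f : T -> T')
    (x : T) : tvec T' -> Prop :=
  fun w => exists2 v, tangent X x v & dmap X X' f x v = w.

Definition dpreimage (T T' : pointedType) (X : mfd T) (X' : mfd T')
    (f : T -> T') (x : T) (S : tvec T' -> Prop) : tvec T -> Prop :=
  fun v => tangent X x v /\ S (dmap X X' f x v).

(* [T_y Y] as a subspace of [T_y X], via the derivative of the inclusion. *)
Definition tangent_sub (p : smoothness) (T : pointedType) (X : mfd T)
    (Y : set T) (y : T) : tvec T -> Prop :=
  drange (sub_mfd p X Y) X id y.

(* The derivative [dphi(x)] of the chart [c] maps [v] to its component in [c]. *)
Definition dchart (T : pointedType) (c : chart T) (S : tvec T -> Prop) : set c :=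
  [set u | exists2 v, S v & v c = u].
Arguments dchart {T} c S _.

Definition tclosed (T : pointedType) (X : mfd T) (x : T) (S : tvec T -> Prop) :=
  forall c, chart_at X x c -> closed (dchart c S).

Definition tsubspace (T : pointedType) (X : mfd T) (x : T) (S : tvec T -> Prop) :=
  [/\ forall v, S v -> tangent X x v, S (@tzero T) &
      forall a v w, S v -> S w -> S (tadd (tscale a v) w)].

Definition tsum (T : pointedType) (S1 S2 : tvec T -> Prop) : tvec T -> Prop :=
  fun v => exists v1 v2, [/\ S1 v1, S2 v2 & v = tadd v1 v2].

Definition tcomplemented (T : pointedType) (X : mfd T) (x : T)
    (S : tvec T -> Prop) :=
  exists G : tvec T -> Prop,
    [/\ tsubspace X x G, tclosed X x G,
        forall v, S v /\ G v <-> v = @tzero T &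
        forall v, tangent X x v <-> tsum S G v].

Definition transverse_on (p : smoothness) (T T' : pointedType) (X : mfd T)
    (X' : mfd T') (f : T -> T') (Y : set T') (x : T) :=
  (forall w, tangent X' (f x) w <->
     tsum (drange X X' f x) (tangent_sub p X' Y (f x)) w) /\
  tcomplemented X x (dpreimage X X' f x (tangent_sub p X' Y (f x))).

Definition transverse (p : smoothness) (T T' : pointedType) (X : mfd T)
    (X' : mfd T') (f : T -> T') (Y : set T') (x : T) :=
  [\/ ~ Y (f x),
      [/\ Y (f x), interior X x & transverse_on p X X' f Y x] |
      [/\ Y (f x), boundary X x &
          transverse_on p (boundary_mfd p X) X' f Y x]].

End manifolds.

Arguments chs {R T} c _.
Arguments cdom {R T} c _.
Arguments cmap {R T} c _.
Arguments cimg {R T} c _.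
Arguments cinv {R T} c _.
Arguments Mfd {R T} mset atlas.
Arguments rep {R T T'} f c c' _.
Arguments rep_dom {R T T'} f c c' _.
Arguments dchart {R T} c S _.

(* Main.v *)
(* Let [D] be the derivative at [x0] of the local representation [h] of [f] in  *)
(* a chart centered at [x0] and a chart adapted to the submanifold, which is    *)
(* cut out there by a closed subspace [F] (by neatness, even when its points    *)
(* may lie on the boundary). Transversality provides a closed subspace [G],     *)
(* tangent to the boundary if [x0] lies on it, such that [(a, g) |-> a + D g]   *)
(* is a bijection from [F * G] onto the target. By the open mapping theorem its *)
(* inverse yields a bounded [Q] with values in [G], kernel [F] and [Q (D g) = g]*)
(* on [G]. The map [psi e = e + Q (h e - D e)] has derivative the identity at 0 *)
(* and moves points along [G] only, hence preserves the half space, and it is   *)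
(* inverted there by the contraction principle. As [Q (D (psi e)) = Q (h e)],   *)
(* the preimage of the submanifold is, in the chart [psi], the kernel of        *)
(* [Q \o D].                                                                    *)

Require Import Defs.
From HB Require Import structures.
From mathcomp Require Import all_boot all_order all_algebra.
From mathcomp Require Import all_classical all_reals topology normedtype.
From mathcomp Require Import interval_inference sequences ring lra.
Import Order.TTheory GRing.Theory Num.Theory.
Import numFieldNormedType.Exports.
Set Implicit Arguments.
Unset Strict Implicit.
Unset Printing Implicit Defensive.
Local Open Scope classical_set_scope.
Local Open Scope ring_scope.

(** Transversality makes the derivative [D] of [f] at [x0] injective on a closed complement [G] of
    the preimage of the tangent space of [X''], and the image of [G] under [D] a complement of the
    model space [F] of [X'']. Projecting along [F] and inverting [D] on [G] gives the bounded
    operator [Q] of [splitting_retraction]. Membership of [f y] in [X''] thus becomes, in charts, an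
    equation with values in [G], and the chart of [straightening_chart] turns it into the linear
    equation [Q (D e) = 0].

    Boundaries enter twice. In the target, neatness ensures that [X''] does not end inside the
    chart: by [neat_adapted] it is all of [F] there, so no inequality accompanies the equation. In
    the source, transversality of the restriction to the boundary puts [G] inside the boundary
    hyperplane ([transverse_complement]), so the change of chart leaves the boundary functional
    unchanged, and [halfspace_inverse] replaces the inverse function theorem without extending [f]
    across the boundary.

    The conclusions are read off this one chart. There the preimage is the trace of [L], the kernel
    of [Q \o D], and the [slice] lemmas yield the embedding, the submanifold and its neatness. For
    the tangent spaces, [Q] composed with the local representation of [f] agrees with one linear map
    on the whole chart domain, so its derivative is the same at every point and not only at [x0].

    Calculus on half spaces rests on three facts: at a boundary point every direction or its
    opposite stays in the half space ([halfspace_ray]), boundary points are recognized in any chart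
    ([chart_boundary]), and smoothness into a closed subspace can be tested in the ambient space
    ([Cp_lift]). *)

Inductive zexp := ZVar of nat | ZAdd of zexp & zexp | ZOpp of zexp | ZZero.

Fixpoint zeval (V : zmodType) (env : seq V) (e : zexp) : V :=
  match e with
  | ZVar i => env`_i
  | ZAdd e1 e2 => zeval env e1 + zeval env e2
  | ZOpp e1 => - zeval env e1
  | ZZero => 0
  end.

Fixpoint zcoef (e : zexp) (i : nat) : int :=
  match e with
  | ZVar j => (i == j)%:Z
  | ZAdd e1 e2 => zcoef e1 i + zcoef e2 i
  | ZOpp e1 => - zcoef e1 i
  | ZZero => 0
  end.

(** Normal form of an expression as an integer combination of its atoms; the coefficients compute,
    which makes comparison by reflection possible. *)
Lemma zevalE (V : zmodType) (env : seq V) (e : zexp) :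
  zeval env e = \sum_(i < size env) env`_i *~ zcoef e i.
Proof.
elim: e => [j|e1 IH1 e2 IH2|e1 IH1|] /=.
- have [ji|ij] := ltnP j (size env).
    rewrite (bigD1 (Ordinal ji))//= eqxx mulr1z big1 ?addr0// => i.
    by rewrite -val_eqE /= => /negbTE ->; rewrite mulr0z.
  rewrite nth_default// big1// => i _; rewrite ltn_eqF ?mulr0z//.
  exact: leq_trans (ltn_ord i) ij.
- by rewrite IH1 IH2 -big_split; apply: eq_bigr => i _; rewrite mulrzDr.
- by rewrite IH1 -sumrN; apply: eq_bigr => i _; rewrite mulrNz.
- by rewrite big1// => i _; rewrite mulr0z.
Qed.

Lemma zeval_eq (V : zmodType) (env : seq V) (e1 e2 : zexp) :
  all (fun i => zcoef e1 i == zcoef e2 i) (iota 0 (size env)) ->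
  zeval env e1 = zeval env e2.
Proof.
move=> /allP e12; rewrite !zevalE; apply: eq_bigr => i _.
by rewrite (eqP (e12 _ _))// mem_iota /=.
Qed.

(** Matching on a dummy term lets the tactic [unify] run while a term is being computed; its failure
    selects the second branch. *)
Ltac zsame x y :=
  match constr:(Set) with
  | _ => let _ := match constr:(Set) with _ => unify x y end in constr:(true)
  | _ => constr:(false)
  end.

Ltac zmem x l :=
  match l with
  | nil => constr:(false)
  | ?y :: ?l' => match zsame x y with true => constr:(true) | _ => zmem x l' end
  end.

Ltac zindex x l :=
  match l with
  | ?y :: ?l' => match zsame x y with
      true => constr:(0%N) | _ => let n := zindex x l' in constr:(S n) end
  end.

Ltac zatoms t l :=
  match t with
  | (?a + ?b)%R => let l1 := zatoms a l in zatoms b l1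
  | (- ?a)%R => zatoms a l
  | 0%R => l
  | _ => match zmem t l with true => l | false => constr:(t :: l) end
  end.

Ltac zreify t l :=
  match t with
  | (?a + ?b)%R =>
      let e1 := zreify a l in let e2 := zreify b l in constr:(ZAdd e1 e2)
  | (- ?a)%R => let e := zreify a l in constr:(ZOpp e)
  | 0%R => constr:(ZZero)
  | _ => let n := zindex t l in constr:(ZVar n)
  end.

(* Identities of abelian groups, by comparing the coefficients of the atoms. *)
Ltac abel :=
  match goal with
  | |- @eq ?V ?a ?b =>
      let l1 := zatoms a (@nil V) in
      let l := zatoms b l1 in
      let e1 := zreify a l in
      let e2 := zreify b l in
      apply: (@zeval_eq _ l e1 e2); vm_compute; reflexivity
  end.

(** * Differential calculus on half spaces *)

Section metric_forms.
Context {R : realType}.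

Lemma near_normP (E : normedModType R) (x : E) (P : set E) :
  (\forall y \near x, P y) <->
  exists2 d : R, 0 < d & forall y, `|y - x| < d -> P y.
Proof.
split=> [/nbhs_ballP[d /= d0 dP]|[d d0 dP]].
  by exists d => // y yx; apply: dP; rewrite -ball_normE /= distrC.
apply/nbhs_ballP; exists d => //= y; rewrite -ball_normE /= distrC => yx.
exact: dP.
Qed.

Lemma near_withinP (E : normedModType R) (A : set E) (x : E) (P : set E) :
  (\forall y \near within A (nbhs x), P y) <->
  exists2 d : R, 0 < d & forall y, A y -> `|y - x| < d -> P y.
Proof.
split.
  by move=> /near_normP[d d0 dP]; exists d => // y Ay yx; apply: dP.
by case=> d d0 dP; apply/near_normP; exists d => // y yx Ay; apply: dP.
Qed.

Lemma open_inP (E : normedModType R) (A U : set E) :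
  open_in A U <-> U `<=` A /\ forall x, U x ->
    exists2 d : R, 0 < d & forall y, A y -> `|y - x| < d -> U y.
Proof.
split=> [[O oO ->]|[UA Ud]].
  split=> [x []//|x [Ox Ax]].
  have /near_normP[d d0 dO] : nbhs x O by exact: open_nbhs_nbhs.
  by exists d => // y Ay yx; split=> //; exact: dO.
(* The open set is the union of all balls whose trace on [A] lies in [U]. *)
exists (\bigcup_(xd in [set xd : E * R |
    [/\ U xd.1, 0 < xd.2 & forall y, A y -> `|y - xd.1| < xd.2 -> U y]])
    ball xd.1 xd.2).
  by apply: bigcup_open => -[x d] [/= Ux d0 _]; exact: ball_open.
apply/seteqP; split=> [x Ux|x [[[z d] [/= Uz d0 zU]]]].
  have [d d0 dU] := Ud _ Ux; split; last exact: UA.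
  by exists (x, d) => //=; exact: ballxx.
by rewrite -ball_normE /= distrC => zx Ax; exact: zU.
Qed.

Lemma open_inS (E : normedModType R) (A U : set E) : open_in A U -> U `<=` A.
Proof. by case/open_inP. Qed.

Lemma open_inI (E : normedModType R) (A U V : set E) :
  open_in A U -> open_in A V -> open_in A (U `&` V).
Proof.
move=> [O oO ->] [P oP ->]; exists (O `&` P); first exact: openI.
by rewrite setIACA setIid.
Qed.

(** Multiplying out removes the quotient, which is 0 at [y = x] by the convention on inverses; there
    both sides of the new estimate vanish. *)
Lemma is_derivP (E F : normedModType R) (A : set E) (h : E -> F) x
    (u : blin E F) :
  is_deriv A h x u <-> forall e, 0 < e -> exists2 d, 0 < d &
    forall y, A y -> `|y - x| < d -> `|h y - h x - u (y - x)| <= e * `|y - x|.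
Proof.
split=> [/cvgrPdist_le hu e e0|hu].
  have /near_withinP[d d0 dh] := hu _ e0; exists d => // y Ay yx.
  have := dh _ Ay yx; rewrite sub0r normrN ger0_norm ?divr_ge0//.
  have [->|yx0] := eqVneq y x; first by rewrite !subrr blin0 subr0 !normr0 mulr0.
  by rewrite ler_pdivrMr// normr_gt0 subr_eq0.
apply/cvgrPdist_le => e e0; apply/near_withinP.
have [d d0 dh] := hu _ e0; exists d => // y Ay yx.
rewrite sub0r normrN ger0_norm ?divr_ge0//.
have [->|yx0] := eqVneq y x; first by rewrite !subrr normr0 invr0 mulr0 ltW.
by rewrite ler_pdivrMr ?dh// normr_gt0 subr_eq0.
Qed.

Lemma within_continuousP (E F : normedModType R) (A : set E) (h : E -> F) :
  {within A, continuous h} <-> forall x, A x -> forall e, 0 < e ->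
    exists2 d, 0 < d & forall y, A y -> `|y - x| < d -> `|h y - h x| <= e.
Proof.
rewrite subspace_continuousP; split=> [hc x Ax e e0|hc x Ax].
  have /cvgrPdist_le/(_ _ e0)/near_withinP[d d0 dh] := hc _ Ax.
  by exists d => // y Ay yx; rewrite distrC; exact: dh.
apply/cvgrPdist_le => e e0; apply/near_withinP.
have [d d0 dh] := hc _ Ax _ e0; exists d => // y Ay yx.
by rewrite distrC; exact: dh.
Qed.

End metric_forms.

(** * Bounded linear and bilinear maps *)

Section blin_construction.
Context {R : realType}.

Lemma bounded_linear_continuous (E F : normedModType R) (f : E -> F) (M : R) :
  linear f -> (forall x, `|f x| <= M * `|x|) -> continuous f.
Proof.
move=> lf fM x; apply/cvgrPdist_le => e e0; apply/near_normP.
exists (e / (`|M| + 1)); first by rewrite divr_gt0// ltr_wpDl.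
move=> y yx; have -> : f x - f y = f (x - y).
  by have := lf (-1) y x; rewrite !scaleN1r ![- _ + _]addrC.
rewrite (le_trans (fM _))// distrC.
rewrite (le_trans (y := (`|M| + 1) * `|y - x|))//.
  by rewrite ler_wpM2r// (le_trans (ler_norm _))// lerDl.
by rewrite -ler_pdivlMl ?ltr_wpDl// mulrC ltW.
Qed.

Lemma mkblin_subproof (E F : normedModType R) (f : E -> F) (M : R) :
  linear f -> (forall x, `|f x| <= M * `|x|) ->
  f \in (bounded_linear (E := E) (F := F)).
Proof.
by move=> lf fM; rewrite inE; split=> //; exact: bounded_linear_continuous fM.
Qed.

Definition mkblin (E F : normedModType R) (f : E -> F) (M : R) (lf : linear f)
  (fM : forall x, `|f x| <= M * `|x|) : blin E F := Blin (mkblin_subproof lf fM).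

Lemma blinP_eq (E F : normedModType R) (u v : blin E F) : u =1 v -> u = v.
Proof. by move=> uv; apply/val_inj/funext. Qed.

Lemma blinD (E F : normedModType R) (u : blin E F) x y : u (x + y) = u x + u y.
Proof. by have := blin_linear u 1 x y; rewrite !scale1r. Qed.

Lemma blinN (E F : normedModType R) (u : blin E F) x : u (- x) = - u x.
Proof. by rewrite -scaleN1r blinZ scaleN1r. Qed.

Lemma blinB (E F : normedModType R) (u : blin E F) x y : u (x - y) = u x - u y.
Proof. by rewrite blinD blinN. Qed.

Lemma le_blin (E F : normedModType R) (u : blin E F) x : `|u x| <= `|u| * `|x|.
Proof. exact: le_opnorm. Qed.

Lemma blin_norm_le (E F : normedModType R) (u : blin E F) M : 0 <= M ->
  (forall x, `|u x| <= M * `|x|) -> `|u| <= M.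
Proof.
move=> M0 uM; apply: opnorm_le => x x1; rewrite (le_trans (uM x))//.
by rewrite ler_piMr.
Qed.

Lemma bid_subproof (E : normedModType R) (x : E) : `|x| <= 1 * `|x|.
Proof. by rewrite mul1r. Qed.

Definition bid (E : normedModType R) : blin E E :=
  mkblin (fun a x y => erefl : idfun (a *: x + y) = a *: x + y)
    (@bid_subproof E).

Lemma bidE (E : normedModType R) (x : E) : bid E x = x. Proof. by []. Qed.

Lemma bcomp_linear (E F G : normedModType R) (v : blin F G) (u : blin E F) :
  linear (v \o u).
Proof. by move=> a x y /=; rewrite !blin_linear. Qed.

Lemma bcomp_bounded (E F G : normedModType R) (v : blin F G) (u : blin E F) x :
  `|(v \o u) x| <= `|v| * `|u| * `|x|.
Proof.
by rewrite (le_trans (le_blin v _))// -mulrA ler_wpM2l// le_blin.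
Qed.

Definition bcomp (E F G : normedModType R) (v : blin F G) (u : blin E F) :
  blin E G := mkblin (bcomp_linear v u) (bcomp_bounded v u).

Lemma bcompE (E F G : normedModType R) (v : blin F G) (u : blin E F) x :
  bcomp v u x = v (u x).
Proof. by []. Qed.

Lemma bcomp_norm (E F G : normedModType R) (v : blin F G) (u : blin E F) :
  `|bcomp v u| <= `|v| * `|u|.
Proof. by apply: blin_norm_le; [exact: mulr_ge0|exact: bcomp_bounded]. Qed.

Lemma bpost_linear (V E F : normedModType R) (l : blin E F) :
  linear (fun u : blin V E => bcomp l u).
Proof. by move=> a u v; apply: blinP_eq => x; exact: blin_linear. Qed.

Definition bpost (V E F : normedModType R) (l : blin E F) :
  blin (blin V E) (blin V F) := mkblin (@bpost_linear V E F l) (bcomp_norm l).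

(** Composing one argument with operators from a space [V] again gives bounded bilinear maps, [bil1]
    and [bil2], with the same bound. The product rule therefore stays in this class, and inductions
    on the order of differentiability can range over it. *)
Record bilin (E F G : normedModType R) := Bilin {
  bil_fun :> E -> F -> G;
  bil_linl : forall y, linear (bil_fun^~ y);
  bil_linr : forall x, linear (bil_fun x);
  bil_bound : R;
  bil_bound_ge0 : 0 <= bil_bound;
  le_bil : forall x y, `|bil_fun x y| <= bil_bound * `|x| * `|y| }.

Lemma bilBl (E F G : normedModType R) (B : bilin E F G) x x' y :
  B (x - x') y = B x y - B x' y.
Proof. by have := bil_linl B y (-1) x' x; rewrite !scaleN1r ![- _ + _]addrC. Qed.

Lemma bilBr (E F G : normedModType R) (B : bilin E F G) x y y' :
  B x (y - y') = B x y - B x y'.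
Proof. by have := bil_linr B x (-1) y' y; rewrite !scaleN1r ![- _ + _]addrC. Qed.

Section bilin_lift.
Variables (V E F G : normedModType R) (B : bilin E F G).

Lemma bil1_linear (u : blin V E) (y : F) : linear (fun v => B (u v) y).
Proof. by move=> a x x'; rewrite blin_linear bil_linl. Qed.

Lemma bil1_bound (u : blin V E) (y : F) v :
  `|B (u v) y| <= bil_bound B * `|u| * `|y| * `|v|.
Proof.
rewrite (le_trans (le_bil B _ _))// [leRHS]mulrAC ler_wpM2r// -mulrA.
by rewrite ler_wpM2l ?bil_bound_ge0// le_blin.
Qed.

Definition bil1_fun (u : blin V E) (y : F) : blin V G :=
  mkblin (bil1_linear u y) (bil1_bound u y).

Program Definition bil1 : bilin (blin V E) F (blin V G) :=
  @Bilin _ _ _ bil1_fun _ _ (bil_bound B) (bil_bound_ge0 B) _.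
Next Obligation.
by move=> y a u u'; apply: blinP_eq => v; exact: bil_linl.
Qed.
Next Obligation.
by move=> u a y y'; apply: blinP_eq => v; exact: bil_linr.
Qed.
Next Obligation.
move=> u y; apply: blin_norm_le; last exact: bil1_bound.
by rewrite !mulr_ge0// bil_bound_ge0.
Qed.

Lemma bil2_linear (x : E) (u : blin V F) : linear (fun v => B x (u v)).
Proof. by move=> a v v'; rewrite blin_linear bil_linr. Qed.

Lemma bil2_bound (x : E) (u : blin V F) v :
  `|B x (u v)| <= bil_bound B * `|x| * `|u| * `|v|.
Proof.
rewrite (le_trans (le_bil B _ _))// -[leRHS]mulrA ler_wpM2l ?le_blin//.
by rewrite mulr_ge0// bil_bound_ge0.
Qed.

Definition bil2_fun (x : E) (u : blin V F) : blin V G :=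
  mkblin (bil2_linear x u) (bil2_bound x u).

Program Definition bil2 : bilin E (blin V F) (blin V G) :=
  @Bilin _ _ _ bil2_fun _ _ (bil_bound B) (bil_bound_ge0 B) _.
Next Obligation.
by move=> u a x x'; apply: blinP_eq => v; exact: bil_linl.
Qed.
Next Obligation.
by move=> x a u u'; apply: blinP_eq => v; exact: bil_linr.
Qed.
Next Obligation.
move=> x u; apply: blin_norm_le; last exact: bil2_bound.
by rewrite !mulr_ge0// bil_bound_ge0.
Qed.

End bilin_lift.

Program Definition bil_comp (E F G : normedModType R) :
  bilin (blin F G) (blin E F) (blin E G) :=
  @Bilin _ _ _ (@bcomp E F G) _ _ 1 ler01 _.
Next Obligation. by move=> E F G u a v v'; apply: blinP_eq => x. Qed.
Next Obligation.
by move=> E F G v a u u'; apply: blinP_eq => x; exact: blin_linear.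
Qed.
Next Obligation. by move=> E F G v u; rewrite mul1r bcomp_norm. Qed.

End blin_construction.

Section derivatives.
Context {R : realType}.

(** Lets remainder estimates lose a constant factor; dividing by [C + 1] instead of [C] also covers
    [C = 0]. *)
Lemma is_deriv_scaled (E F : normedModType R) (A : set E) (h : E -> F) x
    (u : blin E F) (C : R) : 0 <= C ->
  (forall e, 0 < e -> e <= 1 -> exists2 d, 0 < d &
    forall y, A y -> `|y - x| < d ->
      `|h y - h x - u (y - x)| <= C * e * `|y - x|) ->
  is_deriv A h x u.
Proof.
move=> C0 hC; apply/is_derivP => e e0.
have C1 : 0 < C + 1 by rewrite ltr_wpDl.
have [||d d0 dh] := hC (Num.min 1 (e / (C + 1))).
- by rewrite lt_min ltr01/= divr_gt0.
- by rewrite ge_min lexx.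
exists d => // y Ay yx; rewrite (le_trans (dh _ Ay yx))// ler_wpM2r//.
rewrite (le_trans (y := C * (e / (C + 1))))//.
  by rewrite ler_wpM2l// ge_min lexx orbT.
by rewrite mulrCA ler_piMr ?(ltW e0)// ler_pdivrMr// mul1r lerDl.
Qed.

Lemma is_deriv_sub (E F : normedModType R) (A A' : set E) (h : E -> F) x
    (u : blin E F) : A' `<=` A -> is_deriv A h x u -> is_deriv A' h x u.
Proof.
move=> A'A /is_derivP hu; apply/is_derivP => e /hu[d d0 dh].
by exists d => // y /A'A; exact: dh.
Qed.

Lemma is_deriv_local (E F : normedModType R) (A A' : set E) (h : E -> F) x
    (u : blin E F) (r : R) : 0 < r ->
  (forall y, A y -> `|y - x| < r -> A' y) ->
  is_deriv A' h x u -> is_deriv A h x u.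
Proof.
move=> r0 rA /is_derivP hu; apply/is_derivP => e /hu[d d0 dh].
exists (Num.min r d) => [|y Ay]; first by rewrite lt_min r0.
by rewrite lt_min => /andP[yr yd]; apply: dh => //; exact: rA.
Qed.

Lemma is_deriv_ext (E F : normedModType R) (A : set E) (h h' : E -> F) x
    (u : blin E F) : A x -> (forall y, A y -> h y = h' y) ->
  is_deriv A h x u -> is_deriv A h' x u.
Proof.
move=> Ax hh' /is_derivP hu; apply/is_derivP => e /hu[d d0 dh].
by exists d => // y Ay yx; rewrite -!hh'//; exact: dh.
Qed.

Lemma is_deriv_lip (E F : normedModType R) (A : set E) (h : E -> F) x
    (u : blin E F) : is_deriv A h x u -> exists2 d, 0 < d &
  forall y, A y -> `|y - x| < d -> `|h y - h x| <= (`|u| + 1) * `|y - x|.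
Proof.
move=> /is_derivP/(_ _ ltr01)[d d0 dh]; exists d => // y Ay yx.
have := dh _ Ay yx; rewrite mul1r => hy.
rewrite -(subrK (u (y - x)) (h y - h x)) (le_trans (ler_normD _ _))//.
by rewrite mulrDl mul1r addrC lerD// le_blin.
Qed.

Lemma is_deriv_blin (E F : normedModType R) (A : set E) x (u : blin E F) :
  is_deriv A u x u.
Proof.
apply/is_derivP => e e0; exists 1 => // y _ _.
by rewrite -blinB subrr normr0 mulr_ge0// ltW.
Qed.

Lemma is_deriv_cst (E F : normedModType R) (A : set E) x (a : F) :
  is_deriv A (fun _ : E => a) x 0.
Proof.
apply/is_derivP => e e0; exists 1 => // y _ _.
by rewrite subrr sub0r normrN [X in `|X|](_ : _ = 0)// normr0 mulr_ge0// ltW.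
Qed.

Lemma is_deriv_add (E F : normedModType R) (A : set E) (h k : E -> F) x
    (u v : blin E F) : is_deriv A h x u -> is_deriv A k x v ->
  is_deriv A (fun y => h y + k y) x (u + v).
Proof.
move=> /is_derivP hu /is_derivP kv.
apply: (@is_deriv_scaled _ _ _ _ _ _ 2) => // e e0 _.
have [d d0 dh] := hu _ e0; have [d' d'0 dk] := kv _ e0.
exists (Num.min d d') => [|y Ay]; first by rewrite lt_min d0.
rewrite lt_min => /andP[yd yd'].
have -> : h y + k y - (h x + k x) - (u + v) (y - x) =
    (h y - h x - u (y - x)) + (k y - k x - v (y - x)).
  by rewrite -[(u + v) _]/(u (y - x) + v (y - x)); abel.
rewrite (le_trans (ler_normD _ _))// -mulrA mulr_natl mulr2n.
by rewrite lerD ?dh ?dk.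
Qed.

Lemma is_deriv_comp (E F G : normedModType R) (A : set E) (B : set F)
    (f : E -> F) (g : F -> G) x (u : blin E F) (v : blin F G) :
  (forall y, A y -> B (f y)) -> is_deriv A f x u -> is_deriv B g (f x) v ->
  is_deriv A (g \o f) x (bcomp v u).
Proof.
move=> AB fu gv; have [d1 d10 fl] := is_deriv_lip fu.
move/is_derivP : fu => fu; move/is_derivP : gv => gv.
have K0 : 0 < `|u| + 1 by rewrite ltr_wpDl.
apply: (@is_deriv_scaled _ _ _ _ _ _ (`|u| + 1 + `|v|)).
  by rewrite addr_ge0// ltW.
move=> e e0 _; have [d2 d20 fe] := fu _ e0; have [d3 d30 ge] := gv _ e0.
exists (Num.min d1 (Num.min d2 (d3 / (`|u| + 1)))).
  by rewrite !lt_min d10 d20 divr_gt0.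
move=> y Ay; rewrite !lt_min => /and3P[y1 y2 y3] /=.
have fyl := fl _ Ay y1.
have gy : `|g (f y) - g (f x) - v (f y - f x)| <= e * `|f y - f x|.
  apply: ge; first exact: AB.
  by rewrite (le_lt_trans fyl)// mulrC -ltr_pdivlMr.
rewrite -(subrK (v (f y - f x)) (g (f y) - g (f x))) -addrA -blinB.
rewrite (le_trans (ler_normD _ _))// !mulrDl; apply: lerD.
  rewrite (le_trans gy)// -!mulrDl -mulrA mulrCA ler_wpM2l ?(ltW e0)//.
rewrite (le_trans (le_blin v _))// -mulrA ler_wpM2l// fe//.
Qed.

Lemma is_deriv_post (E F G : normedModType R) (A : set E) (f : E -> F) x
    (u : blin E F) (l : blin F G) : is_deriv A f x u ->
  is_deriv A (fun y => l (f y)) x (bcomp l u).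
Proof.
move=> fu; apply: (@is_deriv_comp _ _ _ _ setT f l) => //.
exact: is_deriv_blin.
Qed.

Lemma is_deriv_bil (V E F G : normedModType R) (B : bilin E F G) (A : set V)
    (a : V -> E) (b : V -> F) x (a' : blin V E) (b' : blin V F) :
  is_deriv A a x a' -> is_deriv A b x b' ->
  is_deriv A (fun y => B (a y) (b y)) x
    (bil1 V B a' (b x) + bil2 V B (a x) b').
Proof.
move=> da db; have [d1 d10 al] := is_deriv_lip da.
have [d2 d20 bl] := is_deriv_lip db.
move/is_derivP : da => da; move/is_derivP : db => db.
pose M := bil_bound B; have M0 : 0 <= M by exact: bil_bound_ge0.
pose K := (`|a'| + 1) * (`|b'| + 1).
have K0 : 0 <= K by rewrite mulr_ge0// addr_ge0.
apply: (@is_deriv_scaled _ _ _ _ _ _ (M * (`|b x| + `|a x| + K))).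
  by rewrite mulr_ge0// addr_ge0// addr_ge0.
move=> e e0 _; have [d3 d30 ae] := da _ e0; have [d4 d40 be] := db _ e0.
(* The radius [e] makes the product of the two increments, which is quadratic in [y - x], at most a
   multiple of [e] times the distance. *)
exists (Num.min (Num.min d1 d2) (Num.min (Num.min d3 d4) e)).
  by rewrite !lt_min d10 d20 d30 d40 e0.
move=> y Ay; rewrite !lt_min => /and3P[/andP[y1 y2] /andP[y3 y4] ye].
set n := `|y - x|; have n0 : 0 <= n by exact: normr_ge0.
have -> : B (a y) (b y) - B (a x) (b x) -
    (bil1 V B a' (b x) + bil2 V B (a x) b') (y - x) =
  B (a y - a x - a' (y - x)) (b x) + B (a x) (b y - b x - b' (y - x)) +
    B (a y - a x) (b y - b x).
  rewrite -[(bil1 _ _ _ _ + _) _]/(B (a' (y - x)) (b x) + B (a x) (b' (y - x))).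
  rewrite !bilBl !bilBr.
  abel.
have t1 : `|B (a y - a x - a' (y - x)) (b x)| <= M * `|b x| * (e * n).
  rewrite (le_trans (le_bil B _ _))// mulrAC ler_wpM2l ?mulr_ge0//.
  exact: ae.
have t2 : `|B (a x) (b y - b x - b' (y - x))| <= M * `|a x| * (e * n).
  rewrite (le_trans (le_bil B _ _))// ler_wpM2l ?mulr_ge0//.
  exact: be.
have t3 : `|B (a y - a x) (b y - b x)| <= M * K * (e * n).
  rewrite (le_trans (le_bil B _ _))// -!mulrA ler_wpM2l//.
  rewrite (le_trans (ler_pM _ _ (al _ Ay y1) (bl _ Ay y2)))//.
  rewrite -/n /K mulrACA -!mulrA ler_wpM2l ?addr_ge0// ler_wpM2l ?addr_ge0//.
  by rewrite ler_wpM2r// ltW.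
rewrite (le_trans (ler_normD _ _))// (le_trans (lerD (ler_normD _ _) t3))//.
rewrite (le_trans (lerD (lerD t1 t2) (lexx _)))//.
by rewrite le_eqVlt; apply/orP; left; apply/eqP; ring.
Qed.

End derivatives.

(** * Maps of class C^k and C^p *)

Section Ck_calculus.
Context {R : realType}.

Lemma Ck_sub k (E F : normedModType R) (A A' : set E) (h : E -> F) :
  A' `<=` A -> Ck k A h -> Ck k A' h.
Proof.
elim: k F h => [|k IH] F h A'A /=; first exact: continuous_subspaceW.
by case=> dh hdh Cdh; exists dh => [x /A'A /hdh|];
  [exact: is_deriv_sub|exact: IH].
Qed.

Lemma Ck_ext k (E F : normedModType R) (A : set E) (h h' : E -> F) :
  (forall x, A x -> h x = h' x) -> Ck k A h -> Ck k A h'.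
Proof.
case: k => [|k] hh' /=.
  move=> /within_continuousP hc; apply/within_continuousP => x Ax e e0.
  have [d d0 dh] := hc _ Ax _ e0.
  by exists d => // y Ay yx; rewrite -!hh'//; exact: dh.
case=> dh hdh Cdh; exists dh => // x Ax.
by apply: is_deriv_ext (hdh _ Ax).
Qed.

Lemma is_deriv_within (E F : normedModType R) (A : set E) (h : E -> F) :
  (forall x, A x -> exists u, is_deriv A h x u) -> {within A, continuous h}.
Proof.
move=> hA; apply/within_continuousP => x Ax e e0.
have [u /is_deriv_lip[d d0 dh]] := hA _ Ax.
have u0 : 0 < `|u| + 1 by rewrite ltr_wpDl.
exists (Num.min d (e / (`|u| + 1))); first by rewrite lt_min d0 divr_gt0.
move=> y Ay; rewrite lt_min => /andP[yd ye].
by rewrite (le_trans (dh _ Ay yd))// mulrC -ler_pdivlMr// ltW.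
Qed.

Lemma CkS k (E F : normedModType R) (A : set E) (h : E -> F) :
  Ck k.+1 A h -> Ck k A h.
Proof.
elim: k F h => [|k IH] F h.
  by case=> dh hdh _; apply: is_deriv_within => x Ax; exists (dh x); exact: hdh.
by case=> dh hdh Cdh; exists dh => //; exact: IH.
Qed.

Lemma Ck_le k l (E F : normedModType R) (A : set E) (h : E -> F) :
  (l <= k)%N -> Ck k A h -> Ck l A h.
Proof.
move=> /subnK <-; elim: (k - l)%N => [//|n IH].
by rewrite addSn => /CkS.
Qed.

Lemma Ck_cst k (E F : normedModType R) (A : set E) (a : F) :
  Ck k A (fun _ : E => a).
Proof.
elim: k F a => [|k IH] F a /=.
  by apply/within_continuousP => x Ax e e0; exists 1 => // y _ _;
    rewrite subrr normr0 ltW.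
by exists (fun _ => 0) => // x _; exact: is_deriv_cst.
Qed.

Lemma Ck_blin k (E F : normedModType R) (A : set E) (u : blin E F) : Ck k A u.
Proof.
apply: CkS; exists (fun _ => u); last exact: Ck_cst.
by move=> x _; exact: is_deriv_blin.
Qed.

Lemma Ck_add k (E F : normedModType R) (A : set E) (g h : E -> F) :
  Ck k A g -> Ck k A h -> Ck k A (fun x => g x + h x).
Proof.
elim: k F g h => [|k IH] F g h /=.
  move=> /within_continuousP gc /within_continuousP hc.
  apply/within_continuousP => x Ax e e0.
  have e20 : 0 < e / 2 by rewrite divr_gt0.
  have [d d0 dg] := gc _ Ax _ e20; have [d' d'0 dh] := hc _ Ax _ e20.
  exists (Num.min d d'); first by rewrite lt_min d0.
  move=> y Ay; rewrite lt_min => /andP[yd yd'].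
  rewrite (_ : _ - _ = (g y - g x) + (h y - h x)); last by abel.
  by rewrite (le_trans (ler_normD _ _))// (splitr e) lerD ?dg ?dh.
case=> dg gdg Cdg [dh hdh Cdh]; exists (fun x => dg x + dh x); last exact: IH.
by move=> x Ax; apply: is_deriv_add; [exact: gdg|exact: hdh].
Qed.

Lemma Ck_post k (E F G : normedModType R) (A : set E) (f : E -> F)
    (l : blin F G) : Ck k A f -> Ck k A (fun x => l (f x)).
Proof.
elim: k F G f l => [|k IH] F G f l /=.
  move=> /within_continuousP fc; apply/within_continuousP => x Ax e e0.
  have l0 : 0 < `|l| + 1 by rewrite ltr_wpDl.
  have [|d d0 df] := fc _ Ax (e / (`|l| + 1)); first by rewrite divr_gt0.
  exists d => // y Ay yx; rewrite -blinB (le_trans (le_blin _ _))//.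
  rewrite (le_trans (ler_wpM2l _ (df _ Ay yx)))//.
  by rewrite mulrCA ler_piMr ?(ltW e0)// ler_pdivrMr// mul1r lerDl.
case=> df fdf Cdf; exists (fun x => bcomp l (df x)).
  by move=> x Ax; apply: is_deriv_post; exact: fdf.
exact: (IH _ _ _ (bpost E l)).
Qed.

(** The product rule expresses the derivative by two bilinear maps, each applied to one factor and
    the derivative of the other, so the induction runs over all bilinear maps at once. *)
Lemma Ck_bil k (V E F G : normedModType R) (B : bilin E F G) (A : set V)
    (a : V -> E) (b : V -> F) :
  Ck k A a -> Ck k A b -> Ck k A (fun x => B (a x) (b x)).
Proof.
elim: k E F G B a b => [|k IH] E F G B a b.
  move=> /within_continuousP ac /within_continuousP bc.
  apply/within_continuousP => x Ax e e0.
  pose M := bil_bound B; have M0 : 0 <= M by exact: bil_bound_ge0.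
  pose C := M * (`|b x| + `|a x| + 1) + 1.
  have C0 : 0 < C by rewrite ltr_wpDl// mulr_ge0// !addr_ge0.
  (* The cap 1 makes the square of [e1] at most [e1]. *)
  pose e1 := Num.min 1 (e / C).
  have e10 : 0 < e1 by rewrite lt_min ltr01 divr_gt0.
  have [d d0 da] := ac _ Ax _ e10; have [d' d'0 db] := bc _ Ax _ e10.
  exists (Num.min d d'); first by rewrite lt_min d0.
  move=> y Ay; rewrite lt_min => /andP[/(da _ Ay) {}da /(db _ Ay) {}db].
  have e1le : e1 <= 1 by rewrite ge_min lexx.
  have -> : B (a y) (b y) - B (a x) (b x) =
      B (a y - a x) (b x) + B (a x) (b y - b x) + B (a y - a x) (b y - b x).
    by rewrite !bilBl !bilBr; abel.
  have t1 : `|B (a y - a x) (b x)| <= M * e1 * `|b x|.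
    by rewrite (le_trans (le_bil B _ _))// ler_wpM2r// ler_wpM2l.
  have t2 : `|B (a x) (b y - b x)| <= M * `|a x| * e1.
    by rewrite (le_trans (le_bil B _ _))// ler_wpM2l// mulr_ge0.
  have t3 : `|B (a y - a x) (b y - b x)| <= M * e1 * 1.
    rewrite (le_trans (le_bil B _ _))// -!mulrA ler_wpM2l// ler_pM//.
    exact: le_trans e1le.
  rewrite (le_trans (ler_normD _ _))// (le_trans (lerD (ler_normD _ _) t3))//.
  rewrite (le_trans (lerD (lerD t1 t2) (lexx _)))//.
  rewrite (le_trans (y := C * e1))//.
    rewrite -subr_ge0 (_ : _ - _ = e1) ?(ltW e10)// /C; ring.
  by rewrite mulrC -ler_pdivlMr// ge_min lexx orbT.
move=> Ca Cb; have Ca' := CkS Ca; have Cb' := CkS Cb.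
case: Ca => da ada Cda; case: Cb => db bdb Cdb.
exists (fun x => bil1 V B (da x) (b x) + bil2 V B (a x) (db x)).
  by move=> x Ax; apply: is_deriv_bil; [exact: ada|exact: bdb].
by apply: Ck_add; apply: IH.
Qed.

(** By the chain rule the derivative is composition, a bilinear map, applied to [dg \o f] and [df];
    the induction hypothesis covers the former and [Ck_bil] concludes. *)
Lemma Ck_comp k (E F G : normedModType R) (A : set E) (B : set F)
    (f : E -> F) (g : F -> G) :
  (forall x, A x -> B (f x)) -> Ck k A f -> Ck k B g -> Ck k A (g \o f).
Proof.
move=> AB; elim: k G g => [|k IH] G g.
  move=> /within_continuousP fc /within_continuousP gc.
  apply/within_continuousP => x Ax e e0.
  have [d d0 dg] := gc _ (AB _ Ax) _ e0.
  have [|r r0 df] := fc _ Ax (d / 2); first by rewrite divr_gt0.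
  exists r => // y Ay yx; apply: dg; first exact: AB.
  rewrite (le_lt_trans (df _ Ay yx))//; lra.
move=> Cf; have Cf' := CkS Cf; case: Cf => df fdf Cdf [dg gdg Cdg].
exists (fun x => bil_comp E F G (dg (f x)) (df x)).
  by move=> x Ax; apply: is_deriv_comp (fdf _ Ax) (gdg _ (AB _ Ax)).
by apply: Ck_bil => //; exact: IH.
Qed.

Definition smoothness_le (k : nat) (p : smoothness) : bool :=
  if p is Defs.Finite n then (k <= n)%N else true.

Lemma CpP p (E F : normedModType R) (A : set E) (h : E -> F) :
  Cp p A h <-> forall k, smoothness_le k p -> Ck k A h.
Proof.
case: p => [n|] /=; split=> // hk.
- by move=> k kn; exact: Ck_le hk.
- exact: hk.
- by move=> k; exact: hk.
Qed.

Lemma Cp_sub p (E F : normedModType R) (A A' : set E) (h : E -> F) :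
  A' `<=` A -> Cp p A h -> Cp p A' h.
Proof.
by move=> A'A /CpP hA; apply/CpP => k kp; apply: Ck_sub (hA _ kp).
Qed.

Lemma Cp_ext p (E F : normedModType R) (A : set E) (h h' : E -> F) :
  (forall x, A x -> h x = h' x) -> Cp p A h -> Cp p A h'.
Proof.
by move=> hh' /CpP hA; apply/CpP => k kp; apply: Ck_ext (hA _ kp).
Qed.

Lemma Cp_blin p (E F : normedModType R) (A : set E) (u : blin E F) : Cp p A u.
Proof. by apply/CpP => k _; exact: Ck_blin. Qed.

Lemma Cp_cst p (E F : normedModType R) (A : set E) (a : F) :
  Cp p A (fun _ : E => a).
Proof. by apply/CpP => k _; exact: Ck_cst. Qed.

Lemma Cp_add p (E F : normedModType R) (A : set E) (g h : E -> F) :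
  Cp p A g -> Cp p A h -> Cp p A (fun x => g x + h x).
Proof.
by move=> /CpP gA /CpP hA; apply/CpP => k kp; apply: Ck_add; auto.
Qed.

Lemma Cp_comp p (E F G : normedModType R) (A : set E) (B : set F)
    (f : E -> F) (g : F -> G) :
  (forall x, A x -> B (f x)) -> Cp p A f -> Cp p B g -> Cp p A (g \o f).
Proof.
move=> AB /CpP fA /CpP gB; apply/CpP => k kp.
by apply: (Ck_comp AB); auto.
Qed.

Lemma Cp_C1 p (E F : normedModType R) (A : set E) (h : E -> F) :
  smooth_ge1 p -> Cp p A h -> Ck 1 A h.
Proof. by move=> p1 /CpP; apply; case: p p1. Qed.

Lemma Cp_within p (E F : normedModType R) (A : set E) (h : E -> F) :
  Cp p A h -> {within A, continuous h}.
Proof. by move=> /CpP/(_ 0); apply; case: p. Qed.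

End Ck_calculus.

(** * Uniqueness, locality and lifting of derivatives on half spaces *)

Section half_space_derivatives.
Context {R : realType}.

Definition is_ray (E : normedModType R) (A : set E) (x v : E) :=
  exists2 d : R, 0 < d & forall t, 0 < t -> t < d -> A (x + t *: v).

(** A linear functional is nonnegative on [v] or on [- v]. This is what remains of openness at a
    boundary point, and it suffices for linear conclusions. *)
Lemma halfspace_ray (E : normedModType R) (alpha : E -> R) (A : set E) x v :
  halfspace_fun alpha -> open_in (hs_pos alpha) A -> A x ->
  is_ray A x v \/ is_ray A x (- v).
Proof.
move=> halpha /open_inP[AE] /(_ x) + Ax => /(_ Ax)[d d0 dA].
have dv : 0 < d / (`|v| + 1) by rewrite divr_gt0// ltr_wpDl.
have small (w : E) t : `|w| = `|v| -> 0 < t -> t < d / (`|v| + 1) ->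
    `|x + t *: w - x| < d.
  move=> wv t0 td; rewrite addrC addKr normrZ gtr0_norm// wv.
  rewrite (le_lt_trans (y := t * (`|v| + 1)))//.
    by rewrite ler_wpM2l ?(ltW t0)// lerDl.
  by rewrite -ltr_pdivlMr// ltr_wpDl.
case: halpha => [[la ca _]|aE].
  have alphaZ t w : alpha (x + t *: w) = alpha x + t * alpha w.
    by rewrite addrC la/= addrC.
  have [av|av] := leP 0 (alpha v); [left|right].
    exists (d / (`|v| + 1)) => // t t0 td; apply: dA; last exact: small.
    rewrite /hs_pos/= alphaZ addr_ge0//; first exact: (AE _ Ax).
    by rewrite mulr_ge0// ltW.
  exists (d / (`|v| + 1)) => // t t0 td; apply: dA; last first.
    by apply: small; rewrite ?normrN.
  have avN : alpha (- v) = - alpha v.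
    by have := la (-1) v 0; rewrite addr0 scaleN1r => ->;
       rewrite (_ : alpha 0 = 0) ?addr0 ?mulN1r//;
       have := la (-1) 0 0; rewrite addr0 scaler0 => ->; rewrite mulN1r addNr.
  rewrite /hs_pos/= alphaZ avN addr_ge0//; first exact: (AE _ Ax).
  by rewrite mulr_ge0 ?oppr_ge0// ltW.
left; exists (d / (`|v| + 1)) => // t t0 td; apply: dA; last exact: small.
by rewrite /hs_pos/= aE /= ler01.
Qed.

Lemma is_deriv_ray (E F : normedModType R) (A : set E) (h : E -> F) x
    (u : blin E F) v : is_deriv A h x u -> is_ray A x v ->
  forall e, 0 < e -> exists2 d, 0 < d & forall t, 0 < t -> t < d ->
    A (x + t *: v) /\ `|t^-1 *: (h (x + t *: v) - h x) - u v| <= e.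
Proof.
move=> /is_derivP hu [r r0 rA] e e0.
have v0 : 0 < `|v| + 1 by rewrite ltr_wpDl.
have [|d d0 dh] := hu (e / (`|v| + 1)); first by rewrite divr_gt0.
exists (Num.min r (d / (`|v| + 1))); first by rewrite lt_min r0 divr_gt0.
move=> t t0; rewrite lt_min => /andP[tr td]; have Ay := rA _ t0 tr.
split=> //; set y := x + t *: v.
have yx : y - x = t *: v by rewrite /y addrC addKr.
have nyx : `|y - x| = t * `|v| by rewrite yx normrZ gtr0_norm.
have := dh y Ay; rewrite nyx => /(_ _)/wrap[].
  rewrite (le_lt_trans (y := t * (`|v| + 1)))//.
    by rewrite ler_wpM2l ?(ltW t0)// lerDl.
  by rewrite -ltr_pdivlMr.
rewrite yx blinZ => hy.
have -> : t^-1 *: (h y - h x) - u v = t^-1 *: (h y - h x - t *: u v).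
  by rewrite [RHS]scalerBr scalerA mulVf ?gt_eqF// scale1r.
rewrite normrZ gtr0_norm ?invr_gt0// ler_pdivrMl// (le_trans hy)//.
rewrite mulrCA ler_wpM2l ?(ltW t0)// -mulrA ler_piMr ?(ltW e0)//.
by rewrite ler_pdivrMl// mulr1 lerDl.
Qed.

(** Along a ray both derivatives are limits of the same difference quotients; every direction or its
    opposite admits a ray, and linearity does the rest. *)
Lemma is_deriv_unique (E F : normedModType R) (alpha : E -> R) (A : set E)
    (h : E -> F) x (u v : blin E F) :
  halfspace_fun alpha -> open_in (hs_pos alpha) A -> A x ->
  is_deriv A h x u -> is_deriv A h x v -> u = v.
Proof.
move=> ha oA Ax hu hv; apply: blinP_eq => w.
have ray z : is_ray A x z -> u z = v z.
  move=> rz; apply/eqP; rewrite -subr_eq0 -normr_le0; apply/ler_addgt0Pl => e e0.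
  have e20 : 0 < e / 2 by rewrite divr_gt0.
  have [d d0 du] := is_deriv_ray hu rz e20.
  have [d' d'0 dv] := is_deriv_ray hv rz e20.
  pose t := Num.min d d' / 2.
  have m0 : 0 < Num.min d d' by rewrite lt_min d0.
  have t0 : 0 < t by rewrite divr_gt0.
  have : t < Num.min d d' by rewrite /t; lra.
  rewrite lt_min => /andP[td td'].
  have [_ ut] := du _ t0 td; have [_ vt] := dv _ t0 td'.
  rewrite addr0 (splitr e).
  rewrite (le_trans (ler_distD (t^-1 *: (h (x + t *: z) - h x)) _ _))// lerD//.
  by rewrite distrC.
have [/ray//|/ray] := halfspace_ray w ha oA Ax.
by rewrite !blinN => /oppr_inj.
Qed.

Lemma deriv_eq (E F : normedModType R) (alpha : E -> R) (A : set E)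
    (h : E -> F) x (u : blin E F) :
  halfspace_fun alpha -> open_in (hs_pos alpha) A -> A x ->
  is_deriv A h x u -> Defs.deriv A h x = u.
Proof.
move=> ha oA Ax hu; rewrite /Defs.deriv; apply: xget_unique => // v /= hv.
exact: (is_deriv_unique ha oA Ax hv hu).
Qed.

(** By uniqueness the local derivatives are values of the single function [deriv A h], which glues
    them. *)
Lemma Ck_local k (E F : normedModType R) (alpha : E -> R) (A : set E)
    (h : E -> F) : halfspace_fun alpha -> open_in (hs_pos alpha) A ->
  (forall x, A x -> exists N, [/\ open_in (hs_pos alpha) N, N x, N `<=` A &
    Ck k N h]) -> Ck k A h.
Proof.
move=> ha oA; elim: k F h => [|k IH] F h hN.
  apply/within_continuousP => x Ax e e0.
  have [N [/open_inP[_ oN] Nx NA /within_continuousP hc]] := hN _ Ax.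
  have [r r0 rN] := oN _ Nx; have [d d0 dh] := hc _ Nx _ e0.
  exists (Num.min r d); first by rewrite lt_min r0.
  move=> y Ay; rewrite lt_min => /andP[yr yd]; apply: dh => //.
  by apply: rN => //; exact: open_inS Ay.
have hA x N dN : A x -> open_in (hs_pos alpha) N -> N x ->
    is_deriv N h x dN -> is_deriv A h x dN.
  move=> Ax /open_inP[_ oN] Nx; have [r r0 rN] := oN _ Nx.
  apply: is_deriv_local r0 _ => y Ay yr.
  by apply: rN => //; exact: open_inS Ay.
exists (Defs.deriv A h) => [x Ax|].
  have [N [oN Nx NA [dN hdN CdN]]] := hN _ Ax.
  have hx := hA _ _ _ Ax oN Nx (hdN _ Nx).
  by rewrite (deriv_eq ha oA Ax hx).
apply: IH => x Ax; have [N [oN Nx NA [dN hdN CdN]]] := hN _ Ax.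
exists N; split => //; apply: Ck_ext CdN => y Ny.
by rewrite (deriv_eq ha oA (NA _ Ny) (hA _ _ _ (NA _ Ny) oN Ny (hdN _ Ny))).
Qed.

Lemma Cp_local p (E F : normedModType R) (alpha : E -> R) (A : set E)
    (h : E -> F) : halfspace_fun alpha -> open_in (hs_pos alpha) A ->
  (forall x, A x -> exists N, [/\ open_in (hs_pos alpha) N, N x, N `<=` A &
    Cp p N h]) -> Cp p A h.
Proof.
move=> ha oA hN; apply/CpP => k kp; apply: (Ck_local ha oA) => x Ax.
by have [N [? ? ? /CpP/(_ _ kp) ?]] := hN _ Ax; exists N.
Qed.

(** An isometry with closed range, the model being the inclusion of a closed subspace. Closedness is
    phrased by approximation because this form passes to spaces of operators, see
    [closed_embedding_post]. *)
Definition closed_embedding (E F : normedModType R) (j : blin E F) :=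
  (forall y, `|j y| = `|y|) /\
  forall z, (forall e, 0 < e -> exists y, `|j y - z| <= e) -> exists y, j y = z.

Lemma closed_embedding_inj (E F : normedModType R) (j : blin E F) :
  closed_embedding j -> injective j.
Proof.
move=> [jn _] x y jxy; apply/eqP; rewrite -subr_eq0 -normr_eq0 -jn blinB jxy.
by rewrite subrr normr0.
Qed.

Lemma blin_lift (V E F : normedModType R) (j : blin E F) (z : blin V F) :
  closed_embedding j -> (forall v, exists y, j y = z v) ->
  exists u, bcomp j u = z.
Proof.
move=> ej zj; have /choice[u ju] := zj; have jinj := closed_embedding_inj ej.
have lu : linear u.
  by move=> a x y; apply: jinj; rewrite blin_linear !ju blin_linear.
have bu x : `|u x| <= `|z| * `|x| by rewrite -ej.1 ju le_blin.
by exists (mkblin lu bu); apply: blinP_eq => x; exact: ju.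
Qed.

Lemma closed_embedding_post (V E F : normedModType R) (j : blin E F) :
  closed_embedding j -> closed_embedding (bpost V j).
Proof.
move=> ej; split=> [u|z zj].
  apply/eqP; rewrite eq_le; apply/andP; split; apply: blin_norm_le => // x.
    by rewrite bcompE ej.1 le_blin.
  by rewrite -ej.1 -bcompE; exact: le_blin.
apply: blin_lift => // v; apply: ej.2 => e e0.
have v0 : 0 < `|v| + 1 by rewrite ltr_wpDl.
have [|u ju] := zj (e / (`|v| + 1)); first by rewrite divr_gt0.
exists (u v); rewrite -[X in `|X|]/((bcomp j u - z) v).
rewrite (le_trans (le_blin _ _))// (le_trans (ler_wpM2r _ ju))//.
by rewrite mulrAC -mulrA ler_piMr ?(ltW e0)// ler_pdivrMr// mul1r lerDl.
Qed.

(** Difference quotients of [j \o h] along rays lie in the closed range of [j], hence so do the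
    values of the derivative, which therefore factors through [j]. The induction continues with
    postcomposition by [j], again a closed embedding. *)
Lemma Ck_lift k (V E F : normedModType R) (alpha : V -> R) (A : set V)
    (j : blin E F) (h : V -> E) :
  halfspace_fun alpha -> open_in (hs_pos alpha) A -> closed_embedding j ->
  Ck k A (j \o h) -> Ck k A h.
Proof.
move=> ha oA; elim: k E F j h => [|k IH] E F j h ej.
  move=> /within_continuousP hc; apply/within_continuousP => x Ax e e0.
  have [d d0 dh] := hc _ Ax _ e0; exists d => // y Ay yx.
  by rewrite -ej.1 blinB; exact: dh.
move=> [dh hdh Cdh].
have ex x : A x -> exists u, bcomp j u = dh x.
  move=> Ax; apply: blin_lift => // v.
  have ray w : is_ray A x w -> exists y, j y = dh x w.
    move=> rw; apply: ej.2 => e e0.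
    have [d d0 dE] := is_deriv_ray (hdh _ Ax) rw e0.
    have t0 : 0 < d / 2 by rewrite divr_gt0.
    have [|_ hd] := dE _ t0; first lra.
    exists ((d / 2)^-1 *: (h (x + d / 2 *: w) - h x)).
    by rewrite blinZ blinB.
  have [/ray//|/ray[y]] := halfspace_ray v ha oA Ax.
  by rewrite blinN => jy; exists (- y); rewrite blinN jy opprK.
exists (fun x => xget 0 [set u | bcomp j u = dh x]).
  move=> x Ax; case: xgetP => [u _ /= ju|no]; last first.
    by have [u ju] := ex _ Ax; have := no u.
  have /is_derivP hd := hdh _ Ax.
  apply/is_derivP => e /hd[d d0 dE]; exists d => // y Ay yx.
  by rewrite -ej.1 !(blinB j) -(bcompE j u) ju; exact: dE.
apply: IH (closed_embedding_post V ej) _; apply: Ck_ext Cdh => x Ax /=.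
case: xgetP => [u _ /= ->//|no].
by have [u ju] := ex _ Ax; have := no u.
Qed.

Lemma Cp_lift p (V E F : normedModType R) (alpha : V -> R) (A : set V)
    (j : blin E F) (h : V -> E) :
  halfspace_fun alpha -> open_in (hs_pos alpha) A -> closed_embedding j ->
  Cp p A (j \o h) -> Cp p A h.
Proof.
move=> ha oA ej /CpP hA; apply/CpP => k kp.
by apply: (Ck_lift ha oA ej); exact: hA.
Qed.

End half_space_derivatives.

(** * Smooth inverses on half spaces *)

Section mean_value.
Context {R : realType}.

(** A supremum argument: the supremum of the times at which the bound from 0 holds inherits it, and
    the local estimate there would push the bound further if it were below 1. *)
Lemma path_mean_value (F : normedModType R) (g : R -> F) (K : R) :
  (forall t, 0 <= t <= 1 -> exists2 d, 0 < d & forall s, 0 <= s <= 1 ->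
    `|s - t| < d -> `|g s - g t| <= K * `|s - t|) ->
  `|g 1 - g 0| <= K.
Proof.
move=> gK; pose T := [set t : R | 0 <= t <= 1 /\ `|g t - g 0| <= K * t].
have T0 : T 0 by rewrite /T/= lexx ler01 subrr normr0 mulr0.
have supT : has_sup T.
  by split; [exists 0|exists 1 => t [/andP[_ ?]]].
pose tau := sup T.
have tau01 : 0 <= tau <= 1.
  rewrite (sup_upper_bound supT)//=; apply: ge_sup; first by exists 0.
  by move=> t [/andP[_ ?]].
have [d d0 dg] := gK _ tau01.
have K0 : 0 <= K.
  have [t t01 /andP[t0 td]] : exists2 t, 0 <= t <= 1 & 0 < `|t - tau| < d.
    pose m := Num.min (d / 2) 2^-1.
    have m0 : 0 < m by rewrite lt_min; lra.
    have m1 : m <= 2^-1 by rewrite ge_min lexx orbT.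
    have m2 : m <= d / 2 by rewrite ge_min lexx.
    have [tau2|tau2] := leP tau 2^-1; [exists (tau + m)|exists (tau - m)].
    - lra.
    - by rewrite (_ : _ - _ = m) ?gtr0_norm; [lra| |ring].
    - lra.
    - by rewrite (_ : _ - _ = - m) ?normrN ?gtr0_norm; [lra| |ring].
  have := dg _ t01 td.
  by move=> /(le_trans (normr_ge0 _)); rewrite pmulr_lge0.
have Ttau : T tau.
  split=> //; have [t [t01 gt] tt] := sup_adherent d0 supT.
  rewrite -/tau in tt; have ttau : t <= tau by exact: sup_upper_bound.
  have nt : `|t - tau| = tau - t by rewrite distrC ger0_norm ?subr_ge0.
  have := dg t t01; rewrite nt distrC => /(_ _)/wrap[|gtau]; first lra.
  rewrite (le_trans (ler_distD (g t) _ _))//.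
  by rewrite (le_trans (lerD gtau gt))// -mulrDr subrK.
have [tau1|] := ltP tau 1; last first.
  move=> t2; case/andP: tau01 => _ t1; have t3 : tau = 1 by lra.
  by case: Ttau => _; rewrite t3 mulr1.
pose s := Num.min 1 (tau + d / 2).
have s1 : s <= 1 by rewrite ge_min lexx.
have s2 : s <= tau + d / 2 by rewrite ge_min lexx orbT.
have s3 : tau < s by rewrite lt_min tau1/=; lra.
have s01 : 0 <= s <= 1 by lra.
have ns : `|s - tau| = s - tau by rewrite gtr0_norm ?subr_gt0.
have : T s.
  split=> //; have := dg s s01; rewrite ns => /(_ _)/wrap[|gs]; first lra.
  rewrite (le_trans (ler_distD (g tau) _ _))//.
  by case: Ttau => _ gt; rewrite (le_trans (lerD gs gt))// -mulrDr subrK.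
by move=> /(sup_upper_bound supT); rewrite -/tau leNgt s3.
Qed.

Lemma mean_value (E F : normedModType R) (A : set E) (h : E -> F)
    (dh : E -> blin E F) (M : R) x y :
  (forall t, 0 <= t <= 1 -> A (x + t *: (y - x))) ->
  (forall z, A z -> is_deriv A h z (dh z) /\ `|dh z| <= M) ->
  `|h y - h x| <= M * `|y - x|.
Proof.
(* With the slack [e], differentiability at each point of the segment yields the local Lipschitz
   estimate of [path_mean_value]. *)
move=> Axy hdh; apply/ler_addgt0Pr => e e0.
have n0 : 0 < `|y - x| + 1 by rewrite ltr_wpDl.
pose p t := x + t *: (y - x).
have -> : h y - h x = h (p 1) - h (p 0).
  by rewrite /p scale1r scale0r addr0 (_ : x + (y - x) = y)//; abel.
apply: (@path_mean_value _ (h \o p)) => t t01.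
have [/is_derivP hd dM] := hdh _ (Axy _ t01).
have [|d d0 dE] := hd (e / (`|y - x| + 1)); first by rewrite divr_gt0.
exists (d / (`|y - x| + 1)) => [|s s01 st]; first by rewrite divr_gt0.
have pst : p s - p t = (s - t) *: (y - x) by rewrite scalerBl /p opprD addrACA subrr add0r.
rewrite /=; have := dE (p s) (Axy _ s01); rewrite -/(p t) pst normrZ => /(_ _)/wrap[].
  rewrite (le_lt_trans (y := `|s - t| * (`|y - x| + 1)))//.
    by rewrite ler_wpM2l// lerDl.
  by rewrite -ltr_pdivlMr.
set w := dh _ _ => hw; rewrite -(subrK w (h (p s) - h (p t))).
rewrite (le_trans (ler_normD _ _))// addrC mulrDl lerD//.
  rewrite /w (le_trans (le_blin _ _))// normrZ mulrCA mulrC ler_wpM2r//.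
  by rewrite ler_wpM2r.
rewrite (le_trans hw)// mulrCA mulrC ler_wpM2r// mulrAC -mulrA.
by rewrite ler_piMr ?(ltW e0)// ler_pdivrMr// mul1r lerDl.
Qed.

Lemma half_contraction_fixpoint (E : completeNormedModType R) (C : set E)
    (f : E -> E) x0 : closed C -> C x0 -> (forall x, C x -> C (f x)) ->
  (forall x y, C x -> C y -> `|f x - f y| <= 2^-1 * `|x - y|) ->
  exists2 p, C p & f p = p.
Proof.
move=> cC Cx0 Cf fl; have fC : {homo f : x / C x >-> C x} by [].
have [||p Cp pf] := @banach_fixed_point _ _ C (mkfun_fun fC) _ cC.
- exists (2^-1)%:nng; split=> /=; first by rewrite invf_lt1// ltr1n.
  by move=> [x y] [/= Cx Cy]; exact: fl.
- by exists x0.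
- by exists p.
Qed.

End mean_value.

Section half_space_geometry.
Context {R : realType}.

Lemma halfspace_continuous (E : normedModType R) (alpha : E -> R) :
  halfspace_fun alpha -> continuous alpha.
Proof. by case=> [[] //|->] x; exact: cvg_cst. Qed.

Lemma hs_pos_closed (E : normedModType R) (alpha : E -> R) :
  halfspace_fun alpha -> closed (hs_pos alpha).
Proof.
move=> /halfspace_continuous ca.
rewrite (_ : hs_pos alpha = alpha @^-1` [set x | 0 <= x])//.
by apply: closed_comp => [x _|]; [exact: ca|exact: closed_ge].
Qed.

Lemma scalar_fun0 (E : normedModType R) (alpha : E -> R) : scalar alpha ->
  alpha 0 = 0.
Proof.
by move=> la; have := la (-1) 0 0; rewrite addr0 scaler0 => ->;
   rewrite /= mulN1r addNr.
Qed.

Lemma scalar_funZ (E : normedModType R) (alpha : E -> R) a x : scalar alpha ->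
  alpha (a *: x) = a * alpha x.
Proof. by move=> la; have := la a x 0; rewrite !addr0 scalar_fun0// addr0. Qed.

Lemma scalar_funD (E : normedModType R) (alpha : E -> R) x y : scalar alpha ->
  alpha (x + y) = alpha x + alpha y.
Proof. by move=> la; have := la 1 x y; rewrite scale1r /= mul1r. Qed.

Lemma scalar_funB (E : normedModType R) (alpha : E -> R) x y : scalar alpha ->
  alpha (x - y) = alpha x - alpha y.
Proof. by move=> la; rewrite scalar_funD// -scaleN1r scalar_funZ// mulN1r. Qed.

Lemma hs_pos_segment (E : normedModType R) (alpha : E -> R) x y t :
  halfspace_fun alpha -> hs_pos alpha x -> hs_pos alpha y -> 0 <= t <= 1 ->
  hs_pos alpha (x + t *: (y - x)).
Proof.
rewrite /hs_pos/= => -[[la _ _] x0 y0 t01|-> _ _ _]; last exact: ler01.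
rewrite scalar_funD// scalar_funZ// scalar_funB//.
rewrite (_ : _ + _ = (1 - t) * alpha x + t * alpha y); last by ring.
by case/andP: t01 => t0 t1; rewrite addr_ge0// mulr_ge0// subr_ge0.
Qed.

End half_space_geometry.

(** * Inverses of operators and of perturbations of the identity *)

Section smooth_inverse.
Context {R : realType}.

Definition blin_inverse (E F : normedModType R) (u : blin E F) (w : blin F E) :=
  (forall x, w (u x) = x) /\ (forall y, u (w y) = y).

(** Solutions of [x + s x = y] are fixed points of a contraction; the lower bound of [x + s x] by
    half the norm of [x] gives both injectivity and the bound 2. *)
Lemma blin_neumann (E : completeNormedModType R) (s : blin E E) :
  `|s| <= 2^-1 -> exists w, blin_inverse (bid E + s) w /\ `|w| <= 2.
Proof.
move=> s2; have sle x : `|s x| <= 2^-1 * `|x|.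
  by rewrite (le_trans (le_blin _ _))// ler_wpM2r.
have ex y : exists x, x + s x = y.
  have fl x x' : setT x -> setT x' ->
      `|(y - s x) - (y - s x')| <= 2^-1 * `|x - x'|.
    move=> _ _; rewrite (_ : _ - _ = s (x' - x)); last by rewrite blinB; abel.
    by rewrite distrC sle.
  have [x _ xy] := @half_contraction_fixpoint R E setT (fun x => y - s x) 0
    closedT I (fun _ _ => I) fl.
  by exists x; rewrite -{1}xy subrK.
have le x : `|x| <= 2 * `|x + s x|.
  rewrite -{1}(addrK (s x) x).
  have := ler_normB (x + s x) (s x); rewrite addrK; have := sle x; lra.
have inj x x' : x + s x = x' + s x' -> x = x'.
  move=> xx'; apply/eqP; rewrite -subr_eq0 -normr_le0 (le_trans (le _))//.
  rewrite (_ : _ + _ = (x + s x) - (x' + s x')); last by rewrite blinB; abel.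
  by rewrite xx' subrr normr0 mulr0.
have /choice[w wE] := ex.
have lw : linear w.
  move=> a x y; apply: inj; rewrite wE blin_linear -{1}(wE x) -{1}(wE y).
  by rewrite scalerDr; abel.
have bw y : `|w y| <= 2 * `|y| by rewrite -{2}(wE y) le.
exists (mkblin lw bw); split; last exact: blin_norm_le.
by split=> [x|y]; [apply: inj; rewrite wE|exact: wE].
Qed.

(** The resolvent identity, which transfers continuity and differentiability from operators to their
    inverses. *)
Lemma blin_inverse_sub (E F : normedModType R) (u u' : blin E F)
    (w w' : blin F E) : blin_inverse u w -> blin_inverse u' w' ->
  w' - w = bcomp w' (bcomp (u - u') w).
Proof.
move=> [wu uw] [wu' uw']; apply: blinP_eq => z.
rewrite -[LHS]/(w' z - w z) -[RHS]/(w' (u (w z) - u' (w z))).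
by rewrite blinB uw wu'.
Qed.

(** Applying the resolvent identity twice isolates the first order term [- w du w]; what is left is
    a quadratic term and the remainder of [u]. *)
Lemma is_deriv_inv (V E F : normedModType R) (A : set V)
    (u : V -> blin E F) (w : V -> blin F E) (M : R) x du : 0 <= M -> A x ->
  (forall x, A x -> blin_inverse (u x) (w x) /\ `|w x| <= M) ->
  is_deriv A u x du ->
  is_deriv A w x
    (- bil2 V (bil_comp F F E) (w x) (bil1 V (bil_comp F E F) du (w x))).
Proof.
move=> M0 Ax uw hu; have [d d0 ul] := is_deriv_lip hu.
move/is_derivP : hu => hu; pose K := `|du| + 1.
have K0 : 0 <= K by rewrite addr_ge0.
apply: (@is_deriv_scaled _ _ _ _ _ _ _ (M * (M * (K * K * M) + M))).
  by rewrite mulr_ge0// addr_ge0// !mulr_ge0.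
move=> e e0 _; have [d' d'0 ue] := hu _ e0.
exists (Num.min (Num.min d d') e); first by rewrite !lt_min d0 d'0 e0.
move=> y Ay; rewrite !lt_min => /andP[/andP[yd yd'] ye].
have [iwx wx] := uw _ Ax; have [iwy wy] := uw _ Ay.
set v := y - x; pose D := u y - u x.
have Dl : `|D| <= K * `|v| by exact: ul.
have wl : `|w y - w x| <= M * (K * `|v| * M).
  rewrite (blin_inverse_sub iwx iwy) (le_trans (bcomp_norm _ _))// ler_pM//.
  by rewrite (le_trans (bcomp_norm _ _))// ler_pM// distrC.
have -> : w y - w x - (- bil2 V (bil_comp F F E) (w x)
      (bil1 V (bil_comp F E F) du (w x))) v =
    - (bcomp (w y - w x) (bcomp D (w x)) + bcomp (w x) (bcomp (D - du v) (w x))).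
  rewrite [in LHS](blin_inverse_sub iwx iwy); apply: blinP_eq => z.
  rewrite -[LHS]/(w y (u x (w x z) - u y (w x z)) - - (w x (du v (w x z)))).
  rewrite -[RHS]/(- ((w y - w x) (u y (w x z) - u x (w x z)) +
    w x (u y (w x z) - u x (w x z) - du v (w x z)))).
  rewrite -[(w y - w x) _]/(w y (u y (w x z) - u x (w x z)) -
    w x (u y (w x z) - u x (w x z))).
  by rewrite !blinB; abel.
rewrite normrN (le_trans (ler_normD _ _))//.
have t1 : `|bcomp (w y - w x) (bcomp D (w x))| <=
    M * (K * `|v| * M) * (K * e * M).
  rewrite (le_trans (bcomp_norm _ _))// ler_pM// (le_trans (bcomp_norm _ _))//.
  by rewrite ler_pM// (le_trans Dl)// ler_wpM2l// ltW.
have t2 : `|bcomp (w x) (bcomp (D - du v) (w x))| <= M * (e * `|v| * M).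
  rewrite (le_trans (bcomp_norm _ _))// ler_pM// (le_trans (bcomp_norm _ _))//.
  by rewrite ler_pM// ue.
rewrite (le_trans (lerD t1 t2))// le_eqVlt; apply/orP; left; apply/eqP; ring.
Qed.

Lemma Ck_inv k (V E F : normedModType R) (A : set V)
    (u : V -> blin E F) (w : V -> blin F E) (M : R) : 0 <= M ->
  (forall x, A x -> blin_inverse (u x) (w x) /\ `|w x| <= M) ->
  Ck k A u -> Ck k A w.
Proof.
move=> M0 uw; elim: k => [|k IH].
  move=> /within_continuousP uc; apply/within_continuousP => x Ax e e0.
  have M1 : 0 < M * M + 1 by rewrite ltr_wpDl// mulr_ge0.
  have [|d d0 du] := uc _ Ax (e / (M * M + 1)); first by rewrite divr_gt0.
  exists d => // y Ay yx; have [iwx wx] := uw _ Ax; have [iwy wy] := uw _ Ay.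
  rewrite (blin_inverse_sub iwx iwy).
  rewrite (le_trans (y := M * (e / (M * M + 1) * M)))//.
    rewrite (le_trans (bcomp_norm _ _))// ler_pM// (le_trans (bcomp_norm _ _))//.
    by rewrite ler_pM// distrC du.
  rewrite mulrCA -mulrA ler_piMr ?(ltW e0)// mulrC ler_pdivrMr// mul1r.
  by rewrite lerDl.
move=> Cu; have Cw := IH (CkS Cu); case: Cu => du hdu Cdu.
exists (fun x => (- bid _ : blin _ _)
    (bil2 V (bil_comp F F E) (w x) (bil1 V (bil_comp F E F) (du x) (w x)))).
  by move=> x Ax; apply: is_deriv_inv uw (hdu _ Ax).
by apply: Ck_post; do 2![apply: Ck_bil => //].
Qed.

Lemma is_deriv_inverse (E F : normedModType R) (A : set E) (B : set F)
    (psi : E -> F) (chi : F -> E) y u w :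
  (forall y, B y -> A (chi y) /\ psi (chi y) = y) ->
  (forall y y', B y -> B y' -> `|chi y - chi y'| <= 2 * `|y - y'|) ->
  B y -> blin_inverse u w -> is_deriv A psi (chi y) u -> is_deriv B chi y w.
Proof.
move=> BA chil By [wu _] /is_derivP hu.
apply: (@is_deriv_scaled _ _ _ _ _ _ _ (`|w| * 2)); first by rewrite mulr_ge0.
move=> e e0 _; have [d d0 ue] := hu _ e0.
exists (d / 2); first by rewrite divr_gt0.
move=> z Bz zy; have zl := chil _ _ Bz By.
have := ue _ (BA _ Bz).1; rewrite (BA _ Bz).2 (BA _ By).2 => /(_ _)/wrap[|he].
  by rewrite (le_lt_trans zl)//; lra.
rewrite (_ : _ - _ = - w (z - y - u (chi z - chi y))); last first.
  by rewrite [in RHS]blinB wu; abel.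
rewrite normrN (le_trans (le_blin _ _))// -!mulrA ler_wpM2l//.
by rewrite (le_trans he)// mulrCA ler_wpM2l// ltW.
Qed.

(** The derivative of [chi] at [y] inverts that of [psi] at [chi y]; inversion preserves the class
    by [Ck_inv], and the induction hypothesis handles the composition with [chi]. *)
Lemma Ck_inverse k (E F : normedModType R) (A : set E) (B : set F)
    (psi : E -> F) (chi : F -> E) :
  (forall y, B y -> A (chi y) /\ psi (chi y) = y) ->
  (forall y y', B y -> B y' -> `|chi y - chi y'| <= 2 * `|y - y'|) ->
  (forall x u, A x -> is_deriv A psi x u ->
     exists w, blin_inverse u w /\ `|w| <= 2) ->
  Ck k A psi -> Ck k B chi.
Proof.
move=> BA chil inv; elim: k => [_|k IH].
  apply/within_continuousP => y By e e0; exists (e / 2).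
    by rewrite divr_gt0.
  by move=> z Bz zy; rewrite (le_trans (chil _ _ Bz By))//; lra.
move=> Cpsi; have Cchi := IH (CkS Cpsi); case: Cpsi => dpsi hpsi Cdpsi.
have /choice[w wE] : forall x, exists w, A x ->
    blin_inverse (dpsi x) w /\ `|w| <= 2.
  move=> x; have [Ax|nAx] := pselect (A x); last by exists 0.
  by have [w ?] := inv _ _ Ax (hpsi _ Ax); exists w.
exists (w \o chi).
  move=> y By; have [Ay _] := BA _ By.
  by apply: is_deriv_inverse (hpsi _ Ay) => //; have [] := wE _ Ay.
apply: (@Ck_inv _ _ _ _ _ (dpsi \o chi) _ 2) => //.
  by move=> y By; apply: wE; exact: (BA _ By).1.
by apply: Ck_comp Cchi Cdpsi => y /BA[].
Qed.

(* A perturbation [x + r x] of the identity with [r] vanishing to first order,  *)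
(* along directions in which [alpha] is constant, is inverted by the fixed      *)
(* points of the contractions [x |-> y - r x], which preserve the half space.   *)
Lemma halfspace_inverse p (E : completeNormedModType R) (alpha : E -> R)
    (A : set E) (r : E -> E) :
  smooth_ge1 p -> halfspace_fun alpha -> open_in (hs_pos alpha) A -> A 0 ->
  (forall x y, A x -> alpha (y + r x) = alpha y) ->
  r 0 = 0 -> is_deriv A r 0 0 -> Cp p A r ->
  exists (A' B' : set E) (chi : E -> E),
    [/\ open_in (hs_pos alpha) A', open_in (hs_pos alpha) B', A' `<=` A, A' 0 &
    [/\ forall x, A' x -> B' (x + r x) /\ chi (x + r x) = x,
        forall y, B' y -> A' (chi y) /\ chi y + r (chi y) = y &
        Cp p B' chi]].
Proof.
move=> p1 ha oA A0 ar r0 dr0 Cr.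
have [dr hdr Cdr] := Cp_C1 p1 Cr.
have drE : dr 0 = 0 by apply: is_deriv_unique (hdr _ A0) dr0; eassumption.
move/within_continuousP : Cdr => Cdr.
have [|d d0 drd] := Cdr _ A0 2^-1; first by rewrite invr_gt0.
move: (oA) => /open_inP[Ahs /(_ _ A0)[d' d'0 dA]].
pose rho := Num.min d d' / 2.
have m0 : 0 < Num.min d d' by rewrite lt_min d0.
have rho0 : 0 < rho by rewrite divr_gt0.
have rhod : rho < Num.min d d' by rewrite /rho; lra.
move: rhod; rewrite lt_min => /andP[rhod rhod'].
(* On this closed convex half ball the derivative of [r] has norm at most 1/2, by its continuity at
   0, so the mean value estimate makes [r] a contraction. *)
pose C := [set x | hs_pos alpha x /\ `|x| <= rho].
have CA : C `<=` A.
  by move=> x [hx xr]; apply: dA; rewrite ?subr0// (le_lt_trans xr).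
have drC x : C x -> `|dr x| <= 2^-1.
  move=> Cx; have := drd _ (CA _ Cx); rewrite drE !subr0; apply.
  by case: Cx => _ xr; rewrite (le_lt_trans xr).
have hs0 : hs_pos alpha 0 by exact: Ahs.
have C0 : C 0 by split; rewrite ?normr0 ?ltW.
have Cseg x y t : C x -> C y -> 0 <= t <= 1 -> C (x + t *: (y - x)).
  move=> [hx xr] [hy yr] t01; split; first exact: hs_pos_segment.
  rewrite (_ : _ + _ = (1 - t) *: x + t *: y); last first.
    by rewrite scalerBl scale1r scalerBr; abel.
  rewrite (le_trans (ler_normD _ _))// !normrZ.
  case/andP: t01 => t0 t1; rewrite !ger0_norm ?subr_ge0//.
  have := ler_wpM2l t0 yr; have : (1 - t) * `|x| <= (1 - t) * rho.
    by rewrite ler_wpM2l// subr_ge0.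
  lra.
have rlip x y : C x -> C y -> `|r y - r x| <= 2^-1 * `|y - x|.
  move=> Cx Cy; apply: (@mean_value _ _ _ C _ dr).
    by move=> t t01; exact: Cseg.
  by move=> z Cz; split; [apply: is_deriv_sub CA (hdr _ (CA _ Cz))|exact: drC].
have rC x : C x -> `|r x| <= 2^-1 * `|x|.
  by move=> Cx; have := rlip _ _ C0 Cx; rewrite r0 !subr0.
have hsr x y : A x -> hs_pos alpha (y + r x) <-> hs_pos alpha y.
  by move=> Ax; rewrite /hs_pos/= ar.
have cC : closed C.
  rewrite (_ : C = hs_pos alpha `&` closed_ball 0 rho).
    by apply: closedI; [exact: hs_pos_closed|exact: closed_ball_closed].
  by rewrite closed_ballE//; apply/seteqP; split=> x [hx]; rewrite /closed_ball_/=
     sub0r normrN.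
have psilip x x' : C x -> C x' -> `|x - x'| <= 2 * `|x + r x - (x' + r x')|.
  move=> Cx Cx'; have := rlip _ _ Cx' Cx.
  have := ler_normB (x + r x - (x' + r x')) (r x - r x').
  rewrite (_ : x + r x - (x' + r x') - (r x - r x') = x - x'); last by abel.
  lra.
(* A solution satisfies [x = y - r x], hence has at most twice the norm of [y]; targets below
   [rho / 2] thus have solutions strictly below [rho], which makes [A'] relatively open. *)
pose B' := [set y | hs_pos alpha y /\ `|y| < rho / 2].
pose A' := [set x | [/\ hs_pos alpha x, `|x| < rho & `|x + r x| < rho / 2]].
have A'C : A' `<=` C by move=> x [hx xr _]; split; rewrite ?ltW.
have ex y : B' y -> exists x, A' x /\ x + r x = y.
  move=> [hy yr].
  have fC x : C x -> C (y - r x).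
    move=> Cx; split; first by apply/(hsr x _ (CA _ Cx)); rewrite subrK.
    have := ler_normB y (r x); have := rC _ Cx; case: Cx => _; lra.
  have fl x x' : C x -> C x' -> `|(y - r x) - (y - r x')| <= 2^-1 * `|x - x'|.
    move=> Cx Cx'; rewrite (_ : _ - _ = r x' - r x); last by abel.
    by rewrite [X in _ * X]distrC rlip.
  have [x Cx xy] := @half_contraction_fixpoint R E C _ 0 cC C0 fC fl.
  have xy' : x + r x = y by rewrite -{1}xy subrK.
  exists x; split=> //; split; [by case: Cx| |by rewrite xy'].
  have := ler_normB y (r x); rewrite xy; have := rC _ Cx; case: Cx => _; lra.
have /choice[chi chiE] : forall y, exists x, B' y -> A' x /\ x + r x = y.
  by move=> y; have [/ex[x]|] := pselect (B' y); [exists x|exists 0].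
have A'A : A' `<=` A by move=> x /A'C /CA.
have BP x : A' x -> B' (x + r x).
  by move=> A'x; have [hx xr xrr] := A'x; split=> //; apply/hsr => //; exact: A'A.
have oA' : open_in (hs_pos alpha) A'.
  apply/open_inP; split=> [x []//|x A'x]; have [hx xr xrr] := A'x.
  have [d1 d10 dE] := is_deriv_lip (hdr _ (A'A _ A'x)).
  (* Near [x] the map [r] is Lipschitz with constant the norm of [dr x] plus 1, and the identity
     adds another 1. *)
  pose K := `|dr x| + 2; have K0 : 0 < K by rewrite ltr_wpDl.
  pose e1 := Num.min (rho - `|x|) ((rho / 2 - `|x + r x|) / K).
  have e10 : 0 < e1 by rewrite lt_min divr_gt0 ?subr_gt0 ?xr.
  exists (Num.min d1 e1); first by rewrite lt_min d10.
  move=> y hy; rewrite !lt_min => /and3P[yd y1 y2].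
  have yr : `|y| < rho by have := ler_normB y x; have := ler_distD 0 y x;
    have := lerB_dist y x; lra.
  split=> //; have Ay : A y by apply: CA; split; rewrite ?ltW.
  have := dE _ Ay yd; have := ler_normD (y - x) (r y - r x).
  rewrite (_ : y - x + (r y - r x) = (y + r y) - (x + r x)); last by abel.
  have := lerB_dist (y + r y) (x + r x).
  move: y2; rewrite ltr_pdivlMr// /K; lra.
exists A', B', chi; split=> //.
- apply/open_inP; split=> [y []//|y [hy yr]].
  exists (rho / 2 - `|y|); first by rewrite subr_gt0.
  by move=> z hz zy; split=> //; have := lerB_dist z y; lra.
- by split=> //; rewrite ?normr0// r0 addr0 normr0 divr_gt0.
split.
- move=> x A'x; split; first exact: BP.
  have [A'c cE] := chiE _ (BP _ A'x); apply/eqP; rewrite -subr_eq0 -normr_le0.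
  by rewrite (le_trans (psilip _ _ (A'C _ A'c) (A'C _ A'x)))// cE subrr normr0
     mulr0.
- by move=> y /chiE.
have CrA' : Cp p A' (fun x => x + r x).
  by apply: Cp_add; [exact: (Cp_blin _ _ (bid E))|exact: Cp_sub Cr].
move/CpP : CrA' => CrA'; apply/CpP => k kp.
apply: (@Ck_inverse k _ _ A' B' (fun x => x + r x)); last exact: CrA'.
- by move=> y /chiE.
- move=> y y' By By'; have [Ay yE] := chiE _ By; have [Ay' yE'] := chiE _ By'.
  by have := psilip _ _ (A'C _ Ay) (A'C _ Ay'); rewrite yE yE'.
- move=> x u A'x hu.
  have hu' : is_deriv A' (fun x => x + r x) x (bid E + dr x).
    apply: is_deriv_add; first exact: (is_deriv_blin _ _ (bid E)).
    by apply: is_deriv_sub A'A (hdr _ (A'A _ A'x)).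
  rewrite (is_deriv_unique ha oA' A'x hu hu').
  by apply: blin_neumann; exact: drC (A'C _ A'x).
Qed.

End smooth_inverse.

(** * Open mappings and splittings *)

Section product_complete.
Context {R : realType} (E F : completeNormedModType R).

(* The alias lets the pointed topological structures be inferred. *)
Definition banach_prod : Type := E * F.

HB.instance Definition _ := NormedModule.copy banach_prod (E * F)%type.

Lemma banach_prod_cauchy_cvg (G : set_system banach_prod) :
  ProperFilter G -> cauchy G -> cvg G.
Proof.
move=> GG /cauchy_ballP Gc.
have c1 : cauchy (fst @ G).
  apply/cauchy_ballP => e e0; have [[P Q] /= [GP GQ] PQ] := Gc _ e0.
  exists (fst @` P, fst @` Q) => /=.
    by split; [apply: filterS GP|apply: filterS GQ] => v Pv; exists v.
  by move=> [_ _] /= [[v Pv <-] [w Qw <-]]; have [] := PQ (v, w) (conj Pv Qw).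
have c2 : cauchy (snd @ G).
  apply/cauchy_ballP => e e0; have [[P Q] /= [GP GQ] PQ] := Gc _ e0.
  exists (snd @` P, snd @` Q) => /=.
    by split; [apply: filterS GP|apply: filterS GQ] => v Pv; exists v.
  by move=> [_ _] /= [[v Pv <-] [w Qw <-]]; have [] := PQ (v, w) (conj Pv Qw).
move/cauchy_cvg : c1 => c1; move/cauchy_cvg : c2 => c2.
apply/cvg_ex; exists (lim (fst @ G), lim (snd @ G)).
move=> P nP; have : G ((fun z : banach_prod => (z.1, z.2)) @^-1` P).
  exact: (cvg_pair c1 c2 nP).
by apply: filterS => -[].
Qed.

HB.instance Definition _ :=
  Uniform_isComplete.Build banach_prod banach_prod_cauchy_cvg.

End product_complete.

Section open_mapping.
Context {R : realType} (Z E : completeNormedModType R) (T : blin Z E).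
Hypothesis Tsurj : forall w, exists z, T z = w.

(* Baire's theorem gives the density of the image of a ball in a ball. *)
Lemma open_mapping_approx : exists2 K : R, 0 <= K &
  forall w e, 0 < e -> exists z, `|z| <= K * `|w| /\ `|w - T z| <= e.
Proof.
pose M n : set E := closure (T @` [set z : Z | `|z| <= n%:R]).
have [n [U [oU U0 UM]]] : exists n, exists U, [/\ open U, U !=set0 & U `<=` M n].
  apply: contrapT => /forallNP noU.
  have dM n : open (~` M n) /\ dense (~` M n).
    split; first exact/closed_openC/closed_closure.
    move=> O O0 oO; apply: contrapT => /set0P/negP/negPn/eqP OM.
    by apply: (noU n); exists O; split=> //; exact/subsets_disjoint.
  have [w [_ wM]] := Baire dM (O := setT) (ex_intro _ 0 I) openT.
  have [z zw] := Tsurj w; apply: (wM (Num.truncn `|z|).+1) => //.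
  by apply: subset_closure; exists z => //=; rewrite ltW// truncnS_gt.
have [a Ua] := U0.
have /near_normP[r r0 rU] : nbhs a U by exact: open_nbhs_nbhs.
have MP y e : M n y -> 0 < e -> exists2 z, `|z| <= n%:R & `|y - T z| < e.
  move=> My e0; have [|_ [[z zn <-] yz]] := My [set y' | `|y - y'| < e].
    by apply/near_normP; exists e => // y'; rewrite distrC.
  by exists z.
(* Subtracting approximations of [a + y] and of [a] moves the ball of density from [a] to 0. *)
have ball0 y e : `|y| < r -> 0 < e ->
    exists2 z, `|z| <= 2 * n%:R & `|y - T z| <= e.
  move=> yr e0; have e20 : 0 < e / 2 by rewrite divr_gt0.
  have [|z1 z1n yz1] := MP (a + y) _ _ e20.
    by apply/UM/rU; rewrite addrC addKr.
  have [z2 z2n az2] := MP a _ (UM _ Ua) e20.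
  exists (z1 - z2).
    by rewrite (le_trans (ler_normB _ _))// mulr_natl mulr2n lerD.
  rewrite blinB (_ : _ - _ = (a + y - T z1) - (a - T z2)); last by abel.
  by rewrite (le_trans (ler_normB _ _))// (splitr e) lerD// ltW.
exists (2 * n%:R * (2 / r)) => [|w e e0].
  by rewrite !mulr_ge0// ?invr_ge0 ltW.
have [->|w0] := eqVneq w 0.
  by exists 0; rewrite !normr0 mulr0 blin0 subrr normr0 lexx ltW.
have nw : 0 < `|w| by rewrite normr_gt0.
pose l := r / 2 / `|w|; have l0 : 0 < l by rewrite !divr_gt0.
have [||z zn lz] := ball0 (l *: w) (l * e).
- by rewrite normrZ gtr0_norm// divfK ?gt_eqF//; lra.
- exact: mulr_gt0.
exists (l^-1 *: z); split.
  have l1 : 0 <= l^-1 by rewrite invr_ge0 ltW.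
  rewrite normrZ ger0_norm// (le_trans (ler_wpM2l l1 zn))//.
  rewrite le_eqVlt; apply/orP; left; apply/eqP; rewrite /l; field.
  by rewrite !gt_eqF.
rewrite blinZ -(ler_pM2l l0) -[X in X * `|_|]gtr0_norm// -normrZ scalerBr.
by rewrite scalerA mulfV ?gt_eqF// scale1r.
Qed.

(** Successive approximation: each step solves the current error up to half of it, and the
    corrections form a geometrically dominated series, convergent by completeness of [Z]. *)
Lemma open_mapping : exists2 K : R, 0 <= K &
  forall w, exists2 z, T z = w & `|z| <= K * `|w|.
Proof.
have [K K0 KT] := open_mapping_approx.
have /choice[s sE] : forall w, exists z,
    `|z| <= K * `|w| /\ `|w - T z| <= `|w| / 2.
  move=> w; have [->|w0] := eqVneq w 0; last first.
    by apply: KT; rewrite divr_gt0// normr_gt0.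
  by exists 0; rewrite !normr0 mulr0 mul0r blin0 subrr normr0 lexx.
exists (2 * K) => [|w]; first exact: mulr_ge0.
pose ws := fix ws n := if n is n'.+1 then ws n' - T (s (ws n')) else w.
pose zs n := s (ws n).
have wsle n : `|ws n| <= `|w| * 2^-1 ^+ n.
  elim: n => [|n IH]; first by rewrite expr0 mulr1.
  by rewrite (le_trans (sE _).2)// exprSr mulrA ler_wpM2r.
have zsle n : `|zs n| <= geometric (K * `|w|) 2^-1 n.
  by rewrite (le_trans (sE _).1)//= -mulrA ler_wpM2l.
have sumE n : w - T (series zs n) = ws n.
  elim: n => [|n IH]; first by rewrite /series/= big_geq// blin0 subr0.
  by rewrite seriesS blinD [T _ + _]addrC opprD addrA IH.
have sumle n : `|series zs n| <= 2 * K * `|w| * (1 - 2^-1 ^+ n).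
  elim: n => [|n IH]; first by rewrite /series/= big_geq// normr0 subrr mulr0.
  rewrite seriesS (le_trans (ler_normD _ _))// (le_trans (lerD (zsle n) IH))//=.
  rewrite exprSr; move: (2^-1 ^+ n) => q.
  by rewrite le_eqVlt; apply/orP; left; apply/eqP; field.
have g0 n : 0 <= geometric (K * `|w|) 2^-1 n by rewrite /= !mulr_ge0.
have h1 : `|2^-1 : R| < 1 by rewrite gtr0_norm// invf_lt1// ltr1n.
have cz : cvgn (series zs) := normed_cvg (series_le_cvg
  (fun n => normr_ge0 (zs n)) g0 zsle (is_cvg_geometric_series h1)).
exists (lim (series zs @ \oo)).
  apply/eqP; rewrite eq_sym -subr_eq0 -normr_le0; apply/ler_addgt0Pl => e e0.
  rewrite addr0; have e20 : 0 < e / 2 by rewrite divr_gt0.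
  have T1 : 0 < `|T| + 1 by rewrite ltr_wpDl.
  have eT : 0 < e / 2 / (`|T| + 1) by rewrite divr_gt0.
  have /cvgrPdist_le/(_ _ eT)[N _ /(_ _ _)/= zN] := cz.
  have w1 : 0 < `|w| + 1 by rewrite ltr_wpDl.
  have /cvgrPdist_le/(_ (e / 2 / (`|w| + 1)))[|N' _ /= wN] :
      (2^-1 : R) ^+ n @[n --> \oo] --> (0 : R).
    by apply: cvg_expr; rewrite gtr0_norm// invf_lt1// ltr1n.
  - by rewrite divr_gt0.
  pose n := maxn N N'.
  rewrite (_ : w - _ = (w - T (series zs n)) -
      T (lim (series zs @ \oo) - series zs n)); last by rewrite blinB; abel.
  rewrite (le_trans (ler_normB _ _))// (splitr e) sumE lerD//.
    rewrite (le_trans (wsle n))//; have := wN n (leq_maxr _ _).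
    rewrite sub0r normrN ger0_norm ?exprn_ge0// => pn.
    rewrite (le_trans (ler_wpM2l _ pn))// mulrCA ler_piMr ?(ltW e20)//.
    by rewrite ler_pdivrMr// mul1r lerDl.
  rewrite (le_trans (le_blin _ _))//.
  rewrite (le_trans (ler_wpM2l _ (zN _ (leq_maxl _ _))))//.
  by rewrite mulrCA ler_piMr ?(ltW e20)// ler_pdivrMr// mul1r lerDl.
have cn : `|series zs n| @[n --> \oo] --> `|limn (series zs)|.
  exact: cvg_norm cz.
rewrite -(cvg_lim _ cn)//; have cvn : cvg (`|series zs n| @[n --> \oo]) by apply/cvg_ex; eexists; exact: cn.
apply: (limr_le cvn); apply: nearW => n; rewrite (le_trans (sumle n))// ler_piMr ?mulr_ge0//.
Qed.

End open_mapping.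

Section splitting.
Context {R : realType}.

Lemma closed_subspace_sub (E : completeNormedModType R) (F : closed_subspace E)
    a x y : cs_set F x -> cs_set F y -> cs_set F (a *: x + y).
Proof.
move=> Fx Fy; have [_ Fl] := cs_submod F.
by have /= := Fl a x y; rewrite !inE; apply.
Qed.

Lemma closed_subspace0 (E : completeNormedModType R) (F : closed_subspace E) :
  cs_set F 0.
Proof. by have [/=] := cs_submod F; rewrite inE. Qed.

Lemma closed_subspaceZ (E : completeNormedModType R) (F : closed_subspace E)
    a x : cs_set F x -> cs_set F (a *: x).
Proof.
by move=> Fx; rewrite -[_ *: _]addr0; apply: closed_subspace_sub => //;
   exact: closed_subspace0.
Qed.

Lemma closed_subspaceD (E : completeNormedModType R) (F : closed_subspace E)
    x y : cs_set F x -> cs_set F y -> cs_set F (x + y).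
Proof.
by move=> Fx Fy; rewrite -[x]scale1r; exact: closed_subspace_sub.
Qed.

Lemma closed_subspaceB (E : completeNormedModType R) (F : closed_subspace E)
    x y : cs_set F x -> cs_set F y -> cs_set F (x - y).
Proof.
by move=> Fx Fy; rewrite addrC -scaleN1r; exact: closed_subspace_sub.
Qed.

Lemma cs_val_mem (E : completeNormedModType R) (F : closed_subspace E)
    (v : cs_type F) : cs_set F (cs_val v).
Proof. by have := cs_valP v; rewrite !inE. Qed.

Lemma cs_mem_pred (E : completeNormedModType R) (F : closed_subspace E) x :
  cs_set F x -> x \in cs_pred F.
Proof. by move=> Fx; rewrite !inE. Qed.

Lemma cs_valK (E : completeNormedModType R) (F : closed_subspace E)
    (v : cs_type F) : insubd 0 (cs_val v) = v.
Proof. exact: valKd. Qed.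

Lemma cs_insubdK (E : completeNormedModType R) (F : closed_subspace E) x :
  cs_set F x -> cs_val (insubd (0 : cs_type F) x) = x.
Proof. by move=> Fx; apply: insubdK; exact: cs_mem_pred. Qed.

Lemma bval_linear (E : completeNormedModType R) (F : closed_subspace E) :
  linear (@cs_val R E F).
Proof. by []. Qed.

Lemma bval_bound (E : completeNormedModType R) (F : closed_subspace E)
  (v : cs_type F) : `|cs_val v| <= 1 * `|v|.
Proof. by rewrite mul1r. Qed.

Definition bval (E : completeNormedModType R) (F : closed_subspace E) :
    blin (cs_type F) E := mkblin (@bval_linear E F) (@bval_bound E F).

Lemma bvalE (E : completeNormedModType R) (F : closed_subspace E)
  (v : cs_type F) : bval F v = cs_val v.
Proof. by []. Qed.

Lemma closed_embedding_bval (E : completeNormedModType R)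
  (F : closed_subspace E) : closed_embedding (bval F).
Proof.
split=> // z zF; suff Fz : cs_set F z.
  by exists (insubd 0 z); rewrite bvalE cs_insubdK.
apply: (@cs_closed _ _ F) => B /near_normP[d d0 dB].
have [|y yz] := zF (d / 2); first by rewrite divr_gt0.
exists (cs_val y); split; first exact: cs_val_mem.
by apply: dB; rewrite (le_lt_trans yz)//; lra.
Qed.

(* [Q] comes from inverting the bijection [(a, g) |-> a + D g]. *)
Lemma splitting_retraction (E E' : completeNormedModType R) (D : blin E E')
    (F : closed_subspace E') (G : closed_subspace E) :
  (forall w, exists a g, [/\ cs_set F a, cs_set G g & w = a + D g]) ->
  (forall g, cs_set G g -> cs_set F (D g) -> g = 0) ->
  exists Q : blin E' E, [/\ forall w, cs_set G (Q w),
    forall g, cs_set G g -> Q (D g) = g & forall w, cs_set F w <-> Q w = 0].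
Proof.
move=> FG inj.
pose Z := banach_prod (cs_type F) (cs_type G).
pose T0 (z : Z) := cs_val z.1 + D (cs_val z.2).
have lT : linear T0.
  move=> a x y; rewrite /T0 -[(a *: x + y).1]/(a *: x.1 + y.1).
  rewrite -[(a *: x + y).2]/(a *: x.2 + y.2) !bval_linear blin_linear scalerDr.
  by abel.
have bT z : `|T0 z| <= (1 + `|D|) * `|z|.
  rewrite (le_trans (ler_normD _ _))// mulrDl mul1r.
  have z1 : `|z.1| <= `|z| by rewrite [leRHS]prod_normE le_max lexx.
  have z2 : `|z.2| <= `|z| by rewrite [leRHS]prod_normE le_max lexx orbT.
  by rewrite lerD// (le_trans (le_blin _ _))// ler_wpM2l.
pose T := mkblin lT bT.
have Tsurj w : exists z, T z = w.
  have [a [g [Fa Gg ->]]] := FG w.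
  by exists (insubd 0 a, insubd 0 g); rewrite /= /T0/= !cs_insubdK.
have Tinj z z' : T z = T z' -> cs_val z.2 = cs_val z'.2.
  rewrite /= /T0 => zz'; apply/eqP; rewrite -subr_eq0; apply/eqP.
  apply: inj; first by apply: closed_subspaceB; exact: cs_val_mem.
  rewrite blinB (_ : _ - _ = cs_val z'.1 - cs_val z.1).
    by apply: closed_subspaceB; exact: cs_val_mem.
  rewrite (_ : D (cs_val z.2) = cs_val z'.1 + D (cs_val z'.2) - cs_val z.1).
    by abel.
  by rewrite -zz'; abel.
have [K K0 KT] := open_mapping Tsurj.
have /choice[s sE] : forall w, exists z, T z = w /\ `|z| <= K * `|w|.
  by move=> w; have [z ? ?] := KT w; exists z.
(* The preimages chosen by [s] are arbitrary, but [Tinj] makes their second component unique, hence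
   linear in [w]. *)
pose q w := cs_val (s w).2.
have lq : linear q.
  move=> a x y; rewrite /q -bval_linear; apply: (Tinj _ (a *: s x + s y)).
  by rewrite (sE _).1 blin_linear !(sE _).1.
have bq w : `|q w| <= K * `|w|.
  by rewrite (le_trans _ (sE w).2)// [leRHS]prod_normE le_max lexx orbT.
exists (mkblin lq bq); split=> [w|g Gg|w] /=.
- exact: cs_val_mem.
- rewrite /q -[RHS](@cs_insubdK _ G)//.
  apply: (Tinj _ (0, insubd 0 g)); rewrite (sE _).1 /= /T0 /= cs_insubdK//.
  by rewrite add0r.
split=> [Fw|qw].
  rewrite /q (Tinj _ (insubd 0 w, 0))//.
  by rewrite (sE _).1 /= /T0 /= cs_insubdK// blin0 addr0.
rewrite -(sE w).1 /= /T0 -/(q w) qw blin0 addr0; exact: cs_val_mem.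
Qed.

End splitting.

(** * Charts and tangent vectors *)

Section local_smoothness.
Context {R : realType}.

Lemma open_in_preimage (E F : normedModType R) (A N : set E) (A' N' : set F)
    (h : E -> F) : open_in A N -> {within N, continuous h} -> open_in A' N' ->
  (forall x, N x -> A' (h x)) -> open_in A (N `&` h @^-1` N').
Proof.
move=> /open_inP[NA oN] /within_continuousP hc /open_inP[_ oN'] NA'.
apply/open_inP; split=> [x [/NA]//|x [Nx N'hx]].
have [d d0 dN] := oN _ Nx; have [d' d'0 dN'] := oN' _ N'hx.
have [|r r0 rh] := hc _ Nx (d' / 2); first by rewrite divr_gt0.
exists (Num.min d r) => [|y Ay]; first by rewrite lt_min d0.
rewrite lt_min => /andP[yd yr]; have Ny := dN _ Ay yd; split=> //.
by apply: dN'; [exact: NA'|have := rh _ Ny yr; lra].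
Qed.

Context {T T' T'' : pointedType}.

Lemma cinvK (X : set T) (c : @chart R T) x : is_chart X c -> cdom c x ->
  cinv c (cmap c x) = x.
Proof. by case=> _ _ ic _ cx; apply: (pinvKV _ ic); rewrite inE. Qed.

Lemma cmap_inj (X : set T) (c : @chart R T) x y : is_chart X c ->
  cdom c x -> cdom c y -> cmap c x = cmap c y -> x = y.
Proof.
by move=> ic cx cy xy; rewrite -(cinvK ic cx) xy (cinvK ic cy).
Qed.

Lemma cimgP (X : set T) (c : @chart R T) z : is_chart X c -> cimg c z ->
  cdom c (cinv c z) /\ cmap c (cinv c z) = z.
Proof. by move=> ic [x cx <-]; rewrite (cinvK ic cx). Qed.

Lemma cimg_hs (X : set T) (c : @chart R T) z : is_chart X c -> cimg c z ->
  hs_pos (chs c) z.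
Proof. by case=> _ _ _ /open_inS; apply. Qed.

Lemma cimg_cmap (c : @chart R T) x : cdom c x -> cimg c (cmap c x).
Proof. by move=> cx; exists x. Qed.

Lemma rep_domP (X : set T) (f : T -> T') (c : @chart R T) (c' : @chart R T') z :
  is_chart X c ->
  rep_dom f c c' z <-> cimg c z /\ cdom c' (f (cinv c z)).
Proof.
move=> ic; split=> [[x [cx c'x] <-]|[/(cimgP ic)[cz zE] c'z]].
  by rewrite (cinvK ic cx); split=> //; exact: cimg_cmap.
by exists (cinv c z).
Qed.

Lemma rep_dom_cmap (f : T -> T') (c : @chart R T) (c' : @chart R T') x :
  cdom c x -> cdom c' (f x) -> rep_dom f c c' (cmap c x).
Proof. by move=> cx c'x; exists x. Qed.

Lemma rep_cmap (X : set T) (f : T -> T') (c : @chart R T) (c' : @chart R T') x :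
  is_chart X c -> cdom c x -> rep f c c' (cmap c x) = cmap c' (f x).
Proof. by move=> ic cx; rewrite /rep /= (cinvK ic cx). Qed.

(* [f] is read in the charts [c] and [c'] as a C^p map near [x]. *)
Definition lgood p (f : T -> T') (c : @chart R T) (c' : @chart R T') x :=
  exists N, [/\ open_in (hs_pos (chs c)) N, N (cmap c x), N `<=` rep_dom f c c' &
    Cp p N (rep f c c')].

(** Reduces compatibility of charts, a statement on whole domains, to a condition at each point. *)
Lemma lgood_rep_dom p (X : set T) (f : T -> T') (c : @chart R T)
    (c' : @chart R T') :
  is_chart X c -> (forall x, cdom c x -> cdom c' (f x) -> lgood p f c c' x) ->
  open_in (hs_pos (chs c)) (rep_dom f c c') /\ Cp p (rep_dom f c c') (rep f c c').
Proof.
move=> ic fg; have oD : open_in (hs_pos (chs c)) (rep_dom f c c').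
  apply/open_inP; split=> [_ [x [cx _] <-]|_ [x [cx c'x] <-]].
    exact/(cimg_hs ic)/cimg_cmap.
  have [N [/open_inP[_ oN] Nx NE _]] := fg _ cx c'x.
  by have [d d0 dN] := oN _ Nx; exists d => // y hy yx; apply: NE; exact: dN.
split=> //; have [hc _ _ _] := ic; apply: (Cp_local hc oD) => _ [x [cx c'x] <-].
by have [N [oN Nx NE CN]] := fg _ cx c'x; exists N.
Qed.

Lemma lgood_cst_dom p (f : T -> T') (c : @chart R T) (c' : @chart R T') x :
  cdom c x -> cdom c' (f x) -> open_in (hs_pos (chs c)) (rep_dom f c c') ->
  Cp p (rep_dom f c c') (rep f c c') -> lgood p f c c' x.
Proof.
by move=> cx c'x oD CD; exists (rep_dom f c c'); split=> //; exact: rep_dom_cmap.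
Qed.

End local_smoothness.

Section local_smoothness_comp.
Context {R : realType} {T T' T'' : pointedType}.

Lemma lgood_comp p (X : set T) (X' : set T') (f : T -> T') (g : T' -> T'')
    (c : @chart R T) (c' : @chart R T') (c'' : @chart R T'') x :
  is_chart X c -> is_chart X' c' -> cdom c x ->
  lgood p f c c' x -> lgood p g c' c'' (f x) -> lgood p (g \o f) c c'' x.
Proof.
move=> ic ic' cx [N [oN Nx NE CN]] [N' [oN' N'x N'E CN']].
have NN' z : N z -> cdom c' (f (cinv c z)).
  by move=> /NE /(rep_domP _ _ _ ic)[].
exists (N `&` rep f c c' @^-1` N'); split.
- apply: (open_in_preimage oN (Cp_within CN) oN') => z Nz.
  by apply: (cimg_hs ic'); apply: cimg_cmap; exact: NN'.
- by split=> //=; rewrite (rep_cmap _ _ ic).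
- move=> z [Nz /= /N'E /(rep_domP _ _ _ ic')[_]].
  rewrite /rep /= (cinvK ic' (NN' _ Nz)) => c''z.
  by apply/(rep_domP _ _ _ ic); split=> //; have /(rep_domP _ _ _ ic)[] := NE _ Nz.
- apply: (@Cp_ext _ _ _ _ _ (rep g c' c'' \o rep f c c')).
    by move=> z [Nz _]; rewrite /rep /= (cinvK ic' (NN' _ Nz)).
  apply: (Cp_comp _ _ CN'); first by move=> z [].
  by apply: Cp_sub CN => z [].
Qed.

Lemma lgood_refl p (X : set T) (c : @chart R T) x : is_chart X c -> cdom c x ->
  lgood p id c c x.
Proof.
move=> ic cx; exists (cimg c); split.
- by case: ic.
- exact: cimg_cmap.
- by move=> z cz; apply/(rep_domP _ _ _ ic); split=> //; have [] := cimgP ic cz.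
- apply: (@Cp_ext _ _ _ _ _ (bid c)); last exact: Cp_blin.
  by move=> z cz; rewrite /rep /=; have [_ ->] := cimgP ic cz.
Qed.

Definition Dr (f : T -> T') (c : @chart R T) (c' : @chart R T') x : blin c c' :=
  Defs.deriv (rep_dom f c c') (rep f c c') (cmap c x).

Lemma Dr_is_deriv p (X : set T) (f : T -> T') (c : @chart R T)
    (c' : @chart R T') x : smooth_ge1 p -> is_chart X c -> lgood p f c c' x ->
  is_deriv (rep_dom f c c') (rep f c c') (cmap c x) (Dr f c c' x).
Proof.
move=> p1 ic [N [/open_inP[_ oN] Nx NE /(Cp_C1 p1)[dN hdN _]]].
rewrite /Dr /Defs.deriv; case: xgetP => [u _ //|no].
have [d d0 dE] := oN _ Nx; case: (no (dN (cmap c x))) => /=.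
apply: is_deriv_local d0 _ (hdN _ Nx) => y /(rep_domP _ _ _ ic)[cy _] yx.
by apply: dE => //; exact: (cimg_hs ic).
Qed.

Lemma Dr_eq p (X : set T) (f : T -> T') (c : @chart R T)
    (c' : @chart R T') x N u : smooth_ge1 p -> is_chart X c -> lgood p f c c' x ->
  open_in (hs_pos (chs c)) N -> N (cmap c x) ->
  is_deriv N (rep f c c') (cmap c x) u -> Dr f c c' x = u.
Proof.
move=> p1 ic fg oN Nx hu; have hD := Dr_is_deriv p1 ic fg.
have [N' [oN' N'x N'E _]] := fg; have [hc _ _ _] := ic.
apply: (is_deriv_unique (h := rep f c c') (x := cmap c x) hc (open_inI oN oN')).
- by split.
- by apply: is_deriv_sub hD => y [_ /N'E].
- by apply: is_deriv_sub hu => y [].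
Qed.

End local_smoothness_comp.

Section Dr_comp.
Context {R : realType} {T T' T'' : pointedType}.

Lemma Dr_refl p (X : set T) (c : @chart R T) x : smooth_ge1 p ->
  is_chart X c -> cdom c x -> Dr id c c x = bid c.
Proof.
move=> p1 ic cx; have [_ _ _ oc] := ic.
apply: (Dr_eq p1 ic (lgood_refl p ic cx) oc); first exact: cimg_cmap.
apply: (@is_deriv_ext _ _ _ _ (bid c)); first exact: cimg_cmap.
  by move=> z cz; rewrite /rep /=; have [_ ->] := cimgP ic cz.
exact: is_deriv_blin.
Qed.

Lemma Dr_comp p (X : set T) (X' : set T') (f : T -> T') (g : T' -> T'')
    (c : @chart R T) (c' : @chart R T') (c'' : @chart R T'') x :
  smooth_ge1 p -> is_chart X c -> is_chart X' c' -> cdom c x ->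
  lgood p f c c' x -> lgood p g c' c'' (f x) ->
  Dr (g \o f) c c'' x = bcomp (Dr g c' c'' (f x)) (Dr f c c' x).
Proof.
move=> p1 ic ic' cx fg gg; have fgg := lgood_comp ic ic' cx fg gg.
have hf := Dr_is_deriv p1 ic fg; have hg := Dr_is_deriv p1 ic' gg.
have [N [oN Nx NE _]] := fg; have [M [oM Mx ME _]] := fgg.
apply: (Dr_eq p1 ic fgg (open_inI oN oM)); first by split.
have NM z : N z -> M z -> cdom c' (f (cinv c z)) /\ cdom c'' (g (f (cinv c z))).
  move=> /NE /(rep_domP _ _ _ ic)[_ ?] /ME /(rep_domP _ _ _ ic)[_ ?].
  by split.
apply: (@is_deriv_ext _ _ _ _ (rep g c' c'' \o rep f c c')); first by split.
  by move=> z [Nz Mz]; rewrite /rep /= (cinvK ic' (NM _ Nz Mz).1).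
apply: (@is_deriv_comp _ _ _ _ _ (rep_dom g c' c'')).
- move=> z [Nz Mz]; have [c'z c''z] := NM _ Nz Mz.
  by apply/(rep_domP _ _ _ ic'); rewrite /rep /= (cinvK ic' c'z); split=> //;
     exact: cimg_cmap.
- by apply: is_deriv_sub hf => z [/NE].
- by rewrite (rep_cmap _ _ ic cx).
Qed.

End Dr_comp.

(** * Atlases and smooth maps *)

Section atlases.
Context {R : realType}.

(* The part of [is_manifold] that does not involve maximality. *)
Definition wmfd p (T : pointedType) (X : @mfd R T) :=
  [/\ forall c, atlas X c -> is_chart X c,
      forall c c', atlas X c -> atlas X c' -> compatible p c c' &
      forall x, mset X x -> exists c, chart_at X x c].

Lemma manifold_wmfd p (T : pointedType) (X : @mfd R T) :
  is_manifold p X -> wmfd p X.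
Proof.
move=> [cov max]; split=> [c /max[]//|c c' /max[_ cc] /cc//|x /cov[c Xc cx]].
by exists c.
Qed.

Lemma chart_at_is_chart p (T : pointedType) (X : @mfd R T) x c :
  wmfd p X -> chart_at X x c -> is_chart X c.
Proof. by case=> ic _ _ [/ic]. Qed.

Lemma lgood_id p (T : pointedType) (X : @mfd R T) x c c' : wmfd p X ->
  chart_at X x c -> chart_at X x c' -> lgood p id c c' x.
Proof.
move=> [_ cc _] [Xc cx] [Xc' c'x]; have [oD _ CD _] := cc _ _ Xc Xc'.
exact: lgood_cst_dom.
Qed.

Lemma compatible_lgood p (T : pointedType) (X : set T) (c c' : @chart R T) :
  is_chart X c -> is_chart X c' ->
  (forall x, cdom c x -> cdom c' x -> lgood p id c c' x) ->
  (forall x, cdom c' x -> cdom c x -> lgood p id c' c x) ->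
  compatible p c c'.
Proof.
move=> ic ic' cc' c'c; have [? ?] := lgood_rep_dom ic cc'.
by have [? ?] := lgood_rep_dom ic' c'c; split.
Qed.

Lemma compatible_sym p (T : pointedType) (c c' : @chart R T) :
  compatible p c c' -> compatible p c' c.
Proof. by case=> ? ? ? ?; split. Qed.

Lemma lgood_compatible p (T : pointedType) (c c' : @chart R T) x :
  compatible p c c' -> cdom c x -> cdom c' x -> lgood p id c c' x.
Proof. by case=> ? _ ? _ cx c'x; exact: lgood_cst_dom. Qed.

(** Two charts compatible with the generating family are compatible with each other, since near each
    point their change factors through a generating chart; so the generated atlas is maximal. *)
Lemma generated_manifold p (T : pointedType) (Y : set T)
    (G : @chart R T -> Prop) :
  (forall c, G c -> is_chart Y c) ->
  (forall c c', G c -> G c' -> compatible p c c') ->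
  (forall x, Y x -> exists c, G c /\ cdom c x) ->
  is_manifold p (Mfd Y (max_atlas p Y G)) /\ (forall c, G c -> max_atlas p Y G c).
Proof.
move=> ic cc cov; have GA c : G c -> max_atlas p Y G c.
  by move=> Gc; split=> [|c' Gc']; [exact: ic|exact: cc].
have lg c c' x : max_atlas p Y G c -> max_atlas p Y G c' -> cdom c x ->
    cdom c' x -> lgood p id c c' x.
  move=> [icc Ac] [icc' Ac'] cx c'x.
  have [g [Gg gx]] : exists c, G c /\ cdom c x by apply: cov; case: icc => _ + _ _; apply.
  have g1 := lgood_compatible (Ac _ Gg) cx gx.
  have g2 := lgood_compatible (compatible_sym (Ac' _ Gg)) gx c'x.
  exact: (lgood_comp (f := id) (g := id) icc (ic _ Gg) cx g1 g2).
split=> //; split=> [x /cov[c [Gc cx]]|c] /=; first by exists c => //; exact: GA.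
split=> [Ac|[ic0 Ac]]; last by split=> // c' /GA/Ac.
split; first by case: Ac.
move=> c' Ac'; have [icc _] := Ac; have [icc' _] := Ac'.
by apply: (compatible_lgood icc icc') => x ? ?; exact: lg.
Qed.

(** Unlike [Cp_map], this concerns all pairs of charts at a point, so that derivatives may be
    computed in any of them. *)
Definition smap p (T T' : pointedType) (X : @mfd R T) (X' : @mfd R T')
    (f : T -> T') :=
  (forall x, mset X x -> mset X' (f x)) /\
  forall c c' x, chart_at X x c -> chart_at X' (f x) c' -> lgood p f c c' x.

Lemma smap_local p (T T' : pointedType) (X : @mfd R T) (X' : @mfd R T')
    (f : T -> T') : wmfd p X -> wmfd p X' ->
  (forall x, mset X x -> mset X' (f x)) ->
  (forall x, mset X x -> exists c c',
    [/\ chart_at X x c, chart_at X' (f x) c' & lgood p f c c' x]) ->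
  smap p X X' f.
Proof.
move=> wX wX' ff fl; split=> // c c' x cx c'x.
have ic := chart_at_is_chart wX cx.
have Xx : mset X x by case: ic => _ + _ _; apply; case: cx.
have [c1 [c1' [c1x c1'x fg]]] := fl _ Xx.
have ic1 := chart_at_is_chart wX c1x; have ic1' := chart_at_is_chart wX' c1'x.
have [_ cx'] := cx; have [_ c1x'] := c1x.
have g1 : lgood p (f \o id) c c1' x.
  exact: (lgood_comp ic ic1 cx' (lgood_id wX cx c1x) fg).
exact: (lgood_comp (g := id) ic ic1' cx' g1 (lgood_id wX' c1'x c'x)).
Qed.

Lemma smap_comp p (T T' T'' : pointedType) (X : @mfd R T) (X' : @mfd R T')
    (X'' : @mfd R T'') (f : T -> T') (g : T' -> T'') :
  wmfd p X -> wmfd p X' -> smap p X X' f -> smap p X' X'' g ->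
  smap p X X'' (g \o f).
Proof.
move=> wX wX' [ff fg] [gg ggo]; split=> [x Xx|c c'' x cx c''x].
  exact/gg/ff.
have ic := chart_at_is_chart wX cx.
have Xx : mset X x by case: ic => _ + _ _; apply; case: cx.
have [_ _ /(_ _ (ff _ Xx))[c' c'x]] := wX'.
apply: (@lgood_comp _ _ _ _ _ _ _ f g c c' c'' x ic (chart_at_is_chart wX' c'x)).
- by case: cx.
- exact: fg.
- exact: ggo.
Qed.

Lemma Cp_map_smap p (T T' : pointedType) (X : @mfd R T) (X' : @mfd R T')
    (f : T -> T') : wmfd p X -> wmfd p X' -> Cp_map p X X' f -> smap p X X' f.
Proof.
move=> wX wX' [fX fl]; apply: smap_local => // [x Xx|x Xx].
  by apply: fX; exists x.
have [c [c' [cx c'x cc' Cf]]] := fl _ Xx; exists c, c'; split=> //.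
have ic := chart_at_is_chart wX cx; have [_ cx'] := cx.
exists (cimg c); split=> //; first by case: ic.
- exact: cimg_cmap.
- move=> z cz; apply/(rep_domP _ _ _ ic); split=> //; apply: cc'.
  by exists (cinv c z) => //; have [] := cimgP ic cz.
Qed.

End atlases.

(** * Tangent vectors and differentials in charts *)

Section tangent_vectors.
Context {R : realType} (p : smoothness) (p1 : smooth_ge1 p).

Lemma tangentE (T : pointedType) (X : @mfd R T) x (v : tvec T) c c' :
  tangent X x v -> chart_at X x c -> chart_at X x c' ->
  v c' = Dr id c c' x (v c).
Proof. by move=> [_ vE] cx c'x; exact: vE. Qed.

Lemma tangent_inj (T : pointedType) (X : @mfd R T) x (v w : tvec T) c :
  tangent X x v -> tangent X x w -> chart_at X x c -> v c = w c -> v = w.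
Proof.
move=> tv tw cx vw; apply/functional_extensionality_dep => c'.
have [c'x|nc'x] := pselect (chart_at X x c').
  by rewrite (tangentE tv cx c'x) (tangentE tw cx c'x) vw.
by case: tv tw => [tv _] [tw _]; rewrite tv// tw.
Qed.

Lemma Dr_id_comp (T : pointedType) (X : @mfd R T) x c c' c'' : wmfd p X ->
  chart_at X x c -> chart_at X x c' -> chart_at X x c'' ->
  Dr id c c'' x = bcomp (Dr id c' c'' x) (Dr id c c' x).
Proof.
move=> wX cx c'x c''x; have [_ cx'] := cx.
have := Dr_comp p1 (chart_at_is_chart wX cx) (chart_at_is_chart wX c'x) cx'
  (lgood_id wX cx c'x) (lgood_id wX c'x c''x).
by [].
Qed.

(** The other components are forced by the derivatives of the chart changes, and the cocycle rule
    [Dr_id_comp] makes them consistent. *)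
Lemma tangent_exists (T : pointedType) (X : @mfd R T) x (c : @chart R T)
    (u : c) : wmfd p X ->
  chart_at X x c -> exists2 v, tangent X x v & v c = u.
Proof.
move=> wX cx; pose v : tvec T := fun c' =>
  if pselect (chart_at X x c') is left _ then Dr id c c' x u else 0.
have vE c' : chart_at X x c' -> v c' = Dr id c c' x u.
  by rewrite /v; case: pselect.
have [_ cx'] := cx.
exists v; last by rewrite vE// (Dr_refl p1 (chart_at_is_chart wX cx) cx').
split=> [c'|c' c'' c'x c''x]; first by rewrite /v; case: pselect.
by rewrite !vE// (Dr_id_comp wX cx c'x c''x).
Qed.

Section differential.
Context {T T' : pointedType} {X : @mfd R T} {X' : @mfd R T'} {f : T -> T'}.
Hypotheses (wX : wmfd p X) (wX' : wmfd p X') (sf : smap p X X' f).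

Lemma Dr_change x c c1 c' c1' : chart_at X x c -> chart_at X x c1 ->
  chart_at X' (f x) c' -> chart_at X' (f x) c1' ->
  Dr f c1 c1' x =
    bcomp (Dr id c' c1' (f x)) (bcomp (Dr f c c' x) (Dr id c1 c x)).
Proof.
move=> cx c1x c'x c1'x; have [_ fg] := sf; have [_ c1x'] := c1x.
have ic := chart_at_is_chart wX cx; have ic1 := chart_at_is_chart wX c1x.
have ic' := chart_at_is_chart wX' c'x.
have g1 := lgood_id wX c1x cx; have g2 := fg _ _ _ cx c'x.
rewrite -(Dr_comp (f := id) (g := f) p1 ic1 ic c1x' g1 g2).
have g3 := lgood_comp (f := id) (g := f) ic1 ic c1x' g1 g2.
exact: (Dr_comp (f := f \o id) (g := id) p1 ic1 ic' c1x' g3 (lgood_id wX' c'x c1'x)).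
Qed.

Lemma dmapE x v c c' : tangent X x v -> chart_at X x c -> chart_at X' (f x) c' ->
  dmap X X' f x v c' = Dr f c c' x (v c).
Proof.
move=> tv cx c'x; apply: xget_unique => [|_ [_ [c1 c1x ->]]].
  by split=> //; exists c.
have [_ cx'] := cx; rewrite -[LHS]/(Dr f c1 c' x (v c1)).
rewrite (tangentE tv cx c1x) (Dr_change c1x cx c'x c'x) /=.
by have [_ c'x'] := c'x; rewrite (Dr_refl p1 (chart_at_is_chart wX' c'x) c'x').
Qed.

Lemma dmap_tangent x v c : chart_at X x c -> tangent X x v ->
  tangent X' (f x) (dmap X X' f x v).
Proof.
move=> cx tv; split=> [c' nc'|c' c'' c'x c''x].
  by rewrite /dmap; case: xgetP => // w _ [].
rewrite -[RHS]/(Dr id c' c'' (f x) _) (dmapE tv cx c'x) (dmapE tv cx c''x).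
rewrite (Dr_change cx cx c'x c''x) /=; have [_ cx'] := cx.
by rewrite (Dr_refl p1 (chart_at_is_chart wX cx) cx').
Qed.

End differential.

End tangent_vectors.

(** * Submanifolds and boundaries *)

Section restricted_charts.
Context {R : realType}.

Definition cut_hs (E : completeNormedModType R) (F : closed_subspace E)
  (mu : cs_type F -> R) : set E := @cs_val _ _ F @` hs_pos mu.

(* [adapted] without centering and complement: this also covers the charts of  *)
(* the boundary.                                                               *)
Definition wadapted (T : pointedType) (X : @mfd R T) (Y : set T)
    (c : @chart R T) (F : closed_subspace c) (mu : cs_type F -> R) :=
  [/\ atlas X c, halfspace_fun mu,
      cmap c @` (cdom c `&` Y) = cimg c `&` cut_hs mu &
      open_in (cut_hs mu) (cmap c @` (cdom c `&` Y))].

Lemma adapted_wadapted (T : pointedType) (X : @mfd R T) (Y : set T) y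
    (c : @chart R T) (F : closed_subspace c) (mu : cs_type F -> R) :
  adapted X Y y mu -> wadapted X Y mu.
Proof. by case=> ? _ _ ? [? ?]. Qed.

Section one_chart.
Context (T : pointedType) (X : @mfd R T) (Y : set T) (c : @chart R T)
  (F : closed_subspace c) (mu : cs_type F -> R).
Hypotheses (ic : is_chart X c) (YX : Y `<=` X) (wa : wadapted X Y mu).

Let r := restr_chart mu Y.

Lemma wadapted_cut x : cdom c x -> Y x -> cut_hs mu (cmap c x).
Proof.
move=> cx Yx; have [_ _ e _] := wa.
by have [] : (cimg c `&` cut_hs mu) (cmap c x) by rewrite -e; exists x.
Qed.

Lemma restr_cmapE x : cdom c x -> Y x -> cs_val (cmap r x) = cmap c x.
Proof.
move=> cx Yx; apply: cs_insubdK; have [v _ <-] := wadapted_cut cx Yx.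
exact: cs_val_mem.
Qed.

Lemma restr_cimgP v :
  cimg r v <-> (cmap c @` (cdom c `&` Y)) (cs_val v).
Proof.
split=> [[x [cx Yx] <-]|[x [cx Yx] xv]].
  by rewrite restr_cmapE//; exists x.
by exists x => //; rewrite /= xv; exact: cs_valK.
Qed.

Lemma restr_is_chart : is_chart Y r.
Proof.
have [_ hmu e oY] := wa; split=> //.
- by move=> x [].
- move=> x y; rewrite !inE => -[cx Yx] [cy Yy] xy.
  apply: (cmap_inj ic cx cy).
  by rewrite -(restr_cmapE cx Yx) -(restr_cmapE cy Yy) xy.
- apply/open_inP; split=> [v /restr_cimgP|v /restr_cimgP cv].
    by rewrite e => -[_ [w mw /val_inj <-]].
  case/open_inP: oY => _ /(_ _ cv)[d d0 dE]; exists d => // w mw wv.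
  by apply/restr_cimgP; apply: dE => //; exists w.
Qed.

Lemma restr_rep v : cimg r v -> rep id r c v = cs_val v.
Proof.
move=> rv; have [[cx Yx] {2}<-] := cimgP restr_is_chart rv.
by rewrite restr_cmapE.
Qed.

Lemma restr_lgood p x : cdom c x -> Y x -> lgood p id r c x.
Proof.
move=> cx Yx; have ir := restr_is_chart; exists (cimg r); split.
- by case: ir.
- by apply: cimg_cmap.
- move=> v rv; apply/(rep_domP _ _ _ ir); split=> //.
  by have [[]] := cimgP ir rv.
- apply: (@Cp_ext _ _ _ _ _ (bval F)); last exact: Cp_blin.
  by move=> v rv; rewrite restr_rep.
Qed.

Lemma restr_Dr p x : smooth_ge1 p -> cdom c x -> Y x -> Dr id r c x = bval F.
Proof.
move=> p1 cx Yx; have ir := restr_is_chart.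
have cr : cimg r (cmap r x) by apply: cimg_cmap.
apply: (Dr_eq p1 ir (restr_lgood p cx Yx) (N := cimg r)) => //.
  by case: ir.
apply: (@is_deriv_ext _ _ _ _ (bval F)) => //; last exact: is_deriv_blin.
by move=> v rv; rewrite restr_rep.
Qed.

(** Smoothness into [X] of a map with values in [Y] lifts to the model space of [Y], by [Cp_lift]
    for the inclusion of [F]. *)
Lemma lgood_restr p (T0 : pointedType) (X0 : set T0) (f : T0 -> T)
    (c0 : @chart R T0) x : is_chart X0 c0 -> (forall y, X0 y -> Y (f y)) ->
  lgood p f c0 c x -> lgood p f c0 r x.
Proof.
move=> ic0 fY [N [oN Nx NE CN]].
have NP z : N z -> [/\ cimg c0 z, cdom c (f (cinv c0 z)) & Y (f (cinv c0 z))].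
  move=> /NE /(rep_domP _ _ _ ic0)[cz fz]; split=> //; apply: fY.
  by have [cz0 _] := cimgP ic0 cz; case: ic0 => _ + _ _; apply.
exists N; split=> //.
  by move=> z /NP[cz fz Yz]; apply/(rep_domP _ _ _ ic0).
have [h0 _ _ _] := ic0; apply: (Cp_lift h0 oN (closed_embedding_bval F)).
apply: Cp_ext CN => z /NP[cz fz Yz].
by rewrite /= -[RHS]/(cs_val (cmap r (f (cinv c0 z)))) restr_cmapE.
Qed.

End one_chart.

Section restricted_atlas.
Context (p : smoothness) (T : pointedType) (X : @mfd R T) (Y : set T)
  (G : @chart R T -> Prop).
Hypotheses (wX : wmfd p X) (YX : Y `<=` X).
Hypothesis Gw : forall c', G c' -> exists (c : @chart R T)
  (F : closed_subspace c) (mu : cs_type F -> R),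
    wadapted X Y mu /\ c' = restr_chart mu Y.
Hypothesis Gcov : forall x, Y x -> exists c, G c /\ cdom c x.

Let M := Mfd Y (max_atlas p Y G).

(** Serves submanifolds and boundaries alike: a change of restricted charts is an inclusion followed
    by a chart change of [X], lifted back by [lgood_restr]. *)
Lemma restricted_manifold :
  is_manifold p M /\ (forall c, G c -> max_atlas p Y G c).
Proof.
have [ic _ _] := wX; apply: generated_manifold => //.
  move=> _ /Gw[c [F [mu [wa ->]]]]; apply: restr_is_chart (wa).
  by have [? _ _ _] := wa; exact: ic.
move=> _ _ /Gw[c1 [F1 [mu1 [wa1 ->]]]] /Gw[c2 [F2 [mu2 [wa2 ->]]]].
have [A1 _ _ _] := wa1; have [A2 _ _ _] := wa2.
have i1 := ic _ A1; have i2 := ic _ A2.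
have ir1 := restr_is_chart i1 wa1; have ir2 := restr_is_chart i2 wa2.
apply: (compatible_lgood ir1 ir2) => x [c1x Yx] [c2x _].
  apply: (lgood_restr wa2 ir1) => //.
  exact: (lgood_comp (f := id) (g := id) ir1 i1 (conj c1x Yx)
    (restr_lgood i1 wa1 p c1x Yx) (lgood_id wX (conj A1 c1x) (conj A2 c2x))).
apply: (lgood_restr wa1 ir2) => //.
exact: (lgood_comp (f := id) (g := id) ir2 i2 (conj c1x Yx)
  (restr_lgood i2 wa2 p c1x Yx) (lgood_id wX (conj A2 c1x) (conj A1 c2x))).
Qed.

Lemma restricted_wmfd : wmfd p M.
Proof. exact: (manifold_wmfd restricted_manifold.1). Qed.

Lemma restricted_smap : smap p M X id.
Proof.
apply: (smap_local restricted_wmfd wX) => [x /YX//|x Yx].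
have [c' [Gc c'x]] := Gcov Yx; have [c [F [mu [wa cE]]]] := Gw Gc.
rewrite cE in Gc c'x; have [cx _] := c'x.
have [A _ _ _] := wa; have [ic _ _] := wX.
exists (restr_chart mu Y), c; split=> //.
- split; last by split.
  exact: restricted_manifold.2.
- exact: (restr_lgood (ic _ A) wa).
Qed.

(** In the restricted chart the differential of the inclusion of [Y] is the inclusion of [F]. *)
Lemma restricted_tangent (c : @chart R T) (F : closed_subspace c)
    (mu : cs_type F -> R) y w : smooth_ge1 p ->
  wadapted X Y mu -> G (restr_chart mu Y) -> cdom c y -> Y y ->
  drange M X id y w <-> tangent X y w /\ cs_set F (w c).
Proof.
move=> p1 wa Gr cy Yy; have [A _ _ _] := wa; have [ic _ _] := wX.
have ry : chart_at M y (restr_chart mu Y).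
  by split; [exact: restricted_manifold.2|split].
have yc : chart_at X y c by split.
have dE v : tangent M y v -> dmap M X id y v c = cs_val (v (restr_chart mu Y)).
  move=> tv; rewrite (dmapE p1 restricted_wmfd wX restricted_smap tv ry yc).
  by rewrite (restr_Dr (ic _ A) wa p1 cy Yy).
split=> [[v tv <-]|[tw Fw]].
  split; first exact: (dmap_tangent p1 restricted_wmfd wX restricted_smap ry tv).
  by rewrite dE//; exact: cs_val_mem.
have [v tv ve] := tangent_exists p1 (insubd (0 : cs_type F) (w c) : restr_chart mu Y)
  restricted_wmfd ry.
exists v => //; apply: (tangent_inj (X := X) (x := y) (c := c)) => //.
  exact: (dmap_tangent p1 restricted_wmfd wX restricted_smap ry tv).
by rewrite dE// ve cs_insubdK.
Qed.

End restricted_atlas.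

End restricted_charts.

(** * Invariance of the boundary *)

Section boundary_invariance.
Context {R : realType}.

Lemma interior_ray (E : normedModType R) (alpha : E -> R) (A : set E) x v :
  halfspace_fun alpha -> open_in (hs_pos alpha) A -> A x -> alpha x != 0 ->
  is_ray A x v.
Proof.
move=> ha /open_inP[AE oA] Ax ax0; have [d d0 dA] := oA _ Ax.
have ax : 0 < alpha x by rewrite lt_def ax0; exact: (AE _ Ax).
have /cvgrPdist_lt/(_ _ ax)/near_normP[d' d'0 dE] := halfspace_continuous ha (x := x).
exists (Num.min d d' / (`|v| + 1)).
  by rewrite divr_gt0 ?ltr_wpDl// lt_min d0.
move=> t t0; rewrite ltr_pdivlMr ?ltr_wpDl// lt_min => /andP[td td'].
have tv : `|x + t *: v - x| <= t * (`|v| + 1).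
  by rewrite addrC addKr normrZ gtr0_norm// ler_wpM2l ?lerDl// ltW.
apply: dA; last exact: le_lt_trans td.
have := dE _ (le_lt_trans tv td'); rewrite /hs_pos/= => axt.
have := ler_norm (alpha x - alpha (x + t *: v)); lra.
Qed.

Context (p : smoothness) (p1 : smooth_ge1 p) (T : pointedType) (X : @mfd R T)
  (wX : wmfd p X).

(* In a chart where the point is interior, the boundary functional of another  *)
(* chart would have a local minimum, hence a vanishing derivative, but the     *)
(* derivative of a chart change is onto.                                       *)
Lemma chart_boundary x c c' : chart_at X x c -> chart_at X x c' ->
  chs c (cmap c x) = 0 -> chs c' (cmap c' x) = 0.
Proof.
move=> cx c'x ax; apply/eqP/negPn/negP => ax'.
have ic := chart_at_is_chart wX cx; have ic' := chart_at_is_chart wX c'x.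
have [ha _ _ _] := ic; have [ha' _ _ _] := ic'.
have [la ca [z0 az0]] : [/\ scalar (chs c), continuous (chs c) &
    exists x, chs c x != 0].
  by case: ha => // h; move: ax; rewrite h /= => /eqP; rewrite oner_eq0.
have lg := lgood_id wX c'x cx.
have hD := Dr_is_deriv p1 ic' lg; have [N [oN Nx NE _]] := lg.
pose D := Dr id c' c x; have [[_ cx'] [_ c'x']] := (cx, c'x).
have Dge0 v : 0 <= chs c (D v).
  rewrite leNgt; apply/negP => Dv.
  have rv := interior_ray v ha' oN Nx ax'.
  have hN : is_deriv N (rep id c' c) (cmap c' x) D.
    exact: is_deriv_sub NE hD.
  have nv : 0 < - chs c (D v) by rewrite oppr_gt0.
  have /cvgrPdist_lt/(_ _ nv)/near_normP[e e0 eE] := ca (D v).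
  have e20 : 0 < e / 2 by rewrite divr_gt0.
  have [d d0 dE] := is_deriv_ray hN rv e20.
  have d20 : 0 < d / 2 by rewrite divr_gt0.
  have [|Nt ht] := dE _ d20; first lra.
  move: ht; rewrite (rep_cmap _ _ ic' c'x'); set q := (d / 2)^-1 *: _ => qD.
  (* The functional vanishes at the base point and is nonnegative on the image of the chart, hence
     on the difference quotient [q] approximating [D v]. *)
  have aq : 0 <= chs c q.
    rewrite /q scalar_funZ// scalar_funB// ax subr0 mulr_ge0 ?invr_ge0 ?(ltW d20)//.
    have /(rep_domP _ _ _ ic')[_ cz] := NE _ Nt.
    by apply: (cimg_hs ic); exact: cimg_cmap.
  have qe : `|q - D v| < e by rewrite (le_lt_trans qD)//; lra.
  have := eE _ qe; rewrite distrC.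
  by have := ler_norm (chs c q - chs c (D v)); lra.
have D0 v : chs c (D v) = 0.
  apply/eqP; rewrite eq_le Dge0 andbT -oppr_ge0 -mulN1r -scalar_funZ// scaleN1r.
  by rewrite -blinN.
move: az0; have := Dr_id_comp p1 wX cx c'x cx.
rewrite (Dr_refl p1 ic cx') => /(congr1 (fun u : blin _ _ => u z0)).
by rewrite bidE => ->; rewrite bcompE D0 eqxx.
Qed.

Lemma boundaryP x c : chart_at X x c -> boundary X x <-> chs c (cmap c x) = 0.
Proof.
move=> cx; split=> [[_ [c' [Xc' c'x ax]]]|ax].
  exact: (chart_boundary (conj Xc' c'x) cx ax).
have [Xc cx'] := cx; split; last by exists c.
by have [ic _ _] := wX; have [_ + _ _] := ic _ Xc; apply.
Qed.

End boundary_invariance.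

(** * New charts of a maximal atlas *)

Section chart_constructions.
Context {R : realType} (p : smoothness) {T : pointedType}.

(** Near each point the changes between the new chart and any other factor through [c], where [psi]
    and [chi] describe them; maximality then puts the new chart into the atlas. *)
Lemma chart_change (X : @mfd R T) (c : @chart R T) (E : completeNormedModType R)
    (beta : E -> R) (A : set c) (B : set E) (psi : c -> E) (chi : E -> c) :
  is_manifold p X -> atlas X c -> halfspace_fun beta ->
  open_in (hs_pos (chs c)) A -> A `<=` cimg c -> open_in (hs_pos beta) B ->
  (forall x, A x -> B (psi x) /\ chi (psi x) = x) ->
  (forall y, B y -> A (chi y) /\ psi (chi y) = y) ->
  Cp p A psi -> Cp p B chi ->
  atlas X (@Chart R T E beta (cdom c `&` cmap c @^-1` A) (psi \o cmap c)).
Proof.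
move=> mX Xc hb oA Ac oB AB BA Cpsi Cchi.
have wX := manifold_wmfd mX; have [icX ccX _] := wX; have ic := icX _ Xc.
set c2 := Chart _ _ _; have [_ cX _ _] := ic.
have im : cimg c2 = B.
  apply/seteqP; split=> [_ [x [cx Ax] <-]|y By]; first by have [] := AB _ Ax.
  have [Ay yE] := BA _ By; have [cz zE] := cimgP ic (Ac _ Ay).
  by exists (cinv c (chi y)); rewrite /= ?zE.
have ic2 : is_chart X c2.
  split=> //=; last by rewrite im.
    by move=> x [/cX].
  move=> x y; rewrite !inE => -[cx Ax] [cy Ay] /= xy.
  apply: (cmap_inj ic cx cy).
  by rewrite -(AB _ Ax).2 xy (AB _ Ay).2.
have inv2 y : B y -> cinv c2 y = cinv c (chi y).
  move=> By; have [Ay yE] := BA _ By; have [cz zE] := cimgP ic (Ac _ Ay).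
  have cy : cimg c2 y by rewrite im.
  have [c2y c2yE] := cimgP ic2 cy.
  apply: (cmap_inj ic2 c2y); last by rewrite c2yE /= zE.
  by split=> //; rewrite /= zE.
have g21 x : cdom c2 x -> lgood p id c2 c x.
  move=> c2x; exists B; split=> //.
  - by rewrite -im; exact: cimg_cmap.
  - move=> y By; apply/(rep_domP _ _ _ ic2); rewrite im; split=> //.
    by rewrite (inv2 _ By); have [Ay _] := BA _ By; have [] := cimgP ic (Ac _ Ay).
  - apply: Cp_ext Cchi => y By; have [Ay yE] := BA _ By.
    by rewrite /rep /= (inv2 _ By); have [_ ->] := cimgP ic (Ac _ Ay).
have g12 x : cdom c2 x -> lgood p id c c2 x.
  move=> [cx Ax]; exists A; split=> //.
  - move=> z Az; apply/(rep_domP _ _ _ ic); have [cz zE] := cimgP ic (Ac _ Az).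
    by split; [exact: Ac|split=> //=; rewrite zE].
  - apply: Cp_ext Cpsi => z Az; have [cz zE] := cimgP ic (Ac _ Az).
    by rewrite /rep /= zE.
have [_ max] := mX; apply/max; split=> // c' Xc'; have ic' := icX _ Xc'.
apply: (compatible_lgood ic2 ic') => x.
  move=> c2x c'x; have [cx _] := c2x.
  exact: (lgood_comp (f := id) (g := id) ic2 ic c2x (g21 _ c2x)
    (lgood_id wX (conj Xc cx) (conj Xc' c'x))).
move=> c'x c2x; have [cx _] := c2x.
exact: (lgood_comp (f := id) (g := id) ic' ic c'x
  (lgood_id wX (conj Xc' c'x) (conj Xc cx)) (g12 _ c2x)).
Qed.

(* At a point off the boundary the half space is replaced by the whole space. *)
Lemma recenter (X : @mfd R T) x c : is_manifold p X -> chart_at X x c ->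
  exists (beta : c -> R) (D : set T),
    let c2 := @Chart R T c beta D (fun y => cmap c y - cmap c x) in
    [/\ atlas X c2, D x, D `<=` cdom c & halfspace_fun beta /\
      (beta = chs c /\ chs c (cmap c x) = 0 \/ beta = cst 1)].
Proof.
move=> mX [Xc cx]; have wX := manifold_wmfd mX; have [icX _ _] := wX.
have ic := icX _ Xc; have [hc _ _ oc] := ic.
have Ctr (A : set c) z : Cp p A (fun y => y + z).
  by apply: Cp_add; [exact: (Cp_blin p A (bid c))|exact: Cp_cst].
have [ax|ax] := eqVneq (chs c (cmap c x)) 0.
  have [la ca nz] : [/\ scalar (chs c), continuous (chs c) &
      exists x, chs c x != 0].
    by case: hc => // h; move: ax; rewrite h /= => /eqP; rewrite oner_eq0.
  exists (chs c), (cdom c `&` cmap c @^-1` cimg c); split.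
  - apply: (@chart_change X c (cmod c) (chs c) (cimg c) [set y | cimg c (y + cmap c x)]
      (fun y => y - cmap c x) (fun y => y + cmap c x)) => //.
    + case/open_inP: (oc) => chs_ oc'; apply/open_inP; split=> [y /= /chs_|y /= cy].
        by rewrite /hs_pos/= scalar_funD// ax addr0.
      have [d d0 dE] := oc' _ cy; exists d => // z hz zy; apply: dE.
        by rewrite /hs_pos/= scalar_funD// ax addr0.
      by rewrite opprD addrACA subrr addr0.
    + by move=> y cy /=; rewrite subrK.
    + by move=> y /= cy; rewrite addrK.
  - by split=> //; exact: cimg_cmap.
  - by move=> y [].
  - by split=> //; left.
have ax0 : 0 < chs c (cmap c x).
  by rewrite lt_def ax; apply: (cimg_hs ic); exact: cimg_cmap.
have /cvgrPdist_lt/(_ _ ax0)/near_normP[d' d'0 dE] :=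
  halfspace_continuous hc (x := cmap c x).
case/open_inP: (oc) => chs_ /(_ _ (cimg_cmap cx))[d d0 dc].
(* Within [d'] the functional stays positive, so the ball lies in the half space; within [d] it then
   lies in the image of the chart. *)
pose r := Num.min d d'; have r0 : 0 < r by rewrite lt_min d0.
pose A := [set y | `|y - cmap c x| < r].
have Ahs : A `<=` hs_pos (chs c).
  move=> y; rewrite /A /= lt_min => /andP[_ /dE].
  by have := ler_norm (chs c (cmap c x) - chs c y); rewrite /hs_pos/=; lra.
have Ac : A `<=` cimg c.
  by move=> y Ay; apply: dc; [exact: Ahs|move: Ay; rewrite /A /= lt_min => /andP[]].
have oball (z : c) : forall y, `|y - z| < r -> exists2 e, 0 < e &
    forall y', `|y' - y| < e -> `|y' - z| < r.
  move=> y yz; exists (r - `|y - z|); first by rewrite subr_gt0.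
  by move=> y' yy'; have := ler_distD y y' z; lra.
exists (cst 1), (cdom c `&` cmap c @^-1` A); split.
- apply: (@chart_change X c (cmod c) (cst 1) A [set y : c | `|y| < r]
      (fun y => y - cmap c x) (fun y => y + cmap c x)) => //.
  + by right.
  + apply/open_inP; split=> // y /oball[e e0 eE]; exists e => // y' _.
    exact: eE.
  + apply/open_inP; split=> [y _|y]; first by rewrite /hs_pos/= ler01.
    rewrite /= -{1}(subr0 y) => /oball[e e0 eE]; exists e => // y' _ /eE.
    by rewrite subr0.
  + by move=> y Ay /=; rewrite subrK.
  + by move=> y yr; rewrite /A /= addrK.
- by split=> //; rewrite /A /= subrr normr0.
- by move=> y [].
- by split; right.
Qed.

End chart_constructions.

Section subspaces.
Context {R : realType}.

Lemma bker_submod (E : completeNormedModType R) (V : normedModType R)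
    (u : blin E V) : submod_closed [pred x | x \in [set x | u x = 0]].
Proof.
split=> [|a x y]; first by rewrite !inE /= blin0.
by rewrite !inE /= => ux uy; rewrite blin_linear ux uy scaler0 addr0.
Qed.

Lemma bker_closed (E : completeNormedModType R) (V : normedModType R)
    (u : blin E V) : closed [set x | u x = 0].
Proof.
rewrite -[[set x | _]]/(u @^-1` [set 0]).
apply: closed_comp => [x _|]; first exact: blin_continuous.
exact/accessible_closed_set1/hausdorff_accessible/norm_hausdorff.
Qed.

Definition bker (E : completeNormedModType R) (V : normedModType R)
  (u : blin E V) : closed_subspace E :=
  ClosedSubspace (bker_submod u) (@bker_closed E V u).

Lemma hs_bd_subspace (E : completeNormedModType R) (alpha : E -> R) x :
  halfspace_fun alpha -> alpha x = 0 ->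
  exists F : closed_subspace E, (F : set E) = hs_bd alpha.
Proof.
case=> [[la ca _] _|->]; last by move/eqP; rewrite /= oner_eq0.
have ba : (alpha : E -> R^o) \in (bounded_linear (E := E) (F := R^o)).
  by rewrite inE.
by exists (bker (Blin ba)).
Qed.

Lemma image_subspace (E : completeNormedModType R) (F : closed_subspace E)
    (G : closed_subspace (cs_type F)) :
  exists H : closed_subspace E, (H : set E) = @cs_val _ _ F @` (G : set (cs_type F)).
Proof.
have sG : submod_closed [pred x | x \in @cs_val _ _ F @` (G : set (cs_type F))].
  split=> [|a x y].
    by rewrite !inE /=; exists 0 => //; exact: closed_subspace0.
  rewrite !inE /= => -[v Gv <-] [w Gw <-].
  by exists (a *: v + w) => //; exact: closed_subspace_sub.
have cG : closed (@cs_val _ _ F @` (G : set (cs_type F))).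
  move=> z zG; have Fz : cs_set F z.
    apply: (@cs_closed _ _ F) => B /zG[_ [[v Gv <-] Bv]].
    by exists (cs_val v); split=> //; exact: cs_val_mem.
  exists (insubd 0 z); last exact: cs_insubdK.
  apply: (@cs_closed _ _ G) => B /near_normP[d d0 dB].
  have [|_ [[v Gv <-] vz]] := zG [set y | `|y - z| < d].
    by apply/near_normP; exists d.
  exists v; split=> //; apply: dB.
  by rewrite -[X in X < _]/(`|cs_val v - cs_val (insubd (0 : cs_type F) z)|)
     cs_insubdK.
by exists (ClosedSubspace sG cG).
Qed.

End subspaces.

(** * Tangent spaces, boundaries and neatness of submanifolds *)

Section submanifolds.
Context {R : realType} (p : smoothness) (p1 : smooth_ge1 p) {T : pointedType}
  (X : @mfd R T) (wX : wmfd p X).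

Section one_submanifold.
Context (Y : set T) (sY : submanifold X Y).

Let G (c' : @chart R T) := exists (y : T) (c : @chart R T)
  (F : closed_subspace c) (mu : cs_type F -> R),
  [/\ Y y, adapted X Y y mu & c' = restr_chart mu Y].

Lemma sub_family_wadapted c' : G c' -> exists (c : @chart R T)
  (F : closed_subspace c) (mu : cs_type F -> R),
    wadapted X Y mu /\ c' = restr_chart mu Y.
Proof.
move=> [y [c [F [mu [_ /adapted_wadapted wa cE]]]]].
by exists c, F, mu.
Qed.

Lemma sub_family_cover x : Y x -> exists c, G c /\ cdom c x.
Proof.
have [_ aY] := sY; move=> Yx; have [c [F [mu ad]]] := aY _ Yx.
exists (restr_chart mu Y); split; first by exists x, c, F, mu.
by have [_ [cx _] _ _ _] := ad; split.
Qed.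

Lemma sub_mfd_wmfd : wmfd p (sub_mfd p X Y).
Proof. exact: (restricted_wmfd wX sub_family_wadapted sub_family_cover). Qed.

Lemma sub_mfd_chart y0 (c : @chart R T) (F : closed_subspace c)
    (mu : cs_type F -> R) : Y y0 -> adapted X Y y0 mu ->
  atlas (sub_mfd p X Y) (restr_chart mu Y).
Proof.
move=> Yy ad; have [_ GA] :=
  restricted_manifold wX sub_family_wadapted sub_family_cover.
by apply: GA; exists y0, c, F, mu.
Qed.

Lemma tangent_subP y0 (c : @chart R T) (F : closed_subspace c)
    (mu : cs_type F -> R) y w : Y y0 -> adapted X Y y0 mu -> cdom c y -> Y y ->
  tangent_sub p X Y y w <-> tangent X y w /\ cs_set F (w c).
Proof.
move=> Yy0 ad cy Yy; have [YX _] := sY.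
have Gr : G (restr_chart mu Y) by exists y0, c, F, mu.
exact: (restricted_tangent wX YX sub_family_wadapted sub_family_cover w p1
  (adapted_wadapted ad) Gr cy Yy).
Qed.

Lemma sub_boundaryP y0 (c : @chart R T) (F : closed_subspace c)
    (mu : cs_type F -> R) y : Y y0 -> adapted X Y y0 mu -> cdom c y -> Y y ->
  boundary (sub_mfd p X Y) y <-> mu (insubd 0 (cmap c y)) = 0.
Proof.
move=> Yy0 ad cy Yy.
have ry : chart_at (sub_mfd p X Y) y (restr_chart mu Y).
  by split; [exact: sub_mfd_chart ad|split].
exact: (boundaryP p1 sub_mfd_wmfd ry).
Qed.

(* If [mu] is negative at a point of [F] in the half space, moving from [y] in *)
(* the opposite direction yields a boundary point of [X] interior to [Y].      *)
Lemma neat_adapted y (c : @chart R T) (F : closed_subspace c)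
    (mu : cs_type F -> R) z :
  boundary (sub_mfd p X Y) = Y `&` boundary X -> Y y -> adapted X Y y mu ->
  cimg c z -> cs_set F z -> cut_hs mu z.
Proof.
move=> neat Yy ad cz Fz; have [Xc [cy cy0] _ hmu [e oY]] := ad.
have [icX _ _] := wX; have ic := icX _ Xc.
exists (insubd 0 z); last exact: cs_insubdK.
rewrite /hs_pos /=; have [[lm _ _]|->] := hmu; last exact: ler01.
rewrite leNgt; apply/negP => mz.
have bnd q : cdom c q -> Y q -> mu (insubd 0 (cmap c q)) = 0 <-> chs c (cmap c q) = 0.
  move=> cq Yq; split=> [|cq0].
    move/(sub_boundaryP Yy ad cq Yq); rewrite neat => -[_].
    by move/(boundaryP p1 wX (conj Xc cq)).
  apply/(sub_boundaryP Yy ad cq Yq); rewrite neat; split=> //.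
  exact/(boundaryP p1 wX (conj Xc cq)).
have zero0 : insubd (0 : cs_type F) 0 = 0 by exact: (cs_valK (0 : cs_type F)).
have a0 : chs c 0 = 0.
  by rewrite -cy0; apply/bnd => //; rewrite cy0 zero0 scalar_fun0.
have la : scalar (chs c).
  have [[[]//|h] _ _ _] := ic.
  by move/eqP: a0; rewrite h /= oner_eq0.
have Yc0 : (cmap c @` (cdom c `&` Y)) 0 by rewrite -cy0; exists y.
have [_ /(_ _ Yc0)[d d0 dE]] := (open_inP _ _).1 oY.
pose t := d / 2 / (`|z| + 1); have z1 : 0 < `|z| + 1 by rewrite ltr_wpDl.
have t0 : 0 < t by rewrite !divr_gt0.
pose v : cs_type F := insubd 0 z; have vE : cs_val v = z by exact: cs_insubdK.
have [||q [cq Yq] qE] := dE (- t *: z).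
- exists (- t *: v); last by rewrite -vE.
  by rewrite /hs_pos /= scalar_funZ// mulNr -mulrN mulr_ge0 ?oppr_ge0 ?ltW.
- rewrite subr0 normrZ normrN gtr0_norm// /t.
  rewrite (le_lt_trans (y := d / 2))//; last by lra.
  by rewrite mulrAC ler_pdivrMr// ler_wpM2l ?lerDl// divr_ge0// ltW.
have az : 0 <= chs c z by exact: (cimg_hs ic cz).
have aq : 0 <= chs c (cmap c q) by apply: (cimg_hs ic); exact: cimg_cmap.
have aq0 : chs c (cmap c q) = 0.
  apply/eqP; rewrite eq_le aq andbT qE scalar_funZ// mulNr oppr_le0.
  by rewrite mulr_ge0// ltW.
move/(bnd _ cq Yq): aq0; rewrite qE (_ : insubd 0 _ = - t *: v).
  rewrite scalar_funZ// => /eqP; rewrite mulf_eq0 oppr_eq0 (gt_eqF t0)/=.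
  by rewrite (lt_eqF mz).
apply: val_inj; rewrite /= cs_insubdK; first by rewrite -vE.
exact: closed_subspaceZ.
Qed.

End one_submanifold.

(** With the ambient functional restricted to [L], the half space of [L] is the trace of the ambient
    one, so [S] is cut out by [L] alone. *)
Lemma adapted_of_cut (c : @chart R T) (L : closed_subspace c) (S : set T) x :
  atlas X c -> cdom c x -> cmap c x = 0 -> complemented L ->
  halfspace_fun (fun l : cs_type L => chs c (cs_val l)) ->
  (forall y, cdom c y -> S y <-> cs_set L (cmap c y)) ->
  adapted X S x (fun l : cs_type L => chs c (cs_val l)).
Proof.
move=> Xc cx cx0 cL hL SL; have [icX _ _] := wX; have ic := icX _ Xc.
have e : cmap c @` (cdom c `&` S) =
    cimg c `&` cut_hs (fun l : cs_type L => chs c (cs_val l)).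
  apply/seteqP; split=> [_ [y [cy Sy] <-]|_ [[y cy <-] [l hl lE]]].
    have Ly : cs_set L (cmap c y) by apply/SL.
    split; first exact: cimg_cmap.
    exists (insubd 0 (cmap c y)); last exact: cs_insubdK.
    by rewrite /hs_pos /= cs_insubdK//; apply: (cimg_hs ic); exact: cimg_cmap.
  by exists y => //; split=> //; apply/SL => //; rewrite -lE; exact: cs_val_mem.
split=> //; split=> //; rewrite e.
have [_ _ _ [O oO cO]] := ic; exists O => //; rewrite cO -setIA.
congr (_ `&` _); apply/seteqP; split=> [z []//|_ [l hl <-]].
by split=> //; exists l.
Qed.

End submanifolds.

(** * The boundary as a manifold *)

Section boundary_manifold.
Context {R : realType} (p : smoothness) (p1 : smooth_ge1 p) {T : pointedType}
  (X : @mfd R T) (wX : wmfd p X).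

Let G (c' : @chart R T) := exists (c : @chart R T) (F : closed_subspace c),
  [/\ atlas X c, (F : set c) = hs_bd (chs c) &
      c' = restr_chart (cst 1 : cs_type F -> R) (boundary X)].

(** The constant functional 1 records that the boundary fills the kernel of [chs c] inside the chart
    and has itself no boundary. *)
Lemma boundary_wadapted (c : @chart R T) (F : closed_subspace c) :
  atlas X c -> (F : set c) = hs_bd (chs c) ->
  wadapted X (boundary X) (cst 1 : cs_type F -> R).
Proof.
move=> Xc FE; have [icX _ _] := wX; have ic := icX _ Xc.
have FP z : cs_set F z <-> chs c z = 0 by rewrite FE.
have e : cmap c @` (cdom c `&` boundary X) =
    cimg c `&` cut_hs (cst 1 : cs_type F -> R).
  apply/seteqP; split=> [_ [x [cx bx] <-]|_ [[x cx <-] [l _ lE]]].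
    split; first exact: cimg_cmap.
    have Fx : cs_set F (cmap c x) by apply/FP/(boundaryP p1 wX (conj Xc cx)).
    by exists (insubd 0 (cmap c x)); [exact: ler01|exact: cs_insubdK].
  exists x => //; split=> //; apply/(boundaryP p1 wX (conj Xc cx))/FP.
  by rewrite -lE; exact: cs_val_mem.
split=> //; first by right.
rewrite e; have [_ _ _ [O oO cO]] := ic; exists O => //; rewrite cO -setIA.
congr (_ `&` _); apply/seteqP; split=> [z []//|_ [l hl <-]].
split; last by exists l.
by have /FP := cs_val_mem l; rewrite /hs_pos /= => ->.
Qed.

Lemma boundary_family_wadapted c' : G c' -> exists (c : @chart R T)
  (F : closed_subspace c) (mu : cs_type F -> R),
    wadapted X (boundary X) mu /\ c' = restr_chart mu (boundary X).
Proof.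
move=> [c [F [Xc FE cE]]]; exists c, F, (cst 1); split=> //.
exact: boundary_wadapted.
Qed.

Lemma boundary_subset : boundary X `<=` X.
Proof. by move=> x []. Qed.

Lemma boundary_family_cover x : boundary X x -> exists c, G c /\ cdom c x.
Proof.
move=> bx; have [_ [c [Xc cx ax]]] := bx.
have [icX _ _] := wX; have [ha _ _ _] := icX _ Xc.
have [F FE] := hs_bd_subspace ha ax.
by exists (restr_chart (cst 1 : cs_type F -> R) (boundary X)); split; [exists c, F|split].
Qed.

Lemma boundary_mfd_wmfd : wmfd p (boundary_mfd p X).
Proof.
exact: (restricted_wmfd wX boundary_family_wadapted boundary_family_cover).
Qed.

Lemma boundary_mfd_smap : smap p (boundary_mfd p X) X id.
Proof.
exact: (restricted_smap wX boundary_subset boundary_family_wadapted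
  boundary_family_cover).
Qed.

Lemma boundary_mfd_chart (c : @chart R T) (F : closed_subspace c) :
  atlas X c -> (F : set c) = hs_bd (chs c) ->
  atlas (boundary_mfd p X) (restr_chart (cst 1 : cs_type F -> R) (boundary X)).
Proof.
move=> Xc FE; have [_ GA] :=
  restricted_manifold wX boundary_family_wadapted boundary_family_cover.
by apply: GA; exists c, F.
Qed.

End boundary_manifold.

Section transversality.
Context {R : realType} (p : smoothness) (p1 : smooth_ge1 p) {T T' : pointedType}.

(** [G] is the complement from transversality, read in the chart [r]. Splitting a source vector
    along it, the part in the preimage is sent to [F], so [F] and the image of [G] span; an element
    of [G] sent to [F] lies in both summands and vanishes. *)
Lemma transverse_on_complement (M : @mfd R T) (X' : @mfd R T') (f : T -> T')
    (Y : set T') x (r : @chart R T) (c' : @chart R T') (F : closed_subspace c')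
    (mu : cs_type F -> R) :
  wmfd p M -> wmfd p X' -> smap p M X' f -> submanifold X' Y ->
  chart_at M x r -> Y (f x) -> adapted X' Y (f x) mu ->
  transverse_on p M X' f Y x ->
  exists G : closed_subspace r,
    (forall w, exists a g, [/\ cs_set F a, cs_set G g & w = a + Dr f r c' x g]) /\
    (forall g, cs_set G g -> cs_set F (Dr f r c' x g) -> g = 0).
Proof.
move=> wM wX' sf sY rx Yx ad [spans [Gt [[Gtan G0 Glin] Gcl Gint Gsum]]].
have [Xc' [c'x _] _ _ _] := ad.
have c'x' : chart_at X' (f x) c' by split.
have tsP w : tangent_sub p X' Y (f x) w <-> tangent X' (f x) w /\ cs_set F (w c').
  exact: (tangent_subP p1 wX' sY w Yx ad c'x Yx).
have sG : submod_closed [pred u | u \in dchart r Gt].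
  split=> [|a u w]; first by rewrite !inE /=; exists (@tzero R T).
  rewrite !inE /= => -[v1 G1 <-] [v2 G2 <-].
  by exists (tadd (tscale a v1) v2) => //; exact: Glin.
pose G := ClosedSubspace sG (Gcl _ rx); exists G.
have dE v : tangent M x v -> dmap M X' f x v c' = Dr f r c' x (v r).
  by move=> tv; rewrite (dmapE p1 wM wX' sf tv rx c'x').
split=> [w|g [v Gv <-] Fg].
  have [om tom omE] := tangent_exists p1 w wX' c'x'.
  have [_ [t [[v tv <-] /tsP[_ Ft] omE']]] := (spans om).1 tom.
  have [v1 [v2 [[tv1 /tsP[_ Fv1]] Gv2 vE]]] := (Gsum v).1 tv.
  exists (t c' + Dr f r c' x (v1 r)), (v2 r); split.
  - by apply: closed_subspaceD => //; rewrite -dE.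
  - by exists v2.
  - by rewrite -omE omE' /tadd dE// vE /tadd blinD; abel.
have tv := Gtan _ Gv.
have : dpreimage M X' f x (tangent_sub p X' Y (f x)) v /\ Gt v.
  split=> //; split=> //; apply/tsP; split; last by rewrite dE.
  exact: (dmap_tangent p1 wM wX' sf rx tv).
by move/Gint => ->.
Qed.

(** At a boundary point, transversality concerns the restriction to the boundary, so [G] lies in the
    kernel of the functional and translations along it preserve the half space. At an interior point
    the functional is the constant 1. *)
Lemma transverse_complement (X : @mfd R T) (X' : @mfd R T') (f : T -> T')
    (Y : set T') x (c : @chart R T) (c' : @chart R T') (F : closed_subspace c')
    (mu : cs_type F -> R) :
  wmfd p X -> wmfd p X' -> smap p X X' f -> submanifold X' Y ->
  chart_at X x c -> chs c (cmap c x) = 0 \/ chs c = cst 1 ->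
  Y (f x) -> adapted X' Y (f x) mu -> transverse p X X' f Y x ->
  exists G : closed_subspace c,
    [/\ forall w, exists a g, [/\ cs_set F a, cs_set G g & w = a + Dr f c c' x g],
        forall g, cs_set G g -> cs_set F (Dr f c c' x g) -> g = 0 &
        forall g e, cs_set G g -> chs c (e + g) = chs c e].
Proof.
move=> wX wX' sf sY cx ac Yx ad [//|[_ [Xx nbx] tr]|[_ bx tr]].
  have [G [G1 G2]] := transverse_on_complement wX wX' sf sY cx Yx ad tr.
  exists G; split=> // g e _; case: ac => [ac|->//].
  by case: nbx; exact/(boundaryP p1 wX cx).
have [Xc cx'] := cx; have ax := (boundaryP p1 wX cx).1 bx.
have ic := chart_at_is_chart wX cx; have [ha _ _ _] := ic.
have la : scalar (chs c) by case: ha ax => [[]//|-> /eqP]; rewrite /= oner_eq0.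
have [F0 F0E] := hs_bd_subspace ha ax.
have wa := boundary_wadapted p1 wX Xc F0E.
pose r := restr_chart (cst 1 : cs_type F0 -> R) (boundary X).
have wM := boundary_mfd_wmfd p1 wX; have sM := boundary_mfd_smap p1 wX.
have rx : chart_at (boundary_mfd p X) x r.
  by split; [exact: boundary_mfd_chart|split].
have sMf : smap p (boundary_mfd p X) X' f by exact: (smap_comp wM wX sM sf).
have [G [G1 G2]] := transverse_on_complement wM wX' sMf sY rx Yx ad tr.
have [H HE] := image_subspace G.
have DE g : Dr f r c' x g = Dr f c c' x (cs_val g).
  have [_ fg] := sf; have [Xc' [c'x _] _ _ _] := ad.
  have := Dr_comp (f := id) (g := f) p1 (restr_is_chart ic wa) ic (conj cx' bx)
    (restr_lgood ic wa p cx' bx) (fg _ _ _ cx (conj Xc' c'x)).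
  by rewrite (restr_Dr ic wa p1 cx' bx) => /(congr1 (fun u : blin _ _ => u g)).
exists H; split=> [w|g|g e]; rewrite ?HE.
- have [a [g [Fa Gg ->]]] := G1 w; exists a, (cs_val g); split=> //.
  by rewrite DE.
- by move=> [l Gl <-] Fl; rewrite (G2 l)// DE.
- move=> [l _ <-]; rewrite scalar_funD//.
  by have := cs_val_mem l; rewrite F0E /hs_bd /= => ->; rewrite addr0.
Qed.

End transversality.

(** * Preimages *)

Section straightening.
Context {R : realType} (p : smoothness) (p1 : smooth_ge1 p) {T T' : pointedType}.

(* In the chart [e |-> e + Q (h e - D e)], with [h] the local representation of *)
(* [f], the map [Q \o h] becomes linear because [Q \o D] is a projection.       *)
Lemma straightening_chart (X : @mfd R T) (X' : @mfd R T') (f : T -> T') x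
    (c : @chart R T) (c' : @chart R T') (Q : blin c' c) (D := Dr f c c' x) :
  is_manifold p X -> smap p X X' f -> chart_at X x c -> chart_at X' (f x) c' ->
  cmap c x = 0 -> cmap c' (f x) = 0 ->
  (forall w, Q (D (Q w)) = Q w) -> (forall w e, chs c (e + Q w) = chs c e) ->
  exists (V : set T) (psi : T -> c),
    [/\ atlas X (@Chart R T c (chs c) V psi), V x, psi x = 0 &
      forall y, V y -> cdom c' (f y) /\ Q (cmap c' (f y)) = Q (D (psi y))].
Proof.
move=> mX sf cx c'x cx0 c'fx0 QDQ aQ.
have wX := manifold_wmfd mX; have ic := chart_at_is_chart wX cx.
have [Xc cx'] := cx; have [_ fg] := sf; have [ha _ _ _] := ic.
have lg := fg _ _ _ cx c'x; have [N [oN N0 NE CN]] := lg.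
rewrite cx0 in N0; pose h := rep f c c'.
have hD : is_deriv N h 0 D.
  by rewrite -cx0; apply: is_deriv_sub NE (Dr_is_deriv p1 ic lg).
pose QD := bcomp Q D; pose r e := Q (h e) + (- QD : blin c c) e.
have rE e : r e = Q (h e - D e) by rewrite /r blinB.
have h0 : h 0 = 0 by rewrite /h -cx0 (rep_cmap _ _ ic cx').
have r0 : r 0 = 0 by rewrite rE h0 !blin0 subrr blin0.
have dr0 : is_deriv N r 0 0.
  (* The two summands of [r] contribute [QD] and [- QD]. *)
  rewrite -(subrr QD); apply: is_deriv_add; last exact: is_deriv_blin.
  exact: is_deriv_post.
have Cr : Cp p N r.
  apply: Cp_add; last exact: Cp_blin.
  exact: (Cp_comp (B := setT) (fun _ _ => I) CN (Cp_blin p setT Q)).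
have ar e y : N e -> chs c (y + r e) = chs c y by move=> _; rewrite rE aQ.
have [A [B [chi [oA oB AN A0 [AB BA Cchi]]]]] :=
  halfspace_inverse p1 ha oN N0 ar r0 dr0 Cr.
have NP y : cdom c y -> N (cmap c y) -> cdom c' (f y).
  by move=> cy /NE /(rep_domP _ _ _ ic)[_]; rewrite (cinvK ic cy).
have Ac : A `<=` cimg c by move=> e /AN /NE /(rep_domP _ _ _ ic)[].
exists (cdom c `&` cmap c @^-1` A), ((fun e => e + r e) \o cmap c); split.
- apply: (@chart_change _ p _ X c c (chs c) A B _ chi) => //.
  by apply: Cp_add; [exact: (Cp_blin p A (bid c))|exact: Cp_sub Cr].
- by split=> //=; rewrite cx0.
- by rewrite /= cx0 r0 addr0.
- move=> y [cy /AN Ny]; split; first exact: NP.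
  (* By [QDQ], the operator [Q \o D] sends the correction to [Q (h e - D e)], and the terms
     [Q (D e)] cancel. *)
  rewrite /= rE blinD blinD !blinB QDQ /h (rep_cmap _ _ ic cy) QDQ.
  by abel.
Qed.

End straightening.

(** * Subsets cut out in a centered chart by a complemented subspace *)

Section slices.
Context {R : realType} (p : smoothness) (p1 : smooth_ge1 p) {T : pointedType}
  (X : @mfd R T) (mX : is_manifold p X).

Lemma open_mfd_wmfd (c : @chart R T) : atlas X c -> wmfd p (open_mfd X (cdom c)).
Proof.
have [icX ccX _] := manifold_wmfd mX; move=> Xc; split.
- by move=> c2 [/icX[? ? ? ?] cc2]; split.
- by move=> c2 c3 [? _] [? _]; exact: ccX.
- by move=> x cx; exists c; split=> //; split.
Qed.

Context (c : @chart R T) (L : closed_subspace c) (S : set T) (x0 : T).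
Let alphaL := fun l : cs_type L => chs c (cs_val l).
Hypotheses (Xc : atlas X c) (cx0 : cdom c x0) (cx00 : cmap c x0 = 0)
  (cL : complemented L) (hL : halfspace_fun alphaL) (ScD : S `<=` cdom c)
  (SL : forall y, cdom c y -> S y <-> cs_set L (cmap c y)).

Let wX := manifold_wmfd mX.
Let ic : is_chart X c. Proof. by have [icX _ _] := wX; exact: icX. Qed.

Lemma slice_center : S x0.
Proof. by apply/SL => //; rewrite cx00; exact: closed_subspace0. Qed.

Lemma slice_adapted_center : adapted X S x0 alphaL.
Proof. exact: (adapted_of_cut wX). Qed.

(** Translating by the image of a point of [S], which lies in [L], maps [L] to itself; hence [L]
    still cuts out [S] in the recentered chart. *)
Lemma slice_adapted y : S y -> exists (c2 : @chart R T) (F : closed_subspace c2)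
  (mu : cs_type F -> R), adapted X S y mu /\ cdom c2 `<=` cdom c.
Proof.
move=> Sy; have cy := ScD Sy.
have [beta [D [Xc2 Dy Dc [hb bE]]]] := recenter mX (conj Xc cy).
pose c2 := @Chart R T c beta D (fun z => cmap c z - cmap c y).
exists c2, L, (fun l : cs_type L => beta (cs_val l)); split=> //.
apply: (@adapted_of_cut R p T X wX c2 L S y) => //.
- by rewrite /= subrr.
- by case: bE => [[bE _]|bE]; rewrite /c2 /= bE //; right.
- have Ly : cs_set L (cmap c y) by apply/SL.
  move=> z /Dc cz; apply: (iff_trans (SL cz)); split=> Lz /=.
    exact: closed_subspaceB.
  by rewrite -(subrK (cmap c y) (cmap c z)); exact: closed_subspaceD.
Qed.

Lemma slice_submanifold : submanifold X S.
Proof.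
split=> [y /ScD|y /slice_adapted[c2 [F [mu [ad _]]]]].
  by case: ic => _ + _ _; exact.
by exists c2, F, mu.
Qed.

(** Both boundaries are read in [c]: the functional of the slice is the restriction of that of [c],
    so they vanish at the same points of [S]. *)
Lemma slice_neat : neat_submanifold p (open_mfd X (cdom c)) S.
Proof.
have wV := open_mfd_wmfd Xc.
have adV y (c2 : @chart R T) (F : closed_subspace c2) (mu : cs_type F -> R) :
    adapted X S y mu -> cdom c2 `<=` cdom c ->
    adapted (open_mfd X (cdom c)) S y mu.
  by case=> ? ? ? ? ? ?; split.
have sV : submanifold (open_mfd X (cdom c)) S.
  split=> // y /slice_adapted[c2 [F [mu [ad cc2]]]].
  by exists c2, F, mu; exact: adV.
split=> //; have ad0 := adV _ _ _ _ slice_adapted_center (fun _ => id).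
apply/seteqP; split=> y.
  move=> by_; have Sy : S y by case: by_.
  split=> //; have cy := ScD Sy.
  apply/(boundaryP p1 wV (conj (conj Xc (fun _ => id)) cy)).
  move/(sub_boundaryP p1 wV sV slice_center ad0 cy Sy): by_.
  by rewrite /alphaL cs_insubdK//; apply/SL.
move=> [Sy by_]; have cy := ScD Sy.
apply/(sub_boundaryP p1 wV sV slice_center ad0 cy Sy).
rewrite /alphaL cs_insubdK; last by apply/SL.
by apply/(boundaryP p1 wV (conj (conj Xc (fun _ => id)) cy)).
Qed.

Let W := [set l : cs_type L | cimg c (cs_val l)].
Let g := fun l : cs_type L => cinv c (cs_val l).
Let r := restr_chart alphaL S.
Let ir : is_chart S r.
Proof. exact: (restr_is_chart ic (adapted_wadapted slice_adapted_center)). Qed.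

Lemma slice_cimg : cimg r = W.
Proof.
have rP := restr_cimgP (adapted_wadapted slice_adapted_center).
apply/seteqP; split=> l.
  by move=> /rP[y [cy _] yE]; exists y.
move=> [y cy yE]; apply/rP; exists y => //; split=> //.
by apply/SL => //; rewrite yE; exact: cs_val_mem.
Qed.

Lemma slice_open : open_in (hs_pos alphaL) W.
Proof. by rewrite -slice_cimg; case: ir. Qed.

Lemma sliceP l : W l -> cdom c (g l) /\ cmap c (g l) = cs_val l.
Proof. exact: (cimgP ic). Qed.

Lemma slice_image : g @` W = S.
Proof.
apply/seteqP; split=> [_ [l Wl <-]|y Sy].
  by have [cy yE] := sliceP Wl; apply/SL => //; rewrite yE; exact: cs_val_mem.
have cy := ScD Sy; have Ly : cs_set L (cmap c y) by apply/SL.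
exists (insubd 0 (cmap c y)).
  by rewrite /W /= cs_insubdK//; exact: cimg_cmap.
by rewrite /g cs_insubdK// (cinvK ic).
Qed.

Let idc := @Chart R (cs_type L) (cs_type L) alphaL W id.

Let id_chart : is_chart W idc.
Proof.
split=> //.
have -> : cimg idc = W by rewrite /cimg /= image_id.
exact: slice_open.
Qed.

Lemma slice_halfspace_mfd : is_manifold p (halfspace_mfd p alphaL W) /\
  atlas (halfspace_mfd p alphaL W) idc.
Proof.
have [mW GA] : is_manifold p (halfspace_mfd p alphaL W) /\
    (forall c0, c0 = idc -> max_atlas p W (fun c => c = idc) c0).
  apply: generated_manifold => [_ ->//|_ _ -> ->|l Wl]; last by exists idc.
  by apply: (compatible_lgood id_chart id_chart) => l Wl _;
     exact: (lgood_refl p id_chart).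
by split=> //; exact: GA.
Qed.

Lemma slice_embedding : embedding p (halfspace_mfd p alphaL W) X g.
Proof.
have [mW aW] := slice_halfspace_mfd.
have idcK l : W l -> cinv idc l = l.
  by move=> Wl; have := cinvK id_chart (x := l) Wl.
have idim : cimg idc = W by rewrite /cimg /= image_id.
have gS l : W l -> S (g l) by move=> Wl; rewrite -slice_image; exists l.
have Sr : atlas (sub_mfd p X S) r.
  exact: (sub_mfd_chart wX slice_submanifold slice_center slice_adapted_center).
have SX : S `<=` X by case: slice_submanifold.
have Cid (A : set (cs_type L)) h : (forall l, A l -> h l = l) -> Cp p A h.
  move=> hE; apply: (@Cp_ext _ _ _ _ _ (bid (cs_type L))); last exact: Cp_blin.
  by move=> l Al; rewrite hE.
rewrite /embedding /diffeo slice_image; split.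
- split=> [_ [l Wl <-]|l Wl]; first by apply/SX/gS.
  exists idc, c; split=> //.
  + by split=> //; have [] := sliceP Wl.
  + by move=> _ [l' Wl' <-]; have [] := sliceP Wl'.
  + apply: (@Cp_ext _ _ _ _ _ (bval L)); last exact: Cp_blin.
    by move=> l'; rewrite idim => Wl'; rewrite /rep /= idcK//; have [_ ->] := sliceP Wl'.
- exact: slice_submanifold.
split.
  split=> [_ [l Wl <-]|l Wl]; first exact: gS.
  have rg l' : W l' -> cdom r (g l').
    by move=> Wl'; split; [have [] := sliceP Wl'|exact: gS].
  exists idc, r; split=> //.
  + by split=> //; exact: rg.
  + by move=> _ [l' Wl' <-]; exact: rg.
  + apply: Cid => l'; rewrite idim => Wl'; rewrite /rep /= idcK//.
    by have [_ ->] := sliceP Wl'; exact: cs_valK.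
(* The inverse of [g] is the restricted chart map, whose local representation is the identity. *)
pose k : T -> cs_type L := cmap r.
have kW y : S y -> W (k y).
  by move=> Sy; rewrite -slice_cimg; apply: cimg_cmap; split=> //; exact: ScD.
have kval y : S y -> cs_val (k y) = cmap c y.
  by move=> Sy; apply: cs_insubdK; apply/SL => //; exact: ScD.
exists k; split.
- split=> [_ [y Sy <-]|y Sy]; first exact: kW.
  exists r, idc; split=> //.
  + by split=> //; split=> //; exact: ScD.
  + by split=> //; exact: kW.
  + by move=> _ [y' [_ Sy'] <-]; exact: kW.
  + by apply: Cid => l' rl'; have [_] := cimgP ir rl'.
- move=> l; rewrite inE => Wl; have [_ gE] := sliceP Wl.
  by rewrite /k /r /= gE; exact: cs_valK.
- move=> y; rewrite inE => Sy; rewrite /g kval//.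
  by rewrite (cinvK ic)//; exact: ScD.
Qed.

End slices.

(** * The preimage of a neat submanifold under a transverse map *)

Theorem theorem1 (R : realType) (p : smoothness) (T T' : pointedType)
    (X : @mfd R T) (X' : @mfd R T') (X'' : set T') (f : T -> T') (x0 : T) :
  smooth_ge1 p -> is_manifold p X -> is_manifold p X' ->
  neat_submanifold p X' X'' -> Cp_map p X X' f ->
  mset X x0 -> X'' (f x0) -> transverse p X X' f X'' x0 ->
  exists c : chart T,
    [/\ atlas X c, cdom c x0, cmap c x0 = 0 &
    exists L : closed_subspace c,
      let V := cdom c in
      let alphaL := fun l : cs_type L => chs c (cs_val l) in
      let W := [set l : cs_type L | cimg c (cs_val l)] in
      let g := fun l : cs_type L => cinv c (cs_val l) in
      let S := V `&` cmap c @^-1` (cimg c `&` L) in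
      [/\ (L : set c) = dchart c
            (dpreimage X X' f x0 (tangent_sub p X' X'' (f x0))),
          complemented L,
          [/\ open_in (hs_pos alphaL) W,
              is_manifold p (halfspace_mfd p alphaL W),
              embedding p (halfspace_mfd p alphaL W) X g,
              g @` W = S & submanifold X S],
          S = V `&` f @^-1` X'' /\
          (forall x, V x -> X'' (f x) ->
             let TX''_x := dpreimage X X' f x (tangent_sub p X' X'' (f x)) in
             (forall v, tangent_sub p X (V `&` f @^-1` X'') x v <-> TX''_x v) /\
             (forall v, TX''_x v <-> tangent X x v /\ cs_set L (v c))) &
          neat_submanifold p (open_mfd X V) (V `&` f @^-1` X'')]].
Proof.
move=> p1 mX mX' [sX'' neat] Cf Xx0 X''x0 tr.
have wX := manifold_wmfd mX; have wX' := manifold_wmfd mX'.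
have sf := Cp_map_smap wX wX' Cf.
have [_ aX''] := sX''; have [c' [F [mu ad]]] := aX'' _ X''x0.
have [Xc' [c'x0 c'0] _ _ _] := ad.
have ic' : is_chart X' c' by have [icX' _ _] := wX'; exact: icX'.
have c'x : chart_at X' (f x0) c' by split.
have cutF z : cimg c' z -> cs_set F z -> cut_hs mu z.
  exact: (neat_adapted p1 wX' sX'' neat X''x0 ad).
(* By neatness, [X''] is given in [c'] by membership in [F] alone. *)
have X''F y : cdom c' y -> X'' y <-> cs_set F (cmap c' y).
  move=> cy; split=> [Yy|Fy].
    have [v _ <-] := wadapted_cut (adapted_wadapted ad) cy Yy.
    exact: cs_val_mem.
  have [_ _ _ _ [e _]] := ad.
  have : (cimg c' `&` cut_hs mu) (cmap c' y).
    by split; [exact: cimg_cmap|apply: cutF => //; exact: cimg_cmap].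
  rewrite -e => -[z [cz Yz] /(cmap_inj ic' cz cy) zy].
  by rewrite -zy.
have [_ _ /(_ _ Xx0)[c1 c1x]] := wX.
(* After recentering, the functional vanishes at the image of [x0] or is the constant 1, the
   alternative required by [transverse_complement]. *)
have [beta [V0 [Xc0 V0x0 _ [hb bE]]]] := recenter mX c1x.
set c0 := Chart _ _ _ in Xc0.
have c0x : chart_at X x0 c0 by split.
have c00 : cmap c0 x0 = 0 by rewrite /= subrr.
have ac0 : chs c0 (cmap c0 x0) = 0 \/ chs c0 = cst 1.
  rewrite c00; case: bE => [[bE bE0]|bE]; [left|by right].
  rewrite /= bE; apply: scalar_fun0.
  have [icX _ _] := wX; have [hc1 _ _ _] := icX _ c1x.1.
  by case: hc1 bE0 => [[]//|-> /eqP]; rewrite /= oner_eq0.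
have [G [G1 G2 aG]] :=
  transverse_complement p1 wX wX' sf sX'' c0x ac0 X''x0 ad tr.
pose D := Dr f c0 c' x0.
have [Q [QG QD QF]] := splitting_retraction (D := D) G1 G2.
have QDQ w : Q (D (Q w)) = Q w by apply: QD.
have aQ w e : chs c0 (e + Q w) = chs c0 e by apply: aG.
have [V [psi [Xc Vx0 psi0 Vpsi]]] :=
  straightening_chart p1 mX sf c0x c'x c00 c'0 QDQ aQ.
pose c := @Chart R T c0 beta V psi.
pose L : closed_subspace c := bker (bcomp Q D).
have LP u : cs_set L u <-> Q (D u) = 0 by [].
have cx0 : chart_at X x0 c by split.
have ic := chart_at_is_chart wX cx0.
have SL x : V x -> X'' (f x) <-> cs_set L (psi x).
  move=> Vx; have [c'fx QE] := Vpsi _ Vx.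
  apply: (iff_trans (X''F _ c'fx)); apply: (iff_trans (QF _)).
  by rewrite QE.
have projL e : cs_set L (e - Q (D e)) by apply/LP; rewrite !blinB QDQ subrr.
(* [Q \o D] is a projection onto [G], so [G] complements its kernel [L]. *)
have cL : complemented L.
  exists G; split; apply/seteqP; split=> //.
  - move=> g [/LP Lg Gg]; rewrite -[g]QD//; exact: Lg.
  - by move=> _ ->; split; [apply/LP; rewrite !blin0|exact: closed_subspace0].
  - move=> e _; exists (e - Q (D e)); first exact: projL.
    by exists (Q (D e)); [exact: QG|rewrite subrK].
have hL : halfspace_fun (fun l : cs_type L => chs c (cs_val l)).
  rewrite /=; case: hb => [[lb cb [e be]]|->]; last by right.
  left; split.
  - by move=> a l l'; rewrite -lb.
  - move=> l; apply: (@continuous_comp _ _ _ (bval L) beta); last exact: cb.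
    exact: blin_continuous.
  (* Projecting to [L] changes a vector only along [G], so the functional keeps its nonzero value at
     [e]. *)
  - exists (insubd 0 (e - Q (D e))); rewrite cs_insubdK; last exact: projL.
    by rewrite -blinN -blinN; rewrite [beta _]aQ.
pose S := V `&` f @^-1` X''.
have SV : S `<=` cdom c by move=> x [].
have ScL x : cdom c x -> S x <-> cs_set L (cmap c x).
  move=> Vx; split=> [[_ /(SL _ Vx)]//|Lx].
  by split=> //; apply/(SL _ Vx).
have SE : S = V `&` cmap c @^-1` (cimg c `&` L).
  apply/seteqP; split=> x [Vx Sx]; split=> //.
    by split; [exact: (cimg_cmap (c := c))|exact/(ScL _ Vx)].
  by case: Sx => _ /(ScL _ Vx)[].
have TX x : V x -> X'' (f x) -> forall v,
    dpreimage X X' f x (tangent_sub p X' X'' (f x)) v <->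
    tangent X x v /\ cs_set L (v c).
  move=> Vx X''fx v; have [c'fx QE] := Vpsi _ Vx.
  have cx : chart_at X x c by split.
  have c'fx' : chart_at X' (f x) c' by split.
  have [_ fg] := sf; have lg := fg _ _ _ cx c'fx'.
  (* In the chart [c], the map [Q] after the local representation of [f] coincides with the linear
     map [Q \o D]; uniqueness of derivatives gives the same derivative at every [x] in [V]. *)
  have QDx u : Q (Dr f c c' x u) = Q (D u).
    have [N [oN Nx NE _]] := lg; have [hc _ _ _] := ic.
    have h1 : is_deriv N (fun z => Q (rep f c c' z)) (cmap c x)
        (bcomp Q (Dr f c c' x)).
      by apply: is_deriv_post; apply: is_deriv_sub NE (Dr_is_deriv p1 ic lg).
    have h2 : is_deriv N (fun z => Q (rep f c c' z)) (cmap c x) (bcomp Q D).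
      apply: (@is_deriv_ext _ _ _ _ (bcomp Q D)) => //; last exact: is_deriv_blin.
      move=> z /NE [y [Vy c'y] <-]; rewrite (rep_cmap _ _ ic Vy).
      by have [_ ->] := Vpsi _ Vy.
    have := is_deriv_unique hc oN Nx h1 h2.
    by move/(congr1 (fun w : blin _ _ => w u)).
  have dE : tangent X x v -> dmap X X' f x v c' = Dr f c c' x (v c).
    by move=> tv; rewrite (dmapE p1 wX wX' sf tv cx c'fx').
  have tP w := tangent_subP p1 wX' sX'' w X''x0 ad c'fx X''fx.
  split=> [[tv /tP[_]]|[tv /LP Lv]].
    by rewrite dE// => /QF; rewrite QDx.
  split=> //; apply/tP; split; first exact: (dmap_tangent p1 wX wX' sf cx tv).
  by rewrite dE//; apply/QF; rewrite QDx.
exists c; split=> //; exists L; rewrite /= -/S; split=> //.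
- apply/seteqP; split=> [u Lu|u [v]].
    have [v tv vE] := tangent_exists p1 (u : c) wX cx0.
    by exists v => //; apply/(TX _ Vx0 X''x0); split=> //; rewrite vE.
  by move=> /(TX _ Vx0 X''x0)[_ Lv] <-.
- rewrite -/c -SE; split.
  + exact: (slice_open mX Xc Vx0 psi0 cL hL ScL).
  + exact: (slice_halfspace_mfd mX Xc Vx0 psi0 cL hL ScL).1.
  + exact: (slice_embedding mX Xc Vx0 psi0 cL hL SV ScL).
  + exact: (slice_image mX Xc SV ScL).
  + exact: (slice_submanifold mX Xc cL hL SV ScL).
- split; first by rewrite -SE.
  move=> x Vx X''fx; split=> v; last exact: (TX _ Vx X''fx).
  apply: iff_sym; apply: (iff_trans (TX _ Vx X''fx v)); apply: iff_sym.
  have sS := slice_submanifold mX Xc cL hL SV ScL.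
  have adS := slice_adapted_center mX Xc Vx0 psi0 cL hL ScL.
  have Sx0 := slice_center (c := c) Vx0 psi0 ScL.
  exact: (tangent_subP p1 wX sS v Sx0 adS Vx (conj Vx X''fx)).
- exact: (slice_neat p1 mX Xc Vx0 psi0 cL hL SV ScL).
Qed.
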